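(* Let $H=H_{l,\phi}$ be a Hamburger Hamiltonian in limit circle case with lengths $(l_j)_{j=1}^\infty$ and angles $(\phi_j)_{j=1}^\infty$. Suppose that $$l_j\asymp d_l(j),\qquad |\sin(\phi_{j+1}-\phi_j)|\asymp d_\phi(j)$$ for sufficiently large $j$, where $d_l,d_\phi:[1,\infty)\to(0,\infty)$ are regularly varying with indices $-\delta_l$ and $-\delta_\phi$, respectively. Assume that $d_\phi(t)$ is $\sim$ to a nonincreasing function as $t\to\infty$. Set $$k(r)=\left[\frac1{d_l d_\phi}\right]^-(r),\qquad m(r)=r\int_{\left[\frac{d_\phi}{d_l}\right]^-(r)}^\infty d_l(x)\,dx .$$ If $1<\delta_l+\delta_\phi<2$, then the following statements hold. (i) In general, for sufficiently large $r$, $$k(r)\lesssim\max_{|z|=r}\log\|W_H(z)\|\lesssim m(r).$$ In particular, $\frac1{\delta_l+\delta_\phi}\le\rho_H\le\frac{1-\delta_\phi}{\delta_l-\delta_\phi}$. (ii) If there is $\psi\in\mathbb R$ such that $|\sin(\phi_j-\psi)|\lesssim|\sin(\phi_{j+1}-\phi_j)|$, and if $\delta_l>1$, then for sufficiently large $r$ $$\max_{|z|=r}\log\|W_H(z)\|\asymp k(r).$$ In particular, $\rho_H=\frac1{\delta_l+\delta_\phi}$. (iii) If, for sufficiently large $j$, $\phi_j$ is monotone with $|\phi_{j+1}-\phi_j|\asymp|\sin(\phi_{j+1}-\phi_j)|\asymp d_\phi(j)$, and if $\delta_\phi>0$, then for sufficiently large $r$ $$\max_{|z|=r}\log\|W_H(z)\|\asymp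 m(r).$$ In particular, $\rho_H=\frac{1-\delta_\phi}{\delta_l-\delta_\phi}$.
   Context: **Hamburger Hamiltonians.** Let $(l_j)_{j=1}^\infty$ be a summable sequence of positive numbers (lengths) and $(\phi_j)_{j=1}^\infty$ a sequence of real numbers (angles) with $\phi_{j+1}-\phi_j\not\equiv 0 \bmod \pi$ for all $j$. Put $x_0=0$, $x_n=\sum_{j=1}^n l_j$, $L=\sum_{j=1}^\infty l_j<\infty$, and $\xi_\phi=(\cos\phi,\sin\phi)^\top$. The Hamburger Hamiltonian $H=H_{l,\phi}$ is the $2\times2$ matrix function on $(0,L)$ with $H_{l,\phi}(t)=\xi_{\phi_j}\xi_{\phi_j}^\top$ for $x_{j-1}\le t<x_j$, $j\ge1$. Limit circle case means $L<\infty$. **Monodromy matrix and order.** Let $J=\begin{pmatrix}0&-1\\1&0\end{pmatrix}$. For $z\in\mathbb C$ let $W_H(t;z)$ be the solution of $\frac{d}{dt}W_H(t;z)J=zW_H(t;z)H(t)$ for a.e. $t\in[0,L]$, $W_H(0;z)=I$. The monodromy matrix is $W_H(z)=W_H(L;z)$; it is entire in $z$. Its order is $\rho_H=\limsup_{r\to\infty}\frac{\log\log\max_{|z|=r}\|W_H(z)\|}{\log r}$. **Regular variation.** A measurable function $a:[1,\infty)\to(0,\infty)$ is regularly varying (at $\infty$) with index $\alpha\in\mathbb R$ if $\lim_{r\to\infty}a(\lambda r)/a(r)=\lambda^\alpha$ for all $\lambda>0$. If $\alpha>0$, set $a^-(x)=\sup\{t\in[1,\infty): a(t)<x\}$ (an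 asymptotic inverse of $a$). **Comparison.** $f\lesssim g$ means that there is a constant $C>0$ with $f\le Cg$ (for all values of the argument, unless restricted); $f\gtrsim g$ means $g\lesssim f$; $f\asymp g$ means both; $f\sim g$ means $f/g\to1$. ''For sufficiently large $x$'' means that there is $x_0$ such that the relation holds on $\{x\ge x_0\}$. *)

(* Defs.v *)
From HB Require Import structures.
From mathcomp Require Export all_boot all_order all_algebra.
From mathcomp Require Export complex.
From mathcomp Require Export all_classical all_reals all_analysis.

Set Implicit Arguments.
Unset Strict Implicit.
Unset Printing Implicit Defensive.

Import Order.TTheory GRing.Theory Num.Theory.
Import numFieldNormedType.Exports.
Import Normc.

Local Open Scope classical_set_scope.
Local Open Scope ring_scope.

Definition lesssim {R : realType} {T : Type} (F : set_system T)
    (f g : T -> R) : Prop :=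
  exists2 C : R, 0 < C & \forall x \near F, f x <= C * g x.

Definition asymp {R : realType} {T : Type} (F : set_system T)
    (f g : T -> R) : Prop :=
  lesssim F f g /\ lesssim F g f.

(* [R] carrying the sigma-algebra of Lebesgue (not just Borel) measurable sets,
   on which [completed_lebesgue_measure] is defined. *)
Definition lebesgueType (R : realType) : measurableType _ :=
  caratheodory_type ((@wlength R idfun)^*)%mu.

(* Only the values of [a] on [1, +oo) matter. *)
Definition regularly_varying {R : realType} (a : R -> R) (alpha : R) : Prop :=
  [/\ forall t, 1 <= t -> 0 < a t,
      @measurable_fun _ _ (lebesgueType R) R `[1, +oo[ a &
      forall lam, 0 < lam ->
        a (lam * r) / a r @[r --> +oo] --> lam `^ alpha].

Definition asymptotic_inverse {R : realType} (a : R -> R) (x : R) : R :=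
  sup [set t | 1 <= t /\ a t < x].

Definition equiv_nonincreasing {R : realType} (a : R -> R) : Prop :=
  exists g : R -> R,
    (forall s t, 1 <= s -> s <= t -> g t <= g s) /\
    a t / g t @[t --> +oo] --> (1 : R).

Definition rate_k {R : realType} (dl dphi : R -> R) (r : R) : R :=
  asymptotic_inverse (fun t => 1 / (dl t * dphi t)) r.

Definition rate_m {R : realType} (dl dphi : R -> R) (r : R) : R :=
  r * \int[@completed_lebesgue_measure R]_(x in
        [set x | asymptotic_inverse (fun t => dphi t / dl t) r <= x]) dl x.

(* Sequences are indexed from 1: the entries [l 0] and [phi 0] are never used. *)
Definition hnode {R : realType} (l : nat -> R) (n : nat) : R :=
  \sum_(1 <= j < n.+1) l j.

Definition hlen {R : realType} (l : nat -> R) : R := limn (hnode l).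

Definition xi {R : realType} (phi : R) : 'cV[R]_2 :=
  \col_(i < 2) (if i == 0 then cos phi else sin phi).

(* The index [j] is unique when [0 <= t < hlen l] and junk otherwise. *)
Definition hamburger {R : realType} (l phi : nat -> R) (t : R) : 'M[R]_2 :=
  let j := get [set j : nat | (1 <= j)%N /\ hnode l j.-1 <= t < hnode l j] in
  xi (phi j) *m (xi (phi j))^T.

Definition limit_circle_hamburger {R : realType} (l phi : nat -> R) : Prop :=
  [/\ forall j, (1 <= j)%N -> 0 < l j,
      cvgn (hnode l) &
      forall j (k : int), (1 <= j)%N -> phi j.+1 - phi j <> k%:~R * pi].

Definition Jmx (K : pzRingType) : 'M[K]_2 :=
  \matrix_(i < 2, j < 2)
    (if (i == 0) && (j == 1) then -1 else if (i == 1) && (j == 0) then 1 else 0).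

Definition absolutely_continuous {R : realType} (a b : R) (f : R -> R[i]) :
    Prop :=
  forall e : R, 0 < e -> exists2 d : R, 0 < d &
    forall (n : nat) (u v : nat -> R),
      (forall i, (i < n)%N -> [/\ a <= u i, u i <= v i & v i <= b]) ->
      classical_sets.trivIset [set i | (i < n)%N] (fun i => `]u i, v i[%classic) ->
      \sum_(0 <= i < n) (v i - u i) < d ->
      \sum_(0 <= i < n) normc (f (v i) - f (u i)) < e.

Definition is_cderive {R : realType} (f : R -> R[i]) (t : R) (df : R[i]) :
    Prop :=
  is_derive t (1 : R) (fun s => complex.Re (f s)) (complex.Re df) /\
  is_derive t (1 : R) (fun s => complex.Im (f s)) (complex.Im df).

(* The solution is meant in the Caratheodory sense: an absolutely continuous
   function satisfying the equation almost everywhere. *)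
Definition is_fundamental_solution {R : realType} (H : R -> 'M[R]_2) (L : R)
    (z : R[i]) (W : R -> 'M[R[i]]_2) : Prop :=
  [/\ W 0 = 1%:M,
      forall i j, absolutely_continuous 0 L (fun t => W t i j) &
      {ae @lebesgue_measure R, forall t : R, 0 <= t <= L ->
        forall i j : 'I_2,
          is_cderive (fun s => (W s *m Jmx R[i]) i j) t
            ((z *: (W t *m map_mx (real_complex R) (H t))) i j)}].

Definition l2norm {R : realType} {n : nat} (v : 'cV[R[i]]_n) : R :=
  Num.sqrt (\sum_(i < n) normc (v i 0) ^+ 2).

Definition opnorm {R : realType} {n : nat} (A : 'M[R[i]]_n) : R :=
  sup [set l2norm (A *m v) | v in [set v : 'cV[R[i]]_n | l2norm v = 1]].

Definition max_circle {R : realType} (f : R[i] -> R) (r : R) : R :=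
  sup [set f z | z in [set z : R[i] | normc z = r]].

Definition log_growth {R : realType} (M : R[i] -> 'M[R[i]]_2) : R -> R :=
  max_circle (fun z => ln (opnorm (M z))).

Definition growth_order {R : realType} (M : R[i] -> 'M[R[i]]_2) : \bar R :=
  limf_esup
    (fun r : R => (ln (ln (max_circle (fun z => opnorm (M z)) r)) / ln r)%:E)
    (pinfty_nbhs R).

(* Main.v *)
(* Along each interval of constancy the system is nilpotent, so a row (u1, u2)
   of the monodromy matrix is obtained by iterating
     u := u + z l_j (u . xi_j) eta_j,   eta_j = (- sin phi_j, cos phi_j),
   where s_j = |sin (phi_(j+1) - phi_j)| governs the change of direction.
   Upper bounds.  Let n be the index where r l_n ~ s_n.  Writing u = (p, q) in
   the frame (xi_j, eta_j), the weighted norm A_j |p| + |q| grows at step j at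
   most by the factor (1 + r l_j / A_j) (1 + 2 s_j A_j).  Up to n one takes
   A_j = (n/j)^gamma with gamma = (delta_l - delta_phi) / 2, which makes both
   errors summable to O(n s_n) exactly because delta_l + delta_phi < 2; after n
   a fixed frame costs r sum_(j > n) l_j, and this is m(r).  If sin (phi_j - psi)
   is dominated by s_j, as in (ii), the frame of psi with the constant weight
   1/s_n, where r l_n s_n ~ 1, costs only O(n) = O(k(r)).
   Lower bounds.  For z = iy put S = Im (q conj p), E = |p|^2 + |q|^2.  Then
   S_j = S_(j-1) + y l_j |p_j|^2, and |p_j p_(j+1)| >= s_j S_j forces S to be
   multiplied by 1 + y^2 l_j l_(j+1) s_j^2 at each step, hence growth exp (c n)
   with n ~ k(r).  If phi is monotone, u rotates through all directions and
   E + S + w_j Re (p conj q), with w_j a smoothed version of y l_j / s_j, grows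
   by 1 + c y l_j at each step with y l_j <= s_j, which gives exp (c m(y)).
   Regular variation enters through the Potter bounds only. *)

Require Import Defs.
From mathcomp Require Import ring lra zify measurable_realfun.

Import Order.TTheory GRing.Theory Num.Theory.
Import numFieldNormedType.Exports.
Import Normc.

Set Implicit Arguments.
Unset Strict Implicit.
Unset Printing Implicit Defensive.

Local Open Scope classical_set_scope.
Local Open Scope ring_scope.

(** * Absolutely continuous functions and the monodromy matrix *)

(** Solutions are only absolutely continuous, so the recursion for the rows rests on an integration
    theorem: an absolutely continuous function whose derivative is almost everywhere a constant is
    affine. Regular variation gives one limit per ratio, without monotonicity or continuity; a
    measure argument makes the ratios locally bounded, which yields the Potter bounds. From there
    the norm estimates speak of sequences: [decays] states Potter bounds from index 1 on and passes
    through [asymp] to l_j and s_j themselves. Finite total length forces delta_l >= 1, and delta_l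
    + delta_phi < 2 then gives delta_phi < 1 and delta_phi < delta_l. The boundary case delta_l = 1
    remains possible in (i) and (iii); there the tail of the lengths can be much larger than n l_n,
    so the estimates with m(r) are phrased with the tail itself. Growth is a supremum over a circle,
    so a lower bound for it makes sense only beside some upper bound; the lower estimates borrow
    theirs from m(r). *)

Lemma creeping (R : realType) (a b : R) (P : R -> Prop) : a <= b -> P a ->
  (forall x, a <= x <= b -> exists2 d : R, 0 < d & forall u v,
     a <= u -> u <= x -> x <= v -> v <= b -> x - d < u -> v < x + d ->
     P u -> P v) -> P b.
Proof.
move=> ab Pa H.
pose A := [set t | a <= t <= b /\ P t].
have hA : has_sup A.
  split; first by exists a; split; rewrite ?lexx.
  by exists b => t [/andP[]].
set T := sup A.
have aT : a <= T by apply: ub_le_sup; [case: hA | split; rewrite ?lexx].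
have Tb : T <= b by apply: ge_sup; [case: hA | move=> t [/andP[]]].
(* The hypothesis at the supremum [T] leads in one move from a good point just below [T] to any
   point just above it. Unless [T = b], this produces a good point beyond the supremum. *)
have [|d d0 Hd] := H T; first by rewrite aT.
have [t [/andP[at_ tb] Pt] Tt] := sup_adherent d0 hA.
have tT : t <= T by apply: ub_le_sup; [case: hA | split; rewrite ?at_].
have PT v : T <= v -> v <= b -> v < T + d -> P v.
  by move=> Tv vb vd; apply: (Hd t v).
have [Tb'|bT] := ltP T b; last by apply: PT; lra.
pose v := Num.min b (T + d / 2).
have Tv : T < v by rewrite /v lt_min Tb'; lra.
have vb : v <= b by rewrite /v ge_min lexx.
have vd : v <= T + d / 2 by rewrite /v ge_min lexx orbT.
have Pv : P v by apply: PT; lra.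
have : v <= T by apply: ub_le_sup; [case: hA | split => //; apply/andP; split; lra].
lra.
Qed.

Definition real_ac {R : realType} (a b : R) (f : R -> R) : Prop :=
  forall e : R, 0 < e -> exists2 d : R, 0 < d &
    forall (n : nat) (u v : nat -> R),
      (forall i, (i < n)%N -> [/\ a <= u i, u i <= v i & v i <= b]) ->
      trivIset [set i | (i < n)%N] (fun i => `]u i, v i[%classic) ->
      \sum_(0 <= i < n) (v i - u i) < d ->
      \sum_(0 <= i < n) `|f (v i) - f (u i)| < e.

(** Straddle lemma: as [u] and [v] lie on opposite sides of [x], the two chord errors carry the
    weights [v - x] and [x - u], which add up to [v - u]. For two points on the same side such a
    bound can fail. *)
Lemma is_derive_local (R : realType) (f : R -> R) (x c e : R) : 0 < e ->
  is_derive x 1 f c -> exists2 d : R, 0 < d & forall u v,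
    u <= x -> x <= v -> x - d < u -> v < x + d ->
    `|f v - f u - c * (v - u)| <= e * (v - u).
Proof.
move=> e0 /is_derive1_caratheodory[g [fE gc <-]].
have /cvgrPdist_le/(_ _ e0)/nbhs_ballP[d /= d0 Hd] := gc.
exists d => // u v ux xv du vd.
have gu : `|g x - g u| <= e by apply: Hd; rewrite /ball/= ltr_norml; lra.
have gv : `|g x - g v| <= e by apply: Hd; rewrite /ball/= ltr_norml; lra.
have -> : f v - f u - g x * (v - u)
    = (g v - g x) * (v - x) + (g u - g x) * (x - u).
  have -> : f v - f u = (f v - f x) - (f u - f x) by ring.
  by rewrite !fE; ring.
rewrite (le_trans (ler_normD _ _))// !normrM (distrC (g v)) (distrC (g u)).
rewrite (ger0_norm (_ : 0 <= v - x)) ?subr_ge0// (ger0_norm (_ : 0 <= x - u)) ?subr_ge0//.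
have h1 : `|g x - g v| * (v - x) <= e * (v - x) by rewrite ler_wpM2r// subr_ge0.
have h2 : `|g x - g u| * (x - u) <= e * (x - u) by rewrite ler_wpM2r// subr_ge0.
lra.
Qed.

(* Off a null set covered by an open set U of small measure, f moves at speed c up
   to e; inside U absolute continuity bounds the total displacement.  The two
   kinds of increments are accumulated by a creeping argument. *)
Lemma real_ac_const_derive (R : realType) (f : R -> R) (a b c : R) : a <= b ->
  real_ac a b f ->
  {ae @lebesgue_measure R, forall t, a <= t <= b -> is_derive t (1 : R) f c} ->
  f b - f a = c * (b - a).
Proof.
move=> ab acf [N [mN N0 HN]].
(* The three errors come from the points off the null set, from the displacement of [f] inside [U],
   and from the total length of the intervals collected inside [U]. *)
suff H (e : R) : 0 < e -> `|f b - f a - c * (b - a)| <= e * (b - a) + e + `|c| * e.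
  apply/eqP; rewrite -subr_eq0 -normr_le0; apply/ler_addgt0Pl => e e0.
  have k0 : 0 < b - a + 1 + `|c| by have := normr_ge0 c; lra.
  have := H (e / (b - a + 1 + `|c|)) (divr_gt0 e0 k0).
  rewrite (_ : _ + `|c| * _ = e) ?addr0//.
  by field; rewrite gt_eqF.
move=> e0.
have [d0 d00 Hd0] := acf _ e0.
pose d := Num.min d0 e.
have dpos : 0 < d by rewrite /d lt_min d00.
have Nfin : (lebesgue_measure N < +oo)%E by rewrite N0 ltry.
have [U [oU NU Ue]] := lebesgue_regularity_outer mN Nfin dpos.
have mU : measurable U by exact: measurable_realfun.open_measurable.

have {}Ue : (lebesgue_measure U < d%:E)%E.
  rewrite -(setDUK NU) measureU//; last 2 first.
    exact: measurableD.
    by rewrite setDE setIA setIC setIA setICl set0I.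
  by rewrite [X in (X + _)%E]N0 add0e.
(* [Q t] carries the list of disjoint intervals crossed inside [U] so far. Their total length is
   compared with the measure of [U] up to [t], not with [d], so that the bound survives the addition
   of an interval. *)
pose Q t := exists n (x y : nat -> R),
  [/\ forall i, (i < n)%N -> [/\ a <= x i, x i <= y i & y i <= t],
      trivIset [set i | (i < n)%N] (fun i => `]x i, y i[%classic),
      ((\sum_(0 <= i < n) (y i - x i))%:E <=
         lebesgue_measure (U `&` `]a, t]%classic))%E &
      `|f t - f a - c * (t - a)| <= e * (t - a) +
        \sum_(0 <= i < n) `|f (y i) - f (x i)| +
        `|c| * \sum_(0 <= i < n) (y i - x i)].
have [|x xab|n [x [y [H1 H2 H3 H4]]]] := creeping (P := Q) ab.
- exists 0%N, (fun=> 0), (fun=> 0); split => //.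
    by rewrite big_nil measure_ge0.
  by rewrite !big_nil !subrr !mulr0 !addr0 subr0 normr0.
- have Qext u v : a <= u -> u <= v ->
     `|f v - f u - c * (v - u)| <= e * (v - u) -> Q u -> Q v.
    move=> au uv Huv [n [x' [y [H1 H2 H3 H4]]]].
    exists n, x', y; split => //.
    + by move=> i /H1[? ? yu]; split => //; exact: le_trans uv.
    + apply: (le_trans H3); apply: le_measure; rewrite ?inE//=.
      * exact: measurableI.
      * exact: measurableI.
      * apply: setIS => z /=; rewrite !in_itv/= => /andP[-> zu].
        exact: le_trans uv.
    + have -> : f v - f a - c * (v - a) =
        (f v - f u - c * (v - u)) + (f u - f a - c * (u - a)) by ring.
      by rewrite (le_trans (ler_normD _ _))//; lra.
  have [xU|xU] := pselect (U x).
    have /nbhs_ballP[r /= r0 Hr] : nbhs x U by exact: open_nbhs_nbhs.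
    exists r => // u v au ux xv vb ru vr [n [x' [y [H1 H2 H3 H4]]]].
    have uvU : `]u, v]%classic `<=` U.
      move=> z /=; rewrite in_itv/= => /andP[uz zv]; apply: Hr.
      by rewrite /ball/= ltr_norml; lra.
    exists n.+1, (fun i => if i == n then u else x' i),
      (fun i => if i == n then v else y i).
    have Hx (F : R -> R -> R) : \sum_(0 <= i < n.+1)
        F (if i == n then u else x' i) (if i == n then v else y i) =
        \sum_(0 <= i < n) F (x' i) (y i) + F u v.
      rewrite big_nat_recr//= eqxx; congr (_ + _).
      by apply: eq_big_nat => i /andP[_ iN]; rewrite (ltn_eqF iN).
    split.
    + move=> i; rewrite ltnS leq_eqVlt; case: eqP => [_ _|_ /= iN].
        by split => //; lra.
      by have [? ? ?] := H1 i iN; split => //; lra.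
    + move=> i j /=; rewrite !ltnS.
      rewrite leq_eqVlt (leq_eqVlt j); case: eqP => [->|_] /=;
        case: eqP => [->|_] //=.
      * move=> _ jN; have [_ _ yju] := H1 j jN.
        by move=> [z [/=]]; rewrite !in_itv/= => /andP[? ?] /andP[? ?]; exfalso; lra.
      * move=> iN _; have [_ _ yju] := H1 i iN.
        by move=> [z [/=]]; rewrite !in_itv/= => /andP[? ?] /andP[? ?]; exfalso; lra.
      * exact: H2.
    + rewrite (Hx (fun p q => q - p)).
      have -> : U `&` `]a, v]%classic =
          (U `&` `]a, u]%classic) `|` `]u, v]%classic.
        apply/seteqP; split => [z /= [Uz]|z /= []]; rewrite ?in_itv/=.
          by move=> /andP[az zv]; have [zu|uz] := leP z u; [left|right];
            rewrite ?az ?zu ?uz ?zv.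
          by move=> [Uz /andP[az zu]]; split => //; rewrite az/=; lra.
        move=> H; split; first by apply: uvU; rewrite /= in_itv/=.
        by apply/andP; split; lra.
      rewrite measureU//; first last.
      * apply/seteqP; split => // z /= [[_]]; rewrite !in_itv/=.
        by move=> /andP[_ zu] /andP[uz _]; lra.
      * exact: measurableI.
      rewrite EFinD; apply: leeD => //; 
      apply: le_trans (_ : _ <= lebesgue_measure `]u, v]%classic)%E _ => //.
      rewrite lebesgue_measure_itv/= lte_fin.
      by case: ltP => [_|vu]; rewrite -?EFinB// lee_fin; lra.
    + rewrite (Hx (fun p q => `|f q - f p|)) (Hx (fun p q => q - p)).
      have -> : f v - f a - c * (v - a) =
        (f v - f u) + (- (c * (v - u)) + (f u - f a - c * (u - a))) by ring.
      rewrite (le_trans (ler_normD _ _))//.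
      have := ler_normD (- (c * (v - u))) (f u - f a - c * (u - a)).
      rewrite normrN normrM (ger0_norm (_ : 0 <= v - u)); last lra.
      have : 0 <= e * (v - u) by rewrite mulr_ge0; lra.
      lra.
  have fx : is_derive x (1 : R) f c.
    apply: contrapT => nfx; apply: xU; apply: NU; apply: HN => /= Hx.
    by apply: nfx; exact: Hx.
  have [r r0 Hr] := is_derive_local e0 fx.
  exists r => // u v au ux xv vb ru vr; apply: Qext => //; first lra.
  exact: Hr.
- have H5 : \sum_(0 <= i < n) (y i - x i) < d.
    rewrite -lte_fin (le_lt_trans _ Ue)// (le_trans H3)//.
    by apply: le_measure; rewrite ?inE//=; exact: measurableI.
  have H6 : \sum_(0 <= i < n) `|f (y i) - f (x i)| < e.
    apply: Hd0 => //; apply: lt_le_trans H5 _.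
    by rewrite /d ge_min lexx.
  apply: (le_trans H4); rewrite -!addrA lerD2l lerD ?(ltW H6)//.
  rewrite ler_wpM2l// (le_trans (ltW H5))//.
  by rewrite /d ge_min lexx orbT.
Qed.

Lemma ReD (R : realType) (x y : R[i]) :
  complex.Re (x + y) = complex.Re x + complex.Re y.
Proof. by case: x; case: y. Qed.

Lemma ImD (R : realType) (x y : R[i]) :
  complex.Im (x + y) = complex.Im x + complex.Im y.
Proof. by case: x; case: y. Qed.

Lemma ReN (R : realType) (x : R[i]) : complex.Re (- x) = - complex.Re x.
Proof. by case: x. Qed.

Lemma ImN (R : realType) (x : R[i]) : complex.Im (- x) = - complex.Im x.
Proof. by case: x. Qed.

Lemma ReM (R : realType) (x y : R[i]) : complex.Re (x * y) =
  complex.Re x * complex.Re y - complex.Im x * complex.Im y.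
Proof. by case: x; case: y. Qed.

Lemma ImM (R : realType) (x y : R[i]) : complex.Im (x * y) =
  complex.Re x * complex.Im y + complex.Im x * complex.Re y.
Proof. by case: x => a b; case: y => c d /=; ring. Qed.

Lemma normr_Re_le (R : realType) (x : R[i]) : `|complex.Re x| <= normc x.
Proof.
by case: x => a b /=; rewrite -sqrtr_sqr ler_wsqrtr// lerDl sqr_ge0.
Qed.

Lemma normr_Im_le (R : realType) (x : R[i]) : `|complex.Im x| <= normc x.
Proof.
by case: x => a b /=; rewrite -sqrtr_sqr ler_wsqrtr// lerDr sqr_ge0.
Qed.

Lemma normc_real (R : realType) (x : R) : normc (real_complex R x) = `|x|.
Proof. by rewrite /= expr0n/= addr0 sqrtr_sqr. Qed.

Lemma complex_ext (R : realType) (x y : R[i]) :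
  complex.Re x = complex.Re y -> complex.Im x = complex.Im y -> x = y.
Proof. by case: x => ? ?; case: y => ? ? /= -> ->. Qed.

Lemma real_ac_Re (R : realType) (a b : R) (f : R -> R[i]) :
  absolutely_continuous a b f -> real_ac a b (fun t => complex.Re (f t)).
Proof.
move=> acf e e0; have [d d0 H] := acf _ e0; exists d => // n u v h1 h2 h3.
apply: le_lt_trans (H n u v h1 h2 h3); apply: ler_sum => i _.
by rewrite -ReN -ReD normr_Re_le.
Qed.

Lemma real_ac_Im (R : realType) (a b : R) (f : R -> R[i]) :
  absolutely_continuous a b f -> real_ac a b (fun t => complex.Im (f t)).
Proof.
move=> acf e e0; have [d d0 H] := acf _ e0; exists d => // n u v h1 h2 h3.
apply: le_lt_trans (H n u v h1 h2 h3); apply: ler_sum => i _.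
by rewrite -ImN -ImD normr_Im_le.
Qed.

Lemma real_ac_lin (R : realType) (a b c s : R) (f g : R -> R) :
  `|c| <= 1 -> `|s| <= 1 -> real_ac a b f -> real_ac a b g ->
  real_ac a b (fun t => c * f t + s * g t).
Proof.
move=> c1 s1 acf acg e e0.
have e20 : 0 < e / 2 by lra.
have [d1 d10 H1] := acf _ e20; have [d2 d20 H2] := acg _ e20.
exists (Num.min d1 d2) => [|n u v h1 h2]; first by rewrite lt_min d10.
rewrite lt_min => /andP[h3 h4].
have := H1 n u v h1 h2 h3; have := H2 n u v h1 h2 h4 => k2 k1.
have -> : e = e / 2 + e / 2 by lra.
apply: le_lt_trans (ltrD k1 k2); rewrite -big_split/=; apply: ler_sum => i _.
have -> : c * f (v i) + s * g (v i) - (c * f (u i) + s * g (u i)) =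
  c * (f (v i) - f (u i)) + s * (g (v i) - g (u i)) by ring.
rewrite (le_trans (ler_normD _ _))// !normrM lerD// -[leRHS]mul1r.
  by rewrite ler_wpM2r.
by rewrite ler_wpM2r.
Qed.

Lemma real_ac_sub (R : realType) (a b a' b' : R) (f : R -> R) :
  a <= a' -> b' <= b -> real_ac a b f -> real_ac a' b' f.
Proof.
move=> aa bb acf e e0; have [d d0 H] := acf _ e0; exists d => // n u v h1.
by apply: H => i /h1[? ? ?]; split => //; lra.
Qed.

Lemma mulmx_Jmx0 (K : pzRingType) (A : 'M[K]_2) i : (A *m Jmx K) i 0 = A i 1.
Proof.
by rewrite !mxE big_ord_recl big_ord1 !mxE/= mulr0 add0r mulr1; congr (A i _); apply/val_inj.
Qed.

Lemma mulmx_Jmx1 (K : pzRingType) (A : 'M[K]_2) i : (A *m Jmx K) i 1 = - A i 0.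
Proof.
by rewrite !mxE big_ord_recl big_ord1 !mxE/= mulr0 addr0 mulrN1; congr (- A i _); apply/val_inj.
Qed.

Lemma mulmx_proj (R : realType) (A : 'M[R[i]]_2) (t : R) i j :
  (A *m map_mx (real_complex R) (xi t *m (xi t)^T)) i j =
  (real_complex R (cos t) * A i 0 + real_complex R (sin t) * A i 1) *
  real_complex R (xi t j 0).
Proof.
rewrite mulmxE !mxE big_ord_recl big_ord1 !mxE !big_ord1 !mxE/= !rmorphM/=.
rewrite (_ : lift ord0 ord0 = 1); last exact/val_inj.
by ring.
Qed.

Lemma hnode0 (R : realType) (l : nat -> R) : hnode l 0 = 0.
Proof. by rewrite /hnode big_geq. Qed.

Lemma hnodeS (R : realType) (l : nat -> R) n : hnode l n.+1 = hnode l n + l n.+1.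
Proof. by rewrite /hnode big_nat_recr. Qed.

#[local] Instance ae_lebesgue_filter (R : realType) :
  Filter (almost_everywhere (@lebesgue_measure R)).
Proof. exact: ae_filter_ringOfSetsType. Qed.

Section nodes.
Variables (R : realType) (l phi : nat -> R).
Hypothesis hH : limit_circle_hamburger l phi.

Let lpos j : 0 < l j.+1.
Proof. by case: hH => + _ _; apply. Qed.

Lemma hnode_lt m n : (m < n)%N -> hnode l m < hnode l n.
Proof.
elim: n => // n IH; rewrite ltnS leq_eqVlt hnodeS => /predU1P[->|/IH].
  by rewrite ltrDl.
by have := lpos n; lra.
Qed.

Lemma hnode_le m n : (m <= n)%N -> hnode l m <= hnode l n.
Proof. by rewrite leq_eqVlt => /predU1P[->|/hnode_lt/ltW]. Qed.

Lemma hnode_ge0 n : 0 <= hnode l n.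
Proof. by rewrite -(hnode0 l) hnode_le. Qed.

Lemma hnode_le_hlen n : hnode l n <= hlen l.
Proof.
case: hH => _ cv _; apply: nondecreasing_cvgn_le => //.
exact: hnode_le.
Qed.

Lemma hamburgerE n t : hnode l n <= t < hnode l n.+1 ->
  hamburger l phi t = xi (phi n.+1) *m (xi (phi n.+1))^T.
Proof.
move=> /andP[nt tn]; rewrite /hamburger.
set j := get _; have [] : [set j : nat | (1 <= j)%N /\
    hnode l j.-1 <= t < hnode l j] j by apply: getPex; exists n.+1; rewrite /= nt tn.
move=> /= j1 /andP[jt tj].
have -> : j = n.+1; last by [].
apply/eqP; rewrite eqn_leq; apply/andP; split; rewrite leqNgt; apply/negP.
  move=> nj; have : (n.+1 <= j.-1)%N by lia.
  by move=> /hnode_le; lra.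
by rewrite ltnS => jn; have := hnode_le jn; lra.
Qed.

(** While the angle is constant, the equation moves the row only in the direction orthogonal to xi.
    Its component along xi is therefore constant, hence so are the derivatives of both entries, and
    these integrate exactly. *)
Lemma fundamental_solution_step z (W : R -> 'M[R[i]]_2) n i :
  is_fundamental_solution (hamburger l phi) (hlen l) z W ->
  let c := cos (phi n.+1) in let s := sin (phi n.+1) in
  let p := real_complex R c * W (hnode l n) i 0 +
           real_complex R s * W (hnode l n) i 1 in
  W (hnode l n.+1) i 0 = W (hnode l n) i 0 - z * real_complex R (l n.+1 * s) * p
  /\
  W (hnode l n.+1) i 1 = W (hnode l n) i 1 + z * real_complex R (l n.+1 * c) * p.
Proof.
move=> [_ acW dW] c s p.
set a := hnode l n; set b := hnode l n.+1.
have a0 : 0 <= a by exact: hnode_ge0.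
have ab : a < b by exact: hnode_lt.
have bL : b <= hlen l by exact: hnode_le_hlen.
have acW' j := real_ac_sub a0 bL (real_ac_Re (acW i j)).
have acW'' j := real_ac_sub a0 bL (real_ac_Im (acW i j)).
pose P t := real_complex R c * W t i 0 + real_complex R s * W t i 1.
have ae0 : {ae @lebesgue_measure R, forall t, a <= t <= b ->
    is_cderive (fun u => W u i 1) t (z * P t * real_complex R c) /\
    is_cderive (fun u => W u i 0) t (- (z * P t * real_complex R s))}.
  (* At the right end [b] the Hamiltonian already has the next angle, so this single point is
     discarded. *)
  have aeb : {ae @lebesgue_measure R, forall t, t != b}.
    exists [set b]; split => //; first exact: lebesgue_measure_set1.
    by move=> t /= /negP; rewrite negbK => /eqP.
  move: dW aeb; apply: filterS2 => t dW tb /andP[at_ tb'].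
  have tb2 : t < b by rewrite lt_neqAle tb.
  have tL : 0 <= t <= hlen l by lra.
  have {}dW := dW tL i.
  have HE : hamburger l phi t = xi (phi n.+1) *m (xi (phi n.+1))^T.
    by apply: hamburgerE; rewrite at_.
  split.
    have := dW 0; rewrite HE [X in is_cderive _ _ X]mxE mulmx_proj mxE/= mulrA.
    under eq_fun do rewrite mulmx_Jmx0.
    by [].
  have := dW 1; rewrite HE [X in is_cderive _ _ X]mxE mulmx_proj mxE/= mulrA.
  under eq_fun do rewrite mulmx_Jmx1.
  move=> -[d1 d2].
  split; rewrite /= ?ReN ?ImN.
    have -> : (fun u => complex.Re (W u i 0)) = - (fun u => complex.Re (- W u i 0)).
      by apply/funext => u /=; rewrite fctE ReN opprK.
    exact: is_deriveN.
  have -> : (fun u => complex.Im (W u i 0)) = - (fun u => complex.Im (- W u i 0)).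
    by apply/funext => u /=; rewrite fctE ImN opprK.
  exact: is_deriveN.
have c1 : `|c| <= 1 by rewrite ler_norml cos_geN1 cos_le1.
have s1 : `|s| <= 1 by rewrite ler_norml sin_geN1 sin_le1.
have ReP t : complex.Re (P t) =
    c * complex.Re (W t i 0) + s * complex.Re (W t i 1).
  by rewrite ReD !ReM/=; ring.
have ImP t : complex.Im (P t) =
    c * complex.Im (W t i 0) + s * complex.Im (W t i 1).
  by rewrite ImD !ImM/=; ring.
have pE : p = P a by [].
have Pcst t : a <= t -> t <= b -> P t = p.
  move=> at_ tb; apply: complex_ext; apply/eqP; rewrite -subr_eq0.
    rewrite pE !ReP.
    apply/eqP; rewrite -[RHS](mul0r (t - a)).
    apply: (@real_ac_const_derive _ (fun t =>
      c * complex.Re (W t i 0) + s * complex.Re (W t i 1))) => //.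
      by apply: real_ac_lin => //; exact: real_ac_sub (acW' _).
    move: ae0; apply: filterS => u H /andP[au ut].
    have [|[d1 _] [d2 _]] := H; first by rewrite au/=; lra.
    apply: is_derive_eq.
    rewrite ReN !ReM/= /GRing.scale/=; ring.
  rewrite pE !ImP.
  apply/eqP; rewrite -[RHS](mul0r (t - a)).
  apply: (@real_ac_const_derive _ (fun t =>
    c * complex.Im (W t i 0) + s * complex.Im (W t i 1))) => //.
    by apply: real_ac_lin => //; exact: real_ac_sub (acW'' _).
  move: ae0; apply: filterS => u H /andP[au ut].
  have [|[_ d1] [_ d2]] := H; first by rewrite au/=; lra.
  apply: is_derive_eq.
  rewrite ImN !ImM/= /GRing.scale/=; ring.
have bal : b - a = l n.+1 by rewrite /b hnodeS addrC addKr.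
have ae1 (j : 'I_2) (w : R[i]) : {ae @lebesgue_measure R, forall t,
    a <= t <= b -> is_cderive (fun u => W u i j) t w} ->
    W b i j = W a i j + real_complex R (l n.+1) * w.
  move=> H; apply: complex_ext.
    have := real_ac_const_derive (ltW ab) (acW' j) (c := complex.Re w).
    rewrite ReD ReM/= mul0r subr0 bal [complex.Re w * _]mulrC => <-; first by rewrite addrC subrK.
    by move: H; apply: filterS => t H /H[].
  have := real_ac_const_derive (ltW ab) (acW'' j) (c := complex.Im w).
  rewrite ImD ImM/= mul0r addr0 bal [complex.Im w * _]mulrC => <-.
    by rewrite addrC subrK.
  by move: H; apply: filterS => t H /H[].
split.
  rewrite (ae1 0 (- (z * p * real_complex R s))).
    by rewrite rmorphM/=; ring.
  move: ae0; apply: filterS => t H /[dup]tab /H[_].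
  by rewrite Pcst//; lra.
rewrite (ae1 1 (z * p * real_complex R c)).
  by rewrite rmorphM/=; ring.
move: ae0; apply: filterS => t H /[dup]tab /H[+ _].
by rewrite Pcst//; lra.
Qed.

End nodes.

Definition transfer_rec {R : realType} (l phi : nat -> R) (z : R[i])
    (u1 u2 : nat -> R[i]) : Prop := forall n,
  let c := cos (phi n.+1) in let s := sin (phi n.+1) in
  let p := real_complex R c * u1 n + real_complex R s * u2 n in
  u1 n.+1 = u1 n - z * real_complex R (l n.+1 * s) * p /\
  u2 n.+1 = u2 n + z * real_complex R (l n.+1 * c) * p.

Section monodromy.
Variables (R : realType) (l phi : nat -> R) (z : R[i]) (W : R -> 'M[R[i]]_2).
Hypothesis hH : limit_circle_hamburger l phi.
Hypothesis hW : is_fundamental_solution (hamburger l phi) (hlen l) z W.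

Lemma monodromy_rec i : transfer_rec l phi z
  (fun n => W (hnode l n) i 0) (fun n => W (hnode l n) i 1).
Proof. by move=> n; exact: fundamental_solution_step. Qed.

Lemma monodromy_init i j : W (hnode l 0) i j = (i == j)%:R.
Proof. by case: hW => W0 _ _; rewrite hnode0 W0 !mxE. Qed.

(** The nodes accumulate at [hlen l] without reaching it. Absolute continuity, applied to the one
    interval from [hnode l n] to [hlen l], carries the recursion to the limit. *)
Lemma monodromy_cvg i j (e : R) : 0 < e ->
  exists N, forall n, (N <= n)%N ->
    normc (W (hlen l) i j - W (hnode l n) i j) < e.
Proof.
move=> e0; case: hW => _ acW _; have [d d0 H] := acW i j e e0.
have cv : hnode l @ \oo --> hlen l by case: hH => _ cv _; exact: cv.
have /cvgrPdist_lt/(_ d d0)[N _ HN] := cv.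
exists N => n Nn; have := HN n Nn => /=.
have nL := hnode_le_hlen hH n.
rewrite ger0_norm ?subr_ge0// => nd.
have := H 1%N (fun=> hnode l n) (fun=> hlen l); rewrite !big_nat1; apply => //.
  by move=> _ _; split => //; exact: hnode_ge0 hH n.
by move=> p q /=; rewrite !ltnS !leqn0 => /eqP-> /eqP->.
Qed.

Lemma monodromy_le i j (B : R) N :
  (forall n, (N <= n)%N -> normc (W (hnode l n) i j) <= B) ->
  normc (W (hlen l) i j) <= B.
Proof.
move=> HB; apply/ler_addgt0Pl => e e0.
have [N' HN'] := monodromy_cvg i j e0.
have h1 := HN' (maxn N N') (leq_maxr _ _); have h2 := HB (maxn N N') (leq_maxl _ _).
have := le_normcD (W (hlen l) i j - W (hnode l (maxn N N')) i j)
  (W (hnode l (maxn N N')) i j).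
by rewrite subrK; lra.
Qed.

Lemma monodromy_ge i (B : R) N :
  (forall n, (N <= n)%N ->
    B <= normc (W (hnode l n) i 0) + normc (W (hnode l n) i 1)) ->
  B <= normc (W (hlen l) i 0) + normc (W (hlen l) i 1).
Proof.
move=> HB; apply/ler_addgt0Pl => e e0; have e20 : 0 < e / 2 by lra.
have [N0 H0] := monodromy_cvg i 0 e20.
have [N1 H1] := monodromy_cvg i 1 e20.
pose n := maxn N (maxn N0 N1).
have h0 := H0 n ltac:(rewrite /n; lia).
have h1 := H1 n ltac:(rewrite /n; lia).
have h := HB n (leq_maxl _ _).
have k (j : 'I_2) : normc (W (hnode l n) i j) <=
    normc (W (hlen l) i j - W (hnode l n) i j) + normc (W (hlen l) i j).
  have := le_normcD (W (hnode l n) i j - W (hlen l) i j) (W (hlen l) i j).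
  by rewrite subrK -[in X in _ <= X -> _]normcN opprB.
by have := k 0; have := k 1; lra.
Qed.

End monodromy.

Lemma normc_ge0 (R : realType) (x : R[i]) : 0 <= normc x.
Proof. by case: x => a b /=; exact: sqrtr_ge0. Qed.

Lemma entry_le_l2norm (R : realType) n (v : 'cV[R[i]]_n) i :
  normc (v i 0) <= l2norm v.
Proof.
rewrite -(ger0_norm (normc_ge0 _)) -sqrtr_sqr ler_wsqrtr//.
by rewrite (bigD1 i)//= lerDl sumr_ge0// => j _; rewrite sqr_ge0.
Qed.

Lemma l2norm2_le (R : realType) (v : 'cV[R[i]]_2) (B : R) :
  (forall i, normc (v i 0) <= B) -> l2norm v <= 2 * B.
Proof.
move=> HB; have B0 : 0 <= B by rewrite (le_trans _ (HB 0)) ?normc_ge0.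
rewrite -[leRHS]ger0_norm ?mulr_ge0// -sqrtr_sqr ler_wsqrtr//.
rewrite big_ord_recl big_ord1.
have := HB ord0; have := HB (lift ord0 ord0) => h1 h0.
have := normc_ge0 (v ord0 0); have := normc_ge0 (v (lift ord0 ord0) 0).
by rewrite exprMn; nra.
Qed.

Lemma l2norm_mul_le (R : realType) (M : 'M[R[i]]_2) (B : R) v :
  (forall i j, normc (M i j) <= B) -> l2norm v = 1 -> l2norm (M *m v) <= 4 * B.
Proof.
move=> HB v1; rewrite (_ : 4 * B = 2 * (2 * B)); last by ring.
apply: l2norm2_le => i; rewrite !mxE big_ord_recl big_ord1.
rewrite (le_trans (le_normcD _ _))// !normcM.
have := entry_le_l2norm v ord0; have := entry_le_l2norm v (lift ord0 ord0).
rewrite v1 => k1 k0.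
have := HB i ord0; have := HB i (lift ord0 ord0) => h1 h0.
have := normc_ge0 (v ord0 0); have := normc_ge0 (v (lift ord0 ord0) 0).
have := normc_ge0 (M i ord0); have := normc_ge0 (M i (lift ord0 ord0)).
by nra.
Qed.

Lemma l2norm_delta (R : realType) (j : 'I_2) :
  l2norm (delta_mx j 0 : 'cV[R[i]]_2) = 1.
Proof.
rewrite /l2norm (bigD1 j)//= big1 => [|i /negbTE ij]; rewrite mxE ?ij ?eqxx ?eqxx/=.
  by rewrite expr1n !expr0n/= !addr0 sqrtr1 expr1n sqrtr1.
by rewrite !expr0n/= addr0 sqrtr0 expr0n.
Qed.

Lemma opnorm_le (R : realType) (M : 'M[R[i]]_2) (B : R) :
  (forall i j, normc (M i j) <= B) -> opnorm M <= 4 * B.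
Proof.
move=> HB; apply: ge_sup => [|_ [v v1 <-]]; last exact: l2norm_mul_le.
by exists (l2norm (M *m delta_mx 0 0)); exists (delta_mx 0 0) => //; exact: l2norm_delta.
Qed.

Lemma entry_le_opnorm (R : realType) (M : 'M[R[i]]_2) i j :
  normc (M i j) <= opnorm M.
Proof.
(* This crude bound on the entries only shows that the set defining [opnorm] is bounded, so that its
   [sup] is an upper bound. *)
pose B := \sum_(k : 'I_2) \sum_(m : 'I_2) normc (M k m).
have HB k m : normc (M k m) <= B.
  rewrite /B (bigD1 k)//= (bigD1 m)//= -addrA lerDl.
  rewrite addr_ge0// ?sumr_ge0// => ? _; rewrite ?normc_ge0// sumr_ge0// => ? _.
  by rewrite normc_ge0.
pose v : 'cV[R[i]]_2 := delta_mx j 0.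
have -> : M i j = (M *m v) i 0.
  by rewrite -colE mxE.
apply: le_trans (entry_le_l2norm _ i) _; apply: ub_le_sup.
  by exists (4 * B) => _ [w w1 <-]; exact: l2norm_mul_le.
by exists v => //; exact: l2norm_delta.
Qed.

(** * Growth on the imaginary axis and in weighted norms *)

Definition wedge {R : realType} (u1 u2 : R[i]) : R :=
  complex.Re u1 * complex.Im u2 - complex.Re u2 * complex.Im u1.

Definition sqnorm {R : realType} (u1 u2 : R[i]) : R :=
  complex.Re u1 ^+ 2 + complex.Im u1 ^+ 2 +
  (complex.Re u2 ^+ 2 + complex.Im u2 ^+ 2).

Definition sqcoord {R : realType} (t : R) (u1 u2 : R[i]) : R :=
  (cos t * complex.Re u1 + sin t * complex.Re u2) ^+ 2 +
  (cos t * complex.Im u1 + sin t * complex.Im u2) ^+ 2.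

Lemma sqcoord_ge0 (R : realType) (t : R) u1 u2 : 0 <= sqcoord t u1 u2.
Proof. by rewrite addr_ge0// sqr_ge0. Qed.

Lemma sqnorm_ge0 (R : realType) (u1 u2 : R[i]) : 0 <= sqnorm u1 u2.
Proof. by rewrite !addr_ge0// sqr_ge0. Qed.

Lemma wedge_le_sqnorm (R : realType) (u1 u2 : R[i]) :
  2 * wedge u1 u2 <= sqnorm u1 u2.
Proof. 
case: u1 => a b; case: u2 => c d; rewrite /wedge /sqnorm /=.
by have := sqr_ge0 (a - d); have := sqr_ge0 (b + c); lra.
 Qed.

Lemma sqnorm_le (R : realType) (u1 u2 : R[i]) :
  sqnorm u1 u2 <= (normc u1 + normc u2) ^+ 2.
Proof.
have h (u : R[i]) : complex.Re u ^+ 2 + complex.Im u ^+ 2 = normc u ^+ 2.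
  by case: u => a b /=; rewrite sqr_sqrtr// addr_ge0// sqr_ge0.
rewrite /sqnorm !h; have := normc_ge0 u1; have := normc_ge0 u2; nra.
Qed.

Lemma sin2D (R : realType) (t : R) : sin t * sin t = 1 - cos t * cos t.
Proof. by rewrite -!expr2 sin2cos2. Qed.

(** Let p and p' be the coordinates of u along xi_t and xi_t'. The left side is the square of Im
    (conj p p'), the right side is |p p'|^2, and they differ by the square of the real part. *)
Lemma sin_wedge_sqcoord (R : realType) (t t' : R) (u1 u2 : R[i]) :
  (sin (t' - t) * wedge u1 u2) ^+ 2 <= sqcoord t u1 u2 * sqcoord t' u1 u2.
Proof.
rewrite sinB /wedge /sqcoord; case: u1 => a b; case: u2 => c d /=.
set C := cos t; set S := sin t; set C' := cos t'; set S' := sin t'.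
set pa := C * a + S * c; set pb := C * b + S * d.
set pa' := C' * a + S' * c; set pb' := C' * b + S' * d.
have -> : (S' * C - C' * S) * (a * d - c * b) = pa * pb' - pb * pa'.
  by rewrite /pa /pb /pa' /pb'; ring.
have H := sqr_ge0 (pa * pa' + pb * pb').
rewrite -subr_ge0.
have -> : (pa ^+ 2 + pb ^+ 2) * (pa' ^+ 2 + pb' ^+ 2) -
  (pa * pb' - pb * pa') ^+ 2 = (pa * pa' + pb * pb') ^+ 2 by ring.
exact: H.
Qed.

(* Re (p conj q) for the coordinates p = u . xi_t and q = u . eta_t; similarly,
   [wedge] is Im (conj p q), which does not depend on t, and [sqcoord] is |p|^2. *)
Definition mixed {R : realType} (t : R) (u1 u2 : R[i]) : R :=
  (cos t * complex.Re u1 + sin t * complex.Re u2) *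
  (cos t * complex.Re u2 - sin t * complex.Re u1) +
  (cos t * complex.Im u1 + sin t * complex.Im u2) *
  (cos t * complex.Im u2 - sin t * complex.Im u1).

Lemma mixed_le (R : realType) (t : R) (u1 u2 : R[i]) :
  `|mixed t u1 u2| <= sqnorm u1 u2 / 2.
Proof.
rewrite /mixed /sqnorm; case: u1 => a b; case: u2 => c d /=.
set C := cos t; set S := sin t.
have k : S * S = 1 - C * C by exact: sin2D.
have -> : a ^+ 2 + b ^+ 2 + (c ^+ 2 + d ^+ 2) =
  (C * a + S * c) ^+ 2 + (C * c - S * a) ^+ 2 +
  ((C * b + S * d) ^+ 2 + (C * d - S * b) ^+ 2) by ring: k.
set p := C * a + S * c; set q := C * c - S * a.
set p' := C * b + S * d; set q' := C * d - S * b.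
rewrite ler_norml; apply/andP; split.
  by have := sqr_ge0 (p + q); have := sqr_ge0 (p' + q'); lra.
by have := sqr_ge0 (p - q); have := sqr_ge0 (p' - q'); lra.
Qed.

(** The pair Re (p conj q), (|q|^2 - |p|^2) / 2 turns by twice the angle of the frame, and |q|^2 -
    |p|^2 is [sqnorm - 2 * sqcoord]. *)
Lemma mixed_rotate (R : realType) (t t' : R) (u1 u2 : R[i]) :
  mixed t u1 u2 = (1 - 2 * (sin (t' - t) * sin (t' - t))) * mixed t' u1 u2 -
    sin (t' - t) * cos (t' - t) * (sqnorm u1 u2 - 2 * sqcoord t' u1 u2).
Proof.
rewrite sinB cosB /mixed /sqnorm /sqcoord; case: u1 => a b; case: u2 => c d /=.
set C := cos t; set S := sin t; set C' := cos t'; set S' := sin t'.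
have k : S * S = 1 - C * C by exact: sin2D.
have k' : S' * S' = 1 - C' * C' by exact: sin2D.
by ring: k k'.
Qed.

Lemma expR_half_le (R : realType) (x : R) : 0 <= x <= 1 -> expR (x / 2) <= 1 + x.
Proof.
move=> /andP[x0 x1]; have := expR_ge1Dx (- (x / 2)); rewrite expRN => h.
have e0 := expR_gt0 (x / 2).
have : (1 - x / 2) * expR (x / 2) <= 1 by rewrite -ler_pdivlMr// div1r.
have x2 : 0 < 1 - x / 2 by lra.
rewrite -ler_pdivlMl// mulr1 => /le_trans; apply.
by rewrite -div1r ler_pdivrMr//; nra.
Qed.

(** * The recursion at z = iy: growth of the wedge and a Lyapunov function *)

Section imaginary_axis.
Variables (R : realType) (l phi : nat -> R) (y : R) (u1 u2 : nat -> R[i]).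
Hypothesis lpos : forall j, 0 < l j.+1.
Hypothesis y0 : 0 < y.
Hypothesis Hu : transfer_rec l phi (Complex 0 y) u1 u2.

Let S n := wedge (u1 n) (u2 n).
Let P n := sqcoord (phi n.+1) (u1 n) (u2 n).
Let E n := sqnorm (u1 n) (u2 n).

Lemma wedgeS n : S n.+1 = S n + y * l n.+1 * P n.
Proof.
rewrite /S /P; have [-> ->] := Hu n.
case: (u1 n) => a b; case: (u2 n) => c d.
rewrite /wedge /sqcoord !(ReD, ImD, ReN, ImN, ReM, ImM)/=.
set C := cos _; set s := sin _.
have k : s * s = 1 - C * C by exact: sin2D.
by ring: k.
Qed.

Lemma sqcoordS n : sqcoord (phi n.+1) (u1 n.+1) (u2 n.+1) = P n.
Proof.
rewrite /P; have [-> ->] := Hu n.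
case: (u1 n) => a b; case: (u2 n) => c d.
rewrite /sqcoord !(ReD, ImD, ReN, ImN, ReM, ImM)/=; ring.
Qed.

Lemma sqnormS n : E n.+1 = E n + 2 * y * l n.+1 * S n + (y * l n.+1) ^+ 2 * P n.
Proof.
rewrite /E /S /P; have [-> ->] := Hu n.
case: (u1 n) => a b; case: (u2 n) => c d.
rewrite /sqnorm /wedge /sqcoord !(ReD, ImD, ReN, ImN, ReM, ImM)/=.
set C := cos _; set s := sin _.
have k : s * s = 1 - C * C by exact: sin2D.
by ring: k.
Qed.

Hypothesis S0 : S 0 = 0.

Lemma wedge_homo m n : (m <= n)%N -> S m <= S n.
Proof.
elim: n => [|n IH]; first by rewrite leqn0 => /eqP->.
rewrite leq_eqVlt ltnS wedgeS => /predU1P[->|/IH]; first by rewrite wedgeS.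
move=> h; have : 0 <= y * l n.+1 * P n.
  by rewrite !mulr_ge0 ?sqcoord_ge0// ltW.
lra.
Qed.

Lemma wedge_ge0 n : 0 <= S n.
Proof. by rewrite -S0 wedge_homo. Qed.

Lemma sqnorm_homo m n : (m <= n)%N -> E m <= E n.
Proof.
elim: n => [|n IH]; first by rewrite leqn0 => /eqP->.
rewrite leq_eqVlt ltnS sqnormS => /predU1P[->|/IH]; first by rewrite sqnormS.
move=> h; have : 0 <= 2 * y * l n.+1 * S n.
  by rewrite !mulr_ge0 ?wedge_ge0// ltW.
have : 0 <= (y * l n.+1) ^+ 2 * P n by rewrite mulr_ge0 ?sqr_ge0 ?sqcoord_ge0.
lra.
Qed.

(* The increments D_j = S_j - S_(j-1) = y l_j P_(j-1) satisfy
   D_j D_(j+1) >= y^2 l_j l_(j+1) sin^2 S_j^2, while D_j <= S_j. *)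
Lemma wedge_step n kap : 0 < kap -> 0 < S n.+1 ->
  kap <= y ^+ 2 * l n.+1 * l n.+2 * sin (phi n.+2 - phi n.+1) ^+ 2 ->
  (1 + kap) * S n.+1 <= S n.+2.
Proof.
move=> k0 Sn Hk.
have := sin_wedge_sqcoord (phi n.+1) (phi n.+2) (u1 n.+1) (u2 n.+1).
rewrite sqcoordS -/(P n.+1) -/(S n.+1) exprMn => H.
have D1 := wedgeS n; have D2 := wedgeS n.+1; have Sn0 := wedge_ge0 n.
set d1 := y * l n.+1 * P n in D1; set d2 := y * l n.+2 * P n.+1 in D2.
have d1S : d1 <= S n.+1 by lra.
have d10 : 0 <= d1 by rewrite !mulr_ge0 ?sqcoord_ge0// ltW.
have d20 : 0 <= d2 by rewrite !mulr_ge0 ?sqcoord_ge0// ltW.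
have H2 : kap * S n.+1 ^+ 2 <= d1 * d2.
  have -> : d1 * d2 = y ^+ 2 * l n.+1 * l n.+2 * (P n * P n.+1).
    by rewrite /d1 /d2; ring.
  apply: le_trans (ler_wpM2r (sqr_ge0 _) Hk) _.
  have K0 : 0 <= y ^+ 2 * l n.+1 * l n.+2.
    by rewrite !mulr_ge0 ?sqr_ge0// ltW.
  by have := ler_wpM2l K0 H; rewrite !mulrA.
have H3 : d1 * d2 <= S n.+1 * d2 by rewrite ler_wpM2r.
have H4 : kap * S n.+1 <= d2.
  have : S n.+1 * (kap * S n.+1) <= S n.+1 * d2 by nra.
  by rewrite ler_pM2l.
lra.
Qed.

Lemma wedge_exp_growth N kap : 0 < kap -> 0 < P 0 ->
  (forall j, (1 <= j <= N)%N ->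
    kap <= y ^+ 2 * l j * l j.+1 * sin (phi j.+1 - phi j) ^+ 2) ->
  y * l 1%N * P 0 * (1 + kap) ^+ N <= S N.+1.
Proof.
move=> k0 P0; elim: N => [|N IH] H.
  by rewrite expr0 mulr1 wedgeS S0 add0r.
have {}IH := IH (fun j jN => H j ltac:(lia)).
have c0 : 0 < y * l 1%N * P 0 by rewrite !mulr_gt0.
have SN : 0 < S N.+1.
  by apply: lt_le_trans IH; rewrite mulr_gt0// exprn_gt0//; lra.
apply: le_trans (wedge_step k0 SN (H N.+1 ltac:(lia))).
by rewrite exprS mulrCA ler_wpM2l//; lra.
Qed.

Let M n t := mixed t (u1 n) (u2 n).

Lemma mixedS n : M n.+1 (phi n.+1) = M n (phi n.+1).
Proof.
rewrite /M; have [-> ->] := Hu n.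
case: (u1 n) => a b; case: (u2 n) => c d.
rewrite /mixed !(ReD, ImD, ReN, ImN, ReM, ImM)/=.
set C := cos _; set s := sin _.
have k : s * s = 1 - C * C by exact: sin2D.
by ring: k.
Qed.

(** [E] makes [G] positive. When the frame turns by an angle with sine [sg * s], the mixed term
    gains about [w s (E - 2 P)]; the increment [y l P] of [S] pays for the negative part. The sign
    [sg] is the sense of rotation. *)
Let G (sg : R) (w : nat -> R) n := E n + S n + w n * sg * M n (phi n).

Lemma lyapunov_bounds sg w n : sg ^+ 2 = 1 -> 0 <= w n <= 1 ->
  E n / 2 <= G sg w n <= 2 * E n.
Proof.
move=> sg1 /andP[w0 w1].
have := wedge_ge0 n; have := wedge_le_sqnorm (u1 n) (u2 n).
rewrite -/(S n) -/(E n) => h1 h2.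
have := mixed_le (phi n) (u1 n) (u2 n); rewrite -/(M n _) -/(E n) ler_norml => /andP[m1 m2].
have E0 : 0 <= E n by exact: sqnorm_ge0.
rewrite /G; have [->|->] : sg = 1 \/ sg = -1.
- by have /eqP := sg1; rewrite sqrf_eq1 => /orP[]/eqP->; [left|right].
- by apply/andP; split; nra.
- by apply/andP; split; nra.
Qed.

(** After [S] has paid for [P], the turn yields at least [w s E / 2], because the cosine exceeds [s]
    by at least 1/2. The variation of [w] costs at most [w s E / 4]. The rest is at least
    [kap y l E / 4], which covers the claim since [G <= 2 E]. *)
Lemma lyapunov_step sg w kap n :
  let s := sg * sin (phi n.+1 - phi n) in
  sg ^+ 2 = 1 -> 0 <= s <= 1 / 4 -> 3 / 4 <= cos (phi n.+1 - phi n) ->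
  0 <= w n <= 1 -> 0 <= kap ->
  `|w n.+1 - w n| <= w n * s / 2 ->
  2 * w n * s <= y * l n.+1 -> kap * (y * l n.+1) <= w n * s ->
  (1 + kap / 8 * (y * l n.+1)) * G sg w n <= G sg w n.+1.
Proof.
move=> s sg1 /andP[s0 s14] c34 wn k0 dw ws kw.
have /andP[_ G2] := lyapunov_bounds sg1 wn.
case/andP: wn => w0 w1.
have yl : 0 < y * l n.+1 by rewrite mulr_gt0.
have En : 0 <= E n by exact: sqnorm_ge0.
have Pn : 0 <= P n by exact: sqcoord_ge0.
have hE : 0 <= E n.+1 - E n by rewrite subr_ge0 sqnorm_homo.
have hS := wedgeS n.
have hM : w n * s * (cos (phi n.+1 - phi n) * (E n - 2 * P n) - s * E n)
    <= w n * sg * (M n.+1 (phi n.+1) - M n (phi n)).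
  have hr := mixed_rotate (phi n) (phi n.+1) (u1 n) (u2 n).
  rewrite -/(P n) -/(E n) -/(M n (phi n)) -/(M n (phi n.+1)) in hr.
  rewrite mixedS hr.
  set c := cos _; set sn := sin _; set m := M n _.
  have ssn : s * s = sn * sn.
    have -> : s * s = sg ^+ 2 * (sn * sn) by rewrite /s /sn; ring.
    by rewrite sg1 mul1r.
  have hm : `|m| <= E n / 2 by exact: mixed_le.
  have -> : w n * sg * (m - ((1 - 2 * (sn * sn)) * m - sn * c * (E n - 2 * P n)))
     = w n * s * (c * (E n - 2 * P n)) + w n * (s * s) * (2 * (sg * m)).
    by rewrite ssn /s -/sn; ring.
  have -> : w n * s * (c * (E n - 2 * P n) - s * E n) =
     w n * s * (c * (E n - 2 * P n)) + w n * (s * s) * (- E n) by ring.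
  rewrite lerD2l; apply: ler_wpM2l; first exact: mulr_ge0 (mulr_ge0 s0 s0).
  have : `|sg * m| <= E n / 2.
    by rewrite normrM (_ : `|sg| = 1) ?mul1r// -sqrtr_sqr sg1 sqrtr1.
  by rewrite ler_norml => /andP[]; lra.
have hw : - (w n * s * E n / 4) <= (w n.+1 - w n) * sg * M n.+1 (phi n.+1).
  have : `|(w n.+1 - w n) * sg * M n.+1 (phi n.+1)| <= w n * s / 2 * (E n / 2).
    rewrite !normrM (_ : `|sg| = 1); last by rewrite -sqrtr_sqr sg1 sqrtr1.
    by rewrite mulr1 ler_pM// mixedS mixed_le.
  by rewrite ler_norml => /andP[]; lra.
have c1 := cos_le1 (phi n.+1 - phi n).
have ws0 : 0 <= w n * s by exact: mulr_ge0.
have hP : 0 <= P n * (y * l n.+1 - 2 * w n * s * cos (phi n.+1 - phi n)).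
  have h : w n * s * cos (phi n.+1 - phi n) <= w n * s by rewrite ler_piMr.
  by apply: mulr_ge0 => //; lra.
have hc : 0 <= w n * s * E n * (cos (phi n.+1 - phi n) - s - 1 / 2).
  by apply: mulr_ge0; [exact: mulr_ge0|lra].
have hk : kap / 8 * (y * l n.+1) * G sg w n <= w n * s * E n / 4.
  apply: (@le_trans _ _ (kap / 8 * (y * l n.+1) * (2 * E n))).
    by rewrite ler_wpM2l// !mulr_ge0// ltW.
  have := ler_wpM2r En kw; lra.
have -> : G sg w n.+1 = G sg w n + (E n.+1 - E n) + y * l n.+1 * P n +
   w n * sg * (M n.+1 (phi n.+1) - M n (phi n)) +
   (w n.+1 - w n) * sg * M n.+1 (phi n.+1).
  by rewrite /G hS; ring.
lra.
Qed.

Lemma lyapunov_growth sg w kap m n : (m <= n)%N -> sg ^+ 2 = 1 -> 0 <= kap ->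
  (forall j, (m <= j)%N ->
    let s := sg * sin (phi j.+1 - phi j) in
    [/\ 0 <= s <= 1 / 4, 3 / 4 <= cos (phi j.+1 - phi j), 0 <= w j <= 1,
      `|w j.+1 - w j| <= w j * s / 2 &
      2 * w j * s <= y * l j.+1 /\ kap * (y * l j.+1) <= w j * s]) ->
  E m / 4 * expR (kap / 16 * y * \sum_(m <= j < n) l j.+1) <= E n.
Proof.
move=> mn sg1 k0 H.
have HG : G sg w m * expR (kap / 16 * y * \sum_(m <= j < n) l j.+1) <= G sg w n.
  elim: n mn => [|n IH]; first by rewrite leqn0 => /eqP->; rewrite big_geq// mulr0 expR0 mulr1.
  rewrite leq_eqVlt ltnS => /predU1P[<-|mn]; first by rewrite big_geq// mulr0 expR0 mulr1.
  have [s0 c0 w0 dw [ws kw]] := H n mn.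
  apply: le_trans (lyapunov_step sg1 s0 c0 w0 k0 dw ws kw).
  rewrite big_nat_recr//= mulrDr expRD mulrA mulrC ler_pM ?expR_ge0//.
  - rewrite mulr_ge0 ?expR_ge0//.
    have [_ _ wm _ _] := H m (leqnn m).
    have /andP[+ _] := lyapunov_bounds sg1 wm; apply: le_trans.
    by rewrite divr_ge0// sqnorm_ge0.
  (* [expR_half_le] halves the rate and needs an argument at most 1; this follows from
     [kap * (y * l n.+1) <= w n * s <= 1 / 4]. *)
  - have -> : kap / 16 * y * l n.+1 = kap / 8 * (y * l n.+1) / 2 by lra.
    apply: expR_half_le; apply/andP; split.
      by rewrite !mulr_ge0// ltW// lpos.
    case/andP: s0 => s0 s1; case/andP: w0 => w0 w1.
    have : w n * (sg * sin (phi n.+1 - phi n)) <= 1 * (1 / 4) by rewrite ler_pM.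
    by lra.
  - exact: IH.
have [_ _ wm _ _] := H m (leqnn m); have [_ _ wn _ _] := H n mn.
have /andP[Gm _] := lyapunov_bounds sg1 wm.
have /andP[_ Gn] := lyapunov_bounds sg1 wn.
have e0 : 0 < expR (kap / 16 * y * \sum_(m <= j < n) l j.+1) by exact: expR_gt0.
have := ler_wpM2r (ltW e0) Gm; lra.
Qed.

End imaginary_axis.

(** * Upper bounds in fixed and moving frames *)

Definition coord {R : realType} (t : R) (u1 u2 : R[i]) : R[i] :=
  real_complex R (cos t) * u1 + real_complex R (sin t) * u2.

Lemma normc_trig (R : realType) (t : R) :
  normc (real_complex R (cos t)) <= 1 /\ normc (real_complex R (sin t)) <= 1.
Proof.
by rewrite !normc_real !ler_norml cos_geN1 cos_le1 sin_geN1 sin_le1.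
Qed.

Lemma normc_coord_le (R : realType) (t a b : R) (u1 u2 : R[i]) :
  normc (real_complex R (cos t)) <= a -> normc (real_complex R (sin t)) <= b ->
  normc (coord t u1 u2) <= a * normc u1 + b * normc u2.
Proof.
move=> ca sb; rewrite /coord (le_trans (le_normcD _ _))// !normcM.
by rewrite lerD// ler_wpM2r// normc_ge0.
Qed.

Lemma rmorph_sin2 (R : realType) (t : R) :
  real_complex R (sin t) * real_complex R (sin t) =
  1 - real_complex R (cos t) * real_complex R (cos t).
Proof. by rewrite -!rmorphM/= sin2D rmorphB rmorph1. Qed.

Lemma coordB (R : realType) (t t' : R) (u1 u2 : R[i]) :
  coord t' u1 u2 = coord (t' - t) (coord t u1 u2) (coord t u2 (- u1)).
Proof.
rewrite /coord cosB sinB !(rmorphD, rmorphB, rmorphM)/=.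
have k := rmorph_sin2 t.
by ring: k.
Qed.

(** [coord t u2 (- u1)] is the coordinate along eta_t, so this is the second row of the rotation
    whose first row is [coordB]. *)
Lemma coordBN (R : realType) (t t' : R) (u1 u2 : R[i]) :
  coord t' u2 (- u1) = coord (t' - t) (coord t u2 (- u1)) (- coord t u1 u2).
Proof.
rewrite (coordB t); congr (coord _ _ _); rewrite /coord; ring.
Qed.

Lemma normc_coord (R : realType) (t : R) (u1 u2 : R[i]) :
  normc (coord t u1 u2) <= normc u1 + normc u2.
Proof.
have [c1 s1] := normc_trig t.
by have := normc_coord_le u1 u2 c1 s1; rewrite !mul1r.
Qed.

Lemma normc_opp (R : realType) (x : R[i]) : normc (- x) = normc x.
Proof. exact: normcN. Qed.

Lemma normc_coordK (R : realType) (t : R) (u1 u2 : R[i]) :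
  normc u1 + normc u2 <=
  2 * (normc (coord t u1 u2) + normc (coord t u2 (- u1))).
Proof.
have h1 : u1 = coord (- t) (coord t u1 u2) (coord t u2 (- u1)).
  by rewrite -[- t]add0r -coordB /coord cos0 sin0 rmorph1 rmorph0; ring.
have h2 : u2 = coord (- t) (coord t u2 (- u1)) (- coord t u1 u2).
  by rewrite -[- t]add0r -coordBN /coord cos0 sin0 rmorph1 rmorph0; ring.
have := normc_coord (- t) (coord t u1 u2) (coord t u2 (- u1)).
have := normc_coord (- t) (coord t u2 (- u1)) (- coord t u1 u2).
by rewrite -h1 -h2 normc_opp; lra.
Qed.

Section upper.
Variables (R : realType) (l phi : nat -> R) (z : R[i]) (u1 u2 : nat -> R[i]).
Hypothesis lpos : forall j, 0 < l j.+1.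
Hypothesis Hu : transfer_rec l phi z u1 u2.
Let r := normc z.
Let T n := normc (u1 n) + normc (u2 n).
Let p t n := coord t (u1 n) (u2 n).
Let q t n := coord t (u2 n) (- u1 n).

Lemma coord_step t n : let th := phi n.+1 - t in
  p t n.+1 = p t n - z * real_complex R (l n.+1 * sin th) *
    coord th (p t n) (q t n) /\
  q t n.+1 = q t n + z * real_complex R (l n.+1 * cos th) *
    coord th (p t n) (q t n).
Proof.
rewrite /= -coordB /p /q; have [-> ->] := Hu n.
rewrite /coord cosB sinB !(rmorphD, rmorphB, rmorphM)/=.
have k := rmorph_sin2 t.
by split; ring: k.
Qed.

(** One step adds at most [r l (A sg + 1) |w|] to the weighted norm, where w is the component along
    xi. Both [A sg + 1 = A (1/A + sg)] and [|w| <= (1/A + sg) (A |p| + |q|)] contribute a factor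
    [1/A + sg]. *)
Lemma frame_growth t A n : 1 <= A ->
  let sg := `|sin (phi n.+1 - t)| in
  A * normc (p t n.+1) + normc (q t n.+1) <=
  (1 + r * l n.+1 * A * (A^-1 + sg) ^+ 2) *
    (A * normc (p t n) + normc (q t n)).
Proof.
move=> A1; cbv zeta; set sg := `|_|.
have [-> ->] := coord_step t n.
set th := phi n.+1 - t; set w := coord th _ _.
have A0 : 0 < A by lra.
have r0 : 0 <= r by exact: normc_ge0.
have np := normc_ge0 (p t n); have nq := normc_ge0 (q t n).
have nw : normc w <= normc (p t n) + sg * normc (q t n).
  have [c1 _] := normc_trig th.
  have s1 : normc (real_complex R (sin th)) <= sg by rewrite normc_real.
  by have := normc_coord_le (p t n) (q t n) c1 s1; rewrite mul1r.
have sg0 : 0 <= sg by exact: normr_ge0.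
have l0 : 0 < l n.+1 by [].
have h1 : normc (p t n - z * real_complex R (l n.+1 * sin th) * w) <=
    normc (p t n) + r * (l n.+1 * sg) * normc w.
  rewrite (le_trans (le_normcD _ _))// normc_opp !normcM normc_real normrM.
  by rewrite (gtr0_norm l0).
have h2 : normc (q t n + z * real_complex R (l n.+1 * cos th) * w) <=
    normc (q t n) + r * l n.+1 * normc w.
  rewrite (le_trans (le_normcD _ _))// lerD2l !normcM normc_real normrM.
  rewrite (gtr0_norm l0) ler_wpM2r ?normc_ge0// ler_wpM2l// ler_piMr ?(ltW l0)//.
  by rewrite ler_norml cos_geN1 cos_le1.
set P := normc (p t n) in np nw h1 *; set Q := normc (q t n) in nq nw h2 *.
have nw2 : normc w <= (A^-1 + sg) * (A * P + Q).
  apply: (le_trans nw).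
  have -> : (A^-1 + sg) * (A * P + Q) = P + sg * Q + A^-1 * Q + sg * A * P.
    by field; rewrite gt_eqF.
  have : 0 <= A^-1 * Q by rewrite mulr_ge0// invr_ge0 ltW.
  have : 0 <= sg * A * P by rewrite !mulr_ge0// ltW.
  lra.
have h3 := ler_wpM2l (ltW A0) h1.
have h4 : r * l n.+1 * (A * sg + 1) * normc w <=
    r * l n.+1 * (A * sg + 1) * ((A^-1 + sg) * (A * P + Q)).
  by rewrite ler_wpM2l// !mulr_ge0 ?addr_ge0 ?mulr_ge0// ltW.
have -> : (1 + r * l n.+1 * A * (A^-1 + sg) ^+ 2) * (A * P + Q) =
  A * P + Q + r * l n.+1 * (A * sg + 1) * ((A^-1 + sg) * (A * P + Q)).
  by field; rewrite gt_eqF.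
lra.
Qed.

Lemma tail_growth n : T n.+1 <= (1 + 2 * (r * l n.+1)) * T n.
Proof.
have [h1 h2] := Hu n; rewrite /T h1 h2 -/(coord (phi n.+1) (u1 n) (u2 n)).
have nw := normc_coord (phi n.+1) (u1 n) (u2 n).
set w := coord _ _ _ in nw *.
have rl : 0 <= r * l n.+1 by rewrite mulr_ge0 ?normc_ge0// ltW.
have key v u (a : R) : `|a| <= 1 -> normc v = normc (z * real_complex R (l n.+1 * a) * w) ->
    normc (u + v) <= normc u + r * l n.+1 * T n.
  move=> a1 nv; rewrite (le_trans (le_normcD _ _))// lerD2l nv !normcM normc_real.
  rewrite normrM (gtr0_norm (lpos n)).
  have h : r * (l n.+1 * `|a|) <= r * l n.+1.
    by rewrite mulrA ler_piMr.
  by apply: ler_pM => //; rewrite ?normc_ge0// !mulr_ge0 ?normc_ge0// ltW.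
have k1 := key (- (z * real_complex R (l n.+1 * sin (phi n.+1)) * w)) (u1 n) (sin (phi n.+1)).
have k2 := key (z * real_complex R (l n.+1 * cos (phi n.+1)) * w) (u2 n) (cos (phi n.+1)).
have := k1 ltac:(by rewrite ler_norml sin_geN1 sin_le1) (normc_opp _).
have := k2 ltac:(by rewrite ler_norml cos_geN1 cos_le1) erefl.
by rewrite /T; lra.
Qed.

(** In the frame of the current angle [sg] vanishes and the transfer costs only [r l / A]. The
    passage to the next frame mixes the coordinates by [s], which the weight enlarges to [s A]. A
    decrease of the weight is free. *)
Lemma moving_frame_growth A A' n : 1 <= A -> 0 <= A' <= A ->
  let s := `|sin (phi n.+2 - phi n.+1)| in
  A' * normc (p (phi n.+2) n.+1) + normc (q (phi n.+2) n.+1) <=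
  (1 + r * l n.+1 / A) * (1 + 2 * (s * A)) *
    (A * normc (p (phi n.+1) n) + normc (q (phi n.+1) n)).
Proof.
move=> A1 /andP[A'0 A'A]; cbv zeta; set s := `|_|.
have := frame_growth (phi n.+1) n A1.
have A0 : 0 < A by lra.
rewrite /= subrr sin0 normr0 addr0.
have -> : r * l n.+1 * A * A^-1 ^+ 2 = r * l n.+1 / A by field; rewrite gt_eqF.
set K := 1 + r * l n.+1 / A; set N := A * normc (p (phi n.+1) n) + _ => h.
set P := normc (p (phi n.+1) n.+1) in h; set Q := normc (q (phi n.+1) n.+1) in h.
have P0 : 0 <= P by exact: normc_ge0.
have Q0 : 0 <= Q by exact: normc_ge0.
have s0 : 0 <= s by exact: normr_ge0.
have [c1 _] := normc_trig (phi n.+2 - phi n.+1).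
have s1 : normc (real_complex R (sin (phi n.+2 - phi n.+1))) <= s by rewrite normc_real.
have h1 : normc (p (phi n.+2) n.+1) <= P + s * Q.
  rewrite /p (coordB (phi n.+1)).
  by have := normc_coord_le (p (phi n.+1) n.+1) (q (phi n.+1) n.+1) c1 s1; rewrite mul1r.
have h2 : normc (q (phi n.+2) n.+1) <= Q + s * P.
  rewrite /q (coordBN (phi n.+1)).
  have := normc_coord_le (q (phi n.+1) n.+1) (- p (phi n.+1) n.+1) c1 s1.
  by rewrite mul1r normc_opp.
have h3 : A' * normc (p (phi n.+2) n.+1) <= A * (P + s * Q).
  by rewrite ler_pM// normc_ge0.
have h4 : (1 + 2 * (s * A)) * (A * P + Q) <= (1 + 2 * (s * A)) * (K * N).
  rewrite ler_wpM2l// addr_ge0// !mulr_ge0// ltW//.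
have h5 : s * P <= s * A * (A * P).
  have : 0 <= s * P * (A * A - 1) by rewrite !mulr_ge0//; nra.
  lra.
have h6 : 0 <= s * A * Q by rewrite !mulr_ge0// ltW.
have h7 : 0 <= s * A * (A * P) by rewrite !mulr_ge0// ltW.
lra.
Qed.

Lemma tail_exp_growth n m : (n <= m)%N ->
  T m <= T n * expR (2 * r * \sum_(n <= j < m) l j.+1).
Proof.
elim: m => [|m IH]; first by rewrite leqn0 => /eqP->; rewrite big_geq// mulr0 expR0 mulr1.
rewrite leq_eqVlt ltnS => /predU1P[<-|nm]; first by rewrite big_geq// mulr0 expR0 mulr1.
rewrite big_nat_recr//= mulrDr expRD mulrA mulrC (le_trans (tail_growth m))//.
apply: ler_pM; rewrite ?addr_ge0 ?mulr_ge0 ?normc_ge0 ?(ltW (lpos _))//.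
  by rewrite -mulrA expR_ge1Dx.
exact: IH.
Qed.

(** The factor [4 * A 0] is the price of entering the weighted norm at 0 and of leaving the frame at
    [n]. *)
Lemma upper_bound_moving (A : nat -> R) n m : (n <= m)%N ->
  (forall j, 1 <= A j) -> (forall j, A j.+1 <= A j) ->
  T m <= 4 * A 0%N * T 0%N *
    expR (\sum_(0 <= j < n) (r * l j.+1 / A j + 2 *
      (`|sin (phi j.+2 - phi j.+1)| * A j)) + 2 * r * \sum_(n <= j < m) l j.+1).
Proof.
move=> nm A1 AS; pose N j := A j * normc (p (phi j.+1) j) + normc (q (phi j.+1) j).
have A0 j : 0 < A j by apply: lt_le_trans (A1 j).
have N0 j : 0 <= N j by rewrite addr_ge0 ?mulr_ge0 ?normc_ge0// ltW.
have HN : N n <= N 0%N * expR (\sum_(0 <= j < n) (r * l j.+1 / A j + 2 *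
      (`|sin (phi j.+2 - phi j.+1)| * A j))).
  elim: n {nm} => [|n IH]; first by rewrite big_geq// expR0 mulr1.
  have h : 0 <= A n.+1 <= A n by rewrite AS ltW.
  apply: le_trans (moving_frame_growth n (A1 n) h) _.
  rewrite big_nat_recr//= expRD [leRHS]mulrA [leLHS]mulrC -/(N n).
  have e0 : 0 <= r * l n.+1 / A n.
    by rewrite !mulr_ge0 ?invr_ge0 ?normc_ge0// ltW.
  have e1 : 0 <= 2 * (`|sin (phi n.+2 - phi n.+1)| * A n).
    by rewrite !mulr_ge0// ltW.
  apply: ler_pM => //; first by rewrite mulr_ge0 ?addr_ge0.
  by rewrite expRD ler_pM ?addr_ge0// expR_ge1Dx.
have Tn : T n <= 2 * N n.
  apply: le_trans (normc_coordK (phi n.+1) (u1 n) (u2 n)) _.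
  rewrite ler_pM2l// lerD2r ler_peMl ?normc_ge0//.
have N0T : N 0%N <= 2 * A 0%N * T 0%N.
  have h1 := normc_coord (phi 1%N) (u1 0%N) (u2 0%N).
  have h2 := normc_coord (phi 1%N) (u2 0%N) (- u1 0%N).
  rewrite normc_opp in h2.
  have h3 := ler_wpM2l (ltW (A0 0%N)) h1.
  have h4 : T 0%N <= A 0%N * T 0%N by rewrite ler_peMl// addr_ge0 ?normc_ge0.
  by rewrite /N /p /q /T in h3 h4 *; lra.
have hT := tail_exp_growth nm.
rewrite expRD mulrA; apply: le_trans hT _.
rewrite ler_wpM2r ?expR_ge0//.
apply: le_trans Tn _; set e := expR _ in HN *.
have e0 : 0 <= e by exact: expR_ge0.
have := ler_wpM2r e0 N0T; lra.
Qed.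

(** The exponents [e] are left free because the steps before and after the critical index are
    estimated in different ways. *)
Lemma upper_bound_fixed t (A : R) (e : nat -> R) n : 1 <= A ->
  (forall j, 1 + r * l j.+1 * A * (A^-1 + `|sin (phi j.+1 - t)|) ^+ 2 <=
     expR (e j)) ->
  T n <= 4 * A * T 0%N * expR (\sum_(0 <= j < n) e j).
Proof.
move=> A1 He; have A0 : 0 < A by apply: lt_le_trans A1.
pose N j := A * normc (p t j) + normc (q t j).
have HN : N n <= N 0%N * expR (\sum_(0 <= j < n) e j).
  elim: n => [|n IH]; first by rewrite big_geq// expR0 mulr1.
  apply: le_trans (frame_growth t n A1) _.
  rewrite big_nat_recr//= expRD [leRHS]mulrA [leLHS]mulrC -/(N n).
  apply: ler_pM => //.
    by rewrite addr_ge0 ?mulr_ge0 ?normc_ge0// ltW.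
  have r0 : 0 <= r by exact: normc_ge0.
  apply: addr_ge0 => //; apply: mulr_ge0; last exact: sqr_ge0.
  by apply: mulr_ge0; [apply: mulr_ge0 => //|]; exact: ltW.
have Tn : T n <= 2 * N n.
  apply: le_trans (normc_coordK t (u1 n) (u2 n)) _.
  by rewrite ler_pM2l// lerD2r ler_peMl ?normc_ge0.
have N0T : N 0%N <= 2 * A * T 0%N.
  have h1 := normc_coord t (u1 0%N) (u2 0%N).
  have h2 := normc_coord t (u2 0%N) (- u1 0%N).
  rewrite normc_opp in h2.
  have h3 := ler_wpM2l (ltW A0) h1.
  have h4 : T 0%N <= A * T 0%N by rewrite ler_peMl// addr_ge0 ?normc_ge0.
  by rewrite /N /p /q /T in h3 h4 *; lra.
apply: le_trans Tn _; set E := expR _ in HN *.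
have e0 : 0 <= E by exact: expR_ge0.
have := ler_wpM2r e0 N0T; lra.
Qed.

End upper.

(** * Regular variation *)

Lemma wlength_scale (R : realType) (c : R) (A : set (ocitv_type R)) : 0 < c ->
  ocitv A -> ocitv ((fun x => c * x) @^-1` A) /\
  (c%:E * wlength idfun ((fun x : R => c * x)%R @^-1` A) = wlength idfun A)%E.
Proof.
move=> c0 /ocitvP[->|[[a b] /= ab ->]].
  by rewrite preimage_set0 wlength0 mule0; split => //; exact: ocitv0.
have -> : (fun x => c * x) @^-1` `]a, b]%classic = `](a / c), (b / c)]%classic.
  by apply/seteqP; split => x /=; rewrite !in_itv/= ltr_pdivrMr// ler_pdivlMr// (mulrC x).
have h : a / c < b / c by rewrite ltr_pM2r// invr_gt0.
split; first exact: is_ocitv.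
rewrite !wlength_itv_bnd ?ltW//= -EFinM; congr EFin.
by field; rewrite gt_eqF.
Qed.

(** A cover by half-open intervals pulls back to a cover with all lengths divided by [c]. The
    reverse inequality is this one for [c^-1]. *)
Lemma mu_ext_scale_le (R : realType) (c : R) (X : set R) : 0 < c ->
  (c%:E * mu_ext (@wlength R idfun) ((fun x : R => c * x)%R @^-1` X) <=
   mu_ext (@wlength R idfun) X)%E.
Proof.
move=> c0; apply: le_ereal_inf_tmp => _ [F [mF XF] <-].
have mG k := (wlength_scale c0 (mF k)).1.
have -> : (\sum_(k <oo) wlength idfun (F k) =
   c%:E * \sum_(k <oo) wlength idfun ((fun x : R => c * x)%R @^-1` F k))%E.
  rewrite -nneseriesZl//.
  by apply: eq_eseriesr => k _; rewrite (wlength_scale c0 (mF k)).2.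
rewrite lee_pmul2l//; apply: ereal_inf_lbound.
exists (fun k => (fun x : R => c * x) @^-1` F k) => //; split => // x /= /XF[k _ Fk].
by exists k.
Qed.

Lemma mu_ext_scale (R : realType) (c : R) (X : set R) : 0 < c ->
  (c%:E * mu_ext (@wlength R idfun) ((fun x : R => c * x)%R @^-1` X) =
   mu_ext (@wlength R idfun) X)%E.
Proof.
move=> c0; apply/eqP; rewrite eq_le mu_ext_scale_le//=.
have ci : 0 < c^-1 by rewrite invr_gt0.
have := mu_ext_scale_le ((fun x : R => c * x) @^-1` X) ci.
rewrite -comp_preimage.
have -> : (fun x => c * x) \o (fun x => c^-1 * x) = id :> (R -> R).
  by apply/funext => x /=; rewrite mulVKf// gt_eqF.
rewrite preimage_id => h.
have -> : mu_ext (@wlength R idfun) X =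
    (c%:E * (c^-1%:E * mu_ext (@wlength R idfun) X))%E.
  by rewrite muleA -EFinM divff ?mul1e// gt_eqF.
by rewrite lee_pmul2l.
Qed.

(** Continuity of the dilation would only handle Borel sets. Since the outer measure is homogeneous,
    the Caratheodory criterion for the preimage against [X] is the one for [A] against the dilated
    set [Y]. *)
Lemma measurable_scale (R : realType) (c : R) (A : set (lebesgueType R)) : 0 < c ->
  measurable A -> measurable ((fun x : R => c * x) @^-1` A : set (lebesgueType R)).
Proof.
move=> c0 mA; have {}mA : caratheodory_measurable (@wlength R idfun)^*%mu A := mA.
suff: caratheodory_measurable (@wlength R idfun)^*%mu
  ((fun x : R => c * x) @^-1` A) by [].
move=> X.
have ci : 0 < c^-1 by rewrite invr_gt0.
pose Y := (fun x : R => c^-1 * x) @^-1` X.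
have XE : X = (fun x : R => c * x) @^-1` Y.
  rewrite /Y -comp_preimage.
  have -> : (fun x => c^-1 * x) \o (fun x => c * x) = id :> (R -> R).
    by apply/funext => x /=; rewrite mulKf// gt_eqF.
  by rewrite preimage_id.
have h (B : set R) : mu_ext (@wlength R idfun) ((fun x : R => c * x)%R @^-1` B) =
    (c^-1%:E * mu_ext (@wlength R idfun) B)%E.
  by rewrite -(mu_ext_scale B c0) muleA -EFinM mulVf ?mul1e// gt_eqF.
rewrite XE preimage_setC -!preimage_setI !h (mA Y).
by rewrite ge0_muleDr// mu_ext_ge0// => Z; exact: wlength_ge0.
Qed.

Lemma completed_measure_scale (R : realType) (c : R) (A : set (lebesgueType R)) :
  0 < c -> (c%:E * @completed_lebesgue_measure R ((fun x : R => c * x)%R @^-1` A) =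
  @completed_lebesgue_measure R A)%E.
Proof. exact: mu_ext_scale. Qed.

Lemma completed_measure_itv (R : realType) (i : interval R) :
  @completed_lebesgue_measure R [set` i] = lebesgue_measure [set` i].
Proof. by []. Qed.

Lemma lebesgueType_measurable_itv (R : realType) (i : interval R) :
  measurable ([set` i] : set (lebesgueType R)).
Proof. by apply: sub_caratheodory; exact: measurable_itv. Qed.

(** The ratios that are good at [x m] for all [m >= n] form a sequence of sets increasing to [1, b],
    by the pointwise limits. Continuity of the measure makes one of them nearly full; this replaces
    uniform convergence. *)
Lemma rv_large_set (R : realType) (a : R -> R) (alpha : R) (x : nat -> R)
    (b K d : R) :
  regularly_varying a alpha -> (forall n, n%:R + 1 <= x n) -> 1 < b -> 0 < K ->
  (forall lam, 1 <= lam <= b -> K^-1 < lam `^ alpha < K) -> d < b - 1 ->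
  exists N, forall n, (N <= n)%N -> exists B : set (lebesgueType R),
    [/\ measurable B, B `<=` `[1, b]%classic,
      (d%:E < @completed_lebesgue_measure R B)%E &
      forall lam, B lam -> K^-1 <= a (lam * x n) / a (x n) <= K].
Proof.
move=> [apos ameas alim] xn b1 K0 HK db.
have x1 n : 1 <= x n by apply: le_trans (xn n); rewrite lerDr.
pose D m : set (lebesgueType R) :=
  [set lam | 1 <= lam <= b /\ K^-1 <= a (lam * x m) / a (x m) <= K].
have mD m : measurable (D m).
  have xm0 : 0 < x m by apply: lt_le_trans (x1 m).
  have am0 : 0 < a (x m) by exact: apos.
  have -> : D m = ([set` `[1, b]] : set (lebesgueType R)) `&`
      ((fun t : R => x m * t) @^-1`
        (`[1, +oo[%classic `&` a @^-1` `[(a (x m) / K), (a (x m) * K)]%classic)).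
    apply/seteqP; split => t /=; rewrite !in_itv/= ?andbT.
      move=> [/andP[t1 tb]]; rewrite ler_pdivlMr// ler_pdivrMr// (mulrC t) => /andP[h1 h2].
      split; first by rewrite t1.
      split; first by rewrite -[leLHS]mulr1 ler_pM.
      by rewrite [a (x m) / K]mulrC h1 [a (x m) * K]mulrC.
    move=> [t1b [_ /andP[h1 h2]]]; split => //.
    by rewrite ler_pdivlMr// ler_pdivrMr// (mulrC t) (mulrC K^-1) (mulrC K) h1.
  apply: measurableI; first exact: lebesgueType_measurable_itv.
  apply: measurable_scale => //.
  apply: ameas; last exact: measurable_itv.
  exact: lebesgueType_measurable_itv.
pose V n := \bigcap_(m in [set m | (n <= m)%N]) D m.
have mV n : measurable (V n) by apply: bigcap_measurable => [|k _]; [by exists n => /=|exact: mD].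
have ndV : nondecreasing_seq V.
  move=> n m nm; apply/subsetPset => t Vt k /= mk; apply: Vt => /=.
  exact: leq_trans mk.
have VU : \bigcup_n V n = ([set` `[1, b]] : set (lebesgueType R)).
  apply/seteqP; split => [t [n _ /(_ n (leqnn n))[tb _]]|t /=].
    by rewrite /= in_itv.
  rewrite in_itv/= => t1b.
  have t0 : 0 < t by case/andP: t1b => t1 _; apply: lt_le_trans t1.
  have /andP[k1 k2] := HK t t1b.
  have e0 : 0 < Num.min (t `^ alpha - K^-1) (K - t `^ alpha).
    by rewrite lt_min !subr_gt0 k1.
  have /cvgrPdist_lt/(_ _ e0)[M [_ HM]] := alim t t0.
  exists (Num.truncn `|M|).+1 => // m /= Mm; split => //.
  have : M < x m.
    apply: lt_le_trans (xn m); have := ltnW Mm.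
    rewrite -(ler_nat R) => h; have := truncnS_gt `|M|.
    have := ler_norm M; have : (Num.truncn `|M|).+1%:R <= m%:R :> R by rewrite ler_nat.
    lra.
  move=> /HM /=; rewrite lt_min !ltr_norml => /andP[/andP[h1 h2] /andP[h3 h4]].
  by apply/andP; split; lra.
have [N HN] : exists N, (d%:E < @completed_lebesgue_measure R (V N))%E.
  apply: contrapT => /forallNP H.
  have cv := nondecreasing_cvg_mu (mu := @completed_lebesgue_measure R) mV
    ltac:(rewrite VU; exact: lebesgueType_measurable_itv) ndV.
  have : (@completed_lebesgue_measure R (\bigcup_n V n) <= d%:E)%E.
    rewrite -(cvg_lim _ cv)//; apply: lime_le; first by apply/cvg_ex; eexists; exact: cv.
    by apply: nearW => n /=; rewrite leNgt; apply/negP/H.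
  rewrite VU completed_measure_itv lebesgue_measure_itv/= lte_fin b1 -EFinB lee_fin.
  lra.
exists N => n Nn; exists (V N); split => // [t /(_ n Nn)[]|t /(_ n Nn)[]//].
by rewrite /= in_itv.
Qed.

(* Steinhaus' argument: if a (lam_n x_n) / a x_n were unbounded, the sets of good
   ratios based at x_n and at y_n = lam_n x_n would have nearly full measure in
   [1, 4] and [1, 2], so the first would meet lam_n times the second. *)
Lemma rv_locally_bounded (R : realType) (a : R -> R) (alpha : R) :
  regularly_varying a alpha -> exists X K : R, [/\ 1 <= X, 0 < K &
    forall x lam, X <= x -> 1 <= lam <= 2 -> K^-1 <= a (lam * x) / a x <= K].
Proof.
move=> rva; have [apos _ _] := rva.
(* The summand 1 makes the bounds on [lam] to the power [alpha] strict over [1, 4], as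
   [rv_large_set] asks. *)
pose K := 4 `^ `|alpha| + 1.
have K1 : 1 <= K by rewrite lerDr powR_ge0.
have K0 : 0 < K by lra.
have HK lam : 1 <= lam <= 4 -> K^-1 < lam `^ alpha < K.
  move=> /andP[l1 l4]; have l0 : 0 < lam by lra.
  have h : lam `^ `|alpha| < K.
    by rewrite ltr_pwDr// ge0_ler_powR// nnegrE//; lra.
  have h1 : lam `^ alpha < K by apply: le_lt_trans h; rewrite ler_powR// ler_norm.
  rewrite h1 andbT invf_plt ?posrE ?powR_gt0// -powRN.
  by apply: le_lt_trans h; rewrite ler_powR// -normrN ler_norm.
apply: contrapT => H.
have /choice[f Hf] (n : nat) : exists f : R * R, [/\ n%:R + 1 <= f.1, 1 <= f.2 <= 2 &
    ~ (K ^+ 2)^-1 <= a (f.2 * f.1) / a f.1 <= K ^+ 2].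
  apply: contrapT => /forallNP Hn; apply: H; exists (n%:R + 1), (K ^+ 2); split.
  - by rewrite lerDr.
  - by rewrite exprn_gt0.
  - move=> x lam xn l12; apply: contrapT => Hc; exact: (Hn (x, lam)).
pose x n := (f n).1; pose lam n := (f n).2; pose y n := lam n * x n.
have xn n : n%:R + 1 <= x n by have [] := Hf n.
have ln n : 1 <= lam n <= 2 by have [] := Hf n.
have x1 n : 1 <= x n by apply: le_trans (xn n); rewrite lerDr.
have yx n : x n <= y n.
  by have /andP[? _] := ln n; rewrite /y ler_peMl//; have := x1 n; lra.
have yn n : n%:R + 1 <= y n by exact: le_trans (yx n).
(* The measures 5/2 and 1/2 add up to the length of [1, 4]. This interval contains both [B1] and the
   dilate [B3] of [B2], so two strict inequalities force them to meet. *)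
have [N1 H1] := @rv_large_set _ a alpha x 4 K (5 / 2) rva xn ltac:(lra) K0 HK ltac:(lra).
have [N2 H2] := @rv_large_set _ a alpha y 2 K (1 / 2) rva yn ltac:(lra) K0
  (fun t t12 => HK t ltac:(lra)) ltac:(lra).
pose n := maxn N1 N2.
have [B1 [mB1 B1s B1m HB1]] := H1 n (leq_maxl _ _).
have [B2 [mB2 B2s B2m HB2]] := H2 n (leq_maxr _ _).
have /andP[ln1 ln2] := ln n.
have l0 : 0 < lam n by lra.
have li0 : 0 < (lam n)^-1 by rewrite invr_gt0.
pose B3 : set (lebesgueType R) := (fun t : R => (lam n)^-1 * t) @^-1` B2.
have mB3 : measurable B3 by exact: measurable_scale.
have [t [B1t B3t]] : exists t, B1 t /\ B3 t.
  apply: contrapT => /forallNP H3.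
  have B3m : ((1 / 2)%:E < @completed_lebesgue_measure R B3)%E.
    apply: lt_le_trans B2m _; rewrite -(completed_measure_scale B2 li0).
    rewrite -[leRHS]mul1e; apply: lee_wpmul2r => //.
    by rewrite lee_fin invf_le1.
  have B13 : (@completed_lebesgue_measure R (B1 `|` B3) <= 3%:E)%E.
    apply: (@le_trans _ _ (@completed_lebesgue_measure R [set` `[1, 4]])).
      apply: le_measure; rewrite ?inE.
      - exact: measurableU.
      - exact: lebesgueType_measurable_itv.
      - move=> t [/B1s//|/B2s] /=; rewrite !in_itv/=.
        rewrite [(lam n)^-1 * t]mulrC ler_pdivlMr// ler_pdivrMr// mul1r => /andP[h1 h2].
        by apply/andP; split; nra.
    rewrite completed_measure_itv lebesgue_measure_itv/= lte_fin.
    by case: ifP => _; rewrite -?EFinB lee_fin; lra.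
  move: B13; rewrite measureU//; last first.
    by apply/seteqP; split => // t [? ?]; exact: (H3 t).
  apply/negP; rewrite -ltNge.
  have -> : 3%:E = ((5 / 2)%:E + (1 / 2)%:E)%E :> \bar R by rewrite -EFinD; congr EFin; lra.
  exact: lteD.
have /andP[p1 p2] := HB1 t B1t; have /andP[q1 q2] := HB2 _ B3t.
have [_ _] := Hf n; rewrite -/(x n) -/(lam n); apply.
(* The common ratio leads from [x n] and from [y n] to the same point. Both values of [a] are within
   the factor [K] of the value there, hence within [K ^+ 2] of each other. *)
have tE : (lam n)^-1 * t * y n = t * x n.
  by rewrite /y; field; rewrite gt_eqF.
rewrite tE in q1 q2; rewrite -/(y n).
have B14 := B1s t B1t; rewrite /= in_itv/= in B14.
have x0 : 0 < a (x n) by exact: apos.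
have y0 : 0 < a (y n) by apply: apos; apply: le_trans (x1 n) (yx n).
have tx0 : 0 < a (t * x n).
  apply: apos; case/andP: B14 => t1 _; rewrite -[leLHS]mulr1 ler_pM//.
set A := a (x n) in x0 p1 p2 *; set B := a (y n) in y0 q1 q2 *.
set C := a (t * x n) in tx0 p1 p2 q1 q2.
have Ki : 0 < K^-1 by rewrite invr_gt0.
rewrite !ler_pdivlMr// in p1 q1; rewrite !ler_pdivrMr// in p2 q2.
have p1' : A <= K * C by rewrite -ler_pdivrMl.
have q1' : B <= K * C by rewrite -ler_pdivrMl.
apply/andP; split.
  rewrite ler_pdivlMr// ler_pdivrMl ?exprn_gt0//.
  by apply: le_trans p1' _; rewrite expr2 -mulrA ler_pM2l.
rewrite ler_pdivrMr//; apply: le_trans q1' _.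
by rewrite expr2 -mulrA ler_pM2l.
Qed.

(** * Potter bounds and asymptotic inverses *)

Definition growth_le {R : realType} (f : R -> R) (b : R) : Prop :=
  exists X C : R, [/\ 1 <= X, 0 < C &
    forall x y, X <= x -> x <= y -> f y <= C * (y / x) `^ b * f x].

(** The conclusion of Potter's theorem taken as a notion of its own; the growth bound for the
    reciprocal is the lower bound for [f]. In this form it is stable under products and reciprocals,
    so it reaches the functions inverted in [rate_k] and [rate_m]. *)
Definition potter {R : realType} (f : R -> R) (alpha : R) : Prop :=
  (forall t, 1 <= t -> 0 < f t) /\
  forall e, 0 < e -> growth_le f (alpha + e) /\
                     growth_le (fun t => (f t)^-1) (- alpha + e).

Lemma powR_le_max (R : realType) (x b M : R) : 1 <= x <= M -> x `^ b <= M `^ `|b|.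
Proof.
move=> /andP[x1 xM]; apply: (@le_trans _ _ (x `^ `|b|)).
  by rewrite ler_powR// ler_norm.
by rewrite ge0_ler_powR// nnegrE; lra.
Qed.

Lemma gt1_ltr_powR (R : realType) (a x y : R) : 1 < a -> x < y -> a `^ x < a `^ y.
Proof.
move=> a1 xy; have a0 : a == 0 = false by apply/eqP => a0; move: a1; rewrite a0; lra.
by rewrite /powR a0 ltr_expR ltr_pM2r// ln_gt0.
Qed.

Lemma powR_ge_min (R : realType) (x b M : R) : 1 <= x <= M -> 1 <= M `^ `|b| * x `^ b.
Proof.
move=> /andP[x1 xM]; have := @powR_le_max _ x (- b) M.
rewrite x1 xM normrN => /(_ isT); rewrite powRN => h.
by rewrite -ler_pdivrMr ?div1r// powR_gt0//; lra.
Qed.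

(** From [x] one doubles as long as [y] is not passed, each time with the exact factor [2 ^ b]. Only
    the last incomplete step uses [K], so the constant is paid once, whatever the number of
    doublings. *)
Lemma growth_le_doubling (R : realType) (f : R -> R) (b X K : R) : 1 <= X -> 0 < K ->
  (forall t, X <= t -> 0 < f t) ->
  (forall x lam, X <= x -> 1 <= lam <= 2 -> f (lam * x) <= K * f x) ->
  (forall x, X <= x -> f (2 * x) <= 2 `^ b * f x) ->
  growth_le f b.
Proof.
move=> X1 K0 fpos fK f2; exists X, (K * 2 `^ `|b|); split => //.
  by rewrite mulr_gt0// powR_gt0.
move=> x y Xx xy.
suff H k : forall x, X <= x -> x <= y -> y <= 2 ^+ k * x ->
    f y <= K * 2 `^ `|b| * (y / x) `^ b * f x.
  have x0 : 0 < x by lra.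
  apply: (H (Num.truncn (y / x)).+1) => //.
  rewrite -ler_pdivrMr//; apply: le_trans (ltW (truncnS_gt _)) _.
  by rewrite -natrX ler_nat; apply: ltnW; exact: ltn_expl.
elim: k => [|k IH] {Xx xy}x Xx xy yk.
  have -> : y = x by apply/eqP; rewrite eq_le xy andbT; move: yk; rewrite expr0 mul1r.
  have x0 : 0 < x by lra.
  have h := fK x 1 Xx ltac:(lra); rewrite mul1r in h.
  have fx := ltW (fpos x Xx).
  apply: (le_trans h); rewrite divff ?gt_eqF// powR1 mulr1 ler_wpM2r//.
  by rewrite ler_peMr// ?(ltW K0)// -[leLHS](powRr0 (2 : R)) ler_powR//; lra.
have x0 : 0 < x by lra.
have [y2|y2] := leP y (2 * x).
  have yx : 1 <= y / x <= 2.
    by rewrite ler_pdivlMr// ler_pdivrMr// mul1r xy.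
  have := fK x (y / x) Xx yx; rewrite divfK ?gt_eqF// => /le_trans; apply.
  have fx := ltW (fpos x Xx).
  rewrite ler_wpM2r// -mulrA ler_peMr// ?(ltW K0)//.
  exact: powR_ge_min.
have Xx2 : X <= 2 * x by lra.
have yk' : y <= 2 ^+ k * (2 * x) by rewrite mulrA -exprSr.
apply: (le_trans (IH (2 * x) Xx2 (ltW y2) yk')).
have c0 : 0 <= K * 2 `^ `|b| * (y / (2 * x)) `^ b.
  by rewrite !mulr_ge0 ?powR_ge0// ltW.
apply: le_trans (ler_wpM2l c0 (f2 x Xx)) _.
have fx := ltW (fpos x Xx).
have -> : (y / x) `^ b = (y / (2 * x)) `^ b * 2 `^ b.
  rewrite -powRM//; last by rewrite divr_ge0//; lra.
  by congr (_ `^ _); field; rewrite gt_eqF.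
by rewrite !mulrA.
Qed.

(** Besides local boundedness only the limit at ratio 2 enters: eventually [a (2 t) / a t] lies
    between the powers of 2 with exponents [alpha - e] and [alpha + e]. *)
Lemma rv_potter (R : realType) (a : R -> R) (alpha : R) :
  regularly_varying a alpha -> potter a alpha.
Proof.
move=> rva; have [apos _ alim] := rva; split => // e e0.
have [X [K [X1 K0 HK]]] := rv_locally_bounded rva.
have lt1 : 2 `^ (alpha - e) < (2 : R) `^ alpha by apply: gt1_ltr_powR; lra.
have lt2 : 2 `^ alpha < (2 : R) `^ (alpha + e) by apply: gt1_ltr_powR; lra.
have d0 : 0 < Num.min (2 `^ alpha - 2 `^ (alpha - e)) (2 `^ (alpha + e) - (2 : R) `^ alpha).
  by rewrite lt_min !subr_gt0 lt1.
have /cvgrPdist_lt/(_ _ d0)[M [_ HM]] := alim 2 ltac:(lra).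
pose Y := Num.max X (M + 1).
have Y1 : 1 <= Y by rewrite le_max X1.
have XY : X <= Y by rewrite le_max lexx.
have MY : M < Y by rewrite lt_max; apply/orP; right; lra.
have fpos t : Y <= t -> 0 < a t by move=> Yt; apply: apos; lra.
have f2 t : Y <= t -> 2 `^ (alpha - e) * a t <= a (2 * t) <= 2 `^ (alpha + e) * a t.
  move=> Yt; have Mt : M < t by lra.
  have at0 := fpos t Yt.
  have := HM t Mt; rewrite /= lt_min !ltr_norml => /andP[/andP[h1 h2] /andP[h3 h4]].
  apply/andP; split; [rewrite -ler_pdivlMr//|rewrite -ler_pdivrMr//]; lra.
have fK t lam : Y <= t -> 1 <= lam <= 2 -> K^-1 * a t <= a (lam * t) <= K * a t.
  move=> Yt l12; have at0 := fpos t Yt.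
  have := HK t lam ltac:(lra) l12.
  by rewrite ler_pdivlMr// ler_pdivrMr.
split; apply: (growth_le_doubling (X := Y) (K := K)) => //.
- by move=> t lam Yt l12; have /andP[] := fK t lam Yt l12.
- by move=> t Yt; have /andP[] := f2 t Yt.
- by move=> t Yt; rewrite invr_gt0 fpos.
- move=> t lam Yt l12; have /andP[h _] := fK t lam Yt l12.
  have at0 := fpos t Yt.
  have at1 : 0 < a (lam * t) by apply: lt_le_trans h; rewrite mulr_gt0// invr_gt0.
  rewrite -[K]invrK -invfM lef_pV2// posrE mulr_gt0// invr_gt0//.
- move=> t Yt; have /andP[h _] := f2 t Yt.
  have at0 := fpos t Yt.
  have p0 : 0 < (2 : R) `^ (alpha - e) by rewrite powR_gt0.
  have at1 : 0 < a (2 * t) by apply: lt_le_trans h; rewrite mulr_gt0.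
  have -> : 2 `^ (- alpha + e) = ((2 : R) `^ (alpha - e))^-1.
    by rewrite -powRN opprB addrC.
  by rewrite -invfM lef_pV2// posrE mulr_gt0.
Qed.

Lemma growth_leM (R : realType) (f g : R -> R) (b c : R) :
  (forall t, 1 <= t -> 0 <= f t) -> (forall t, 1 <= t -> 0 <= g t) ->
  growth_le f b -> growth_le g c -> growth_le (fun t => f t * g t) (b + c).
Proof.
move=> f0 g0 [X [C [X1 C0 Hf]]] [Y [D [Y1 D0 Hg]]].
exists (Num.max X Y), (C * D); split; rewrite ?mulr_gt0 ?le_max ?X1//.
move=> x y; rewrite ge_max => /andP[Xx Yx] xy.
have x0 : 0 < x by lra.
have fy := f0 y ltac:(lra); have gy := g0 y ltac:(lra).
have := ler_pM fy gy (Hf x y Xx xy) (Hg x y Yx xy).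
rewrite powRD; last by apply/implyP => _; rewrite gt_eqF// divr_gt0//; lra.
by move=> /le_trans; apply; rewrite le_eqVlt; apply/orP; left; apply/eqP; ring.
Qed.

Lemma growth_le_ext (R : realType) (f g : R -> R) (b : R) :
  (forall t, 1 <= t -> f t = g t) -> growth_le f b -> growth_le g b.
Proof.
move=> fg [X [C [X1 C0 Hf]]]; exists X, C; split => // x y Xx xy.
by rewrite -!fg; [exact: Hf|lra|lra].
Qed.

Lemma potterM (R : realType) (f g : R -> R) (alpha beta : R) :
  potter f alpha -> potter g beta ->
  potter (fun t => f t * g t) (alpha + beta).
Proof.
move=> [f0 Hf] [g0 Hg]; split => [t t1|e e0]; first by rewrite mulr_gt0 ?f0 ?g0.
have e20 : 0 < e / 2 by lra.
have [f1 f2] := Hf _ e20; have [g1 g2] := Hg _ e20; split.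
  have -> : alpha + beta + e = (alpha + e / 2) + (beta + e / 2) by lra.
  by apply: growth_leM => // t t1; rewrite ltW ?f0 ?g0.
have -> : - (alpha + beta) + e = (- alpha + e / 2) + (- beta + e / 2) by lra.
have h := growth_leM _ _ f2 g2.
apply: growth_le_ext (h _ _) => t t1 /=; first by rewrite invfM.
  by rewrite invr_ge0 ltW ?f0.
by rewrite invr_ge0 ltW ?g0.
Qed.

Lemma potterV (R : realType) (f : R -> R) (alpha : R) :
  potter f alpha -> potter (fun t => (f t)^-1) (- alpha).
Proof.
move=> [f0 Hf]; split => [t t1|e e0]; first by rewrite invr_gt0 f0.
have [f1 f2] := Hf e e0; split => //; rewrite opprK.
by apply: growth_le_ext f1 => t _; rewrite invrK.
Qed.

Lemma potter_ext (R : realType) (f g : R -> R) (alpha : R) :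
  (forall t, f t = g t) -> potter f alpha -> potter g alpha.
Proof. by move=> /funext->. Qed.

Lemma potter_local (R : realType) (f : R -> R) (alpha : R) : potter f alpha ->
  exists X K : R, [/\ 1 <= X, 0 < K & forall x y, X <= x -> x <= y -> y <= 2 * x ->
    f y <= K * f x /\ f x <= K * f y].
Proof.
move=> [f0 Hf]; have [[X [C [X1 C0 H1]]] [Y [D [Y1 D0 H2]]]] := Hf 1 ltr01.
pose P := 2 `^ `|alpha + 1| : R; pose Q := 2 `^ `|- alpha + 1| : R.
have P0 : 0 < P by rewrite powR_gt0.
have Q0 : 0 < Q by rewrite powR_gt0.
exists (Num.max X Y), (C * P + D * Q); split.
- by rewrite le_max X1.
- by rewrite addr_gt0 ?mulr_gt0.
move=> x y; rewrite ge_max => /andP[Xx Yx] xy y2.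
have x0 : 0 < x by lra.
have yx : 1 <= y / x <= 2 by rewrite ler_pdivlMr// ler_pdivrMr// mul1r xy.
have fx := f0 x ltac:(lra); have fy := f0 y ltac:(lra).
have h1 := H1 x y Xx xy; have h2 := H2 x y Yx xy.
have p1 : (y / x) `^ (alpha + 1) <= P by exact: powR_le_max.
have p2 : (y / x) `^ (- alpha + 1) <= Q by exact: powR_le_max.
have CP : 0 < C * P by rewrite mulr_gt0.
have DQ : 0 < D * Q by rewrite mulr_gt0.
split.
  apply: (le_trans h1); rewrite ler_wpM2r ?(ltW fx)//.
  have : C * (y / x) `^ (alpha + 1) <= C * P by rewrite ler_pM2l.
  by lra.
have : (f y)^-1 <= D * Q * (f x)^-1.
  by apply: (le_trans h2); rewrite ler_wpM2r ?invr_ge0 ?(ltW fx)// ler_pM2l.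
rewrite ler_pdivlMr// mulrC ler_pdivrMr// => /le_trans; apply.
by rewrite ler_wpM2r ?(ltW fy)//; lra.
Qed.

Lemma potter_unbounded (R : realType) (f : R -> R) (alpha : R) : potter f alpha ->
  0 < alpha -> forall M, exists Y, forall t, Y <= t -> M <= f t.
Proof.
move=> [f0 Hf] a0 M; have a20 : 0 < alpha / 2 by lra.
have [_ [X [C [X1 C0 H]]]] := Hf _ a20.
have X0 : 0 < X by lra.
have fX := f0 X X1.
pose Z := Num.max 1 (C * M / f X).
have Z1 : 1 <= Z by rewrite le_max lexx.
exists (X * Z `^ (2 / alpha)) => t Zt.
have Zp : 1 <= Z `^ (2 / alpha).
  by rewrite -[leLHS](powRr0 Z) ler_powR// divr_ge0//; lra.
have Xt : X <= t by apply: le_trans Zt; rewrite ler_peMr// ltW.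
have ft := f0 t ltac:(lra).
have := H X t (lexx _) Xt.
have -> : - alpha + alpha / 2 = - (alpha / 2) by lra.
rewrite powRN.
have tX : Z <= (t / X) `^ (alpha / 2).
  have -> : Z = (Z `^ (2 / alpha)) `^ (alpha / 2).
    rewrite -powRrM (_ : 2 / alpha * (alpha / 2) = 1) ?powRr1//; first lra.
    by field; rewrite gt_eqF.
  rewrite ge0_ler_powR ?nnegrE//; [lra|lra|by rewrite divr_ge0//; lra|].
  by rewrite ler_pdivlMr// mulrC.
set p := (t / X) `^ _ in tX *.
have p0 : 0 < p by lra.
rewrite -mulrA -invfM ler_pdivlMr ?mulr_gt0// ler_pdivrMl// => h.
have : C * M / f X <= p by apply: le_trans tX; rewrite le_max lexx orbT.
rewrite ler_pdivrMr// => h2.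
by rewrite -(ler_pM2l C0); lra.
Qed.

(** As [f] need not be monotone or continuous, its value at the supremum [T] says nothing directly.
    But [f (n + 1) >= r], since [n + 1 > T], and some [t] within 1 of [T] has [f t < r]; local
    comparability transfers both to the integer part [n]. *)
Lemma asymptotic_inverseP (R : realType) (f : R -> R) (alpha : R) : potter f alpha ->
  0 < alpha -> exists C X : R, [/\ 0 < C, 1 <= X &
  forall r, X <= r -> let T := asymptotic_inverse f r in let n := Num.truncn T in
    [/\ 1 <= T, f n%:R <= C * r, r <= C * f n%:R &
        forall t, T < t -> r <= f t]].
Proof.
move=> pf a0; have [f0 _] := pf.
have [X [K [X1 K0 HK]]] := potter_local pf.
exists (K + 1), (Num.max 1 (f (X + 1) + 1)); split; first by lra.
  by rewrite le_max lexx.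
move=> r; rewrite ge_max => /andP[r1 fr]; rewrite /asymptotic_inverse.
set S := [set t | _]; set T := sup S; set n := Num.truncn T.
have XS : S (X + 1) by split; lra.
have hS : has_sup S.
  split; first by exists (X + 1).
  have [Y HY] := potter_unbounded pf a0 r.
  exists Y => t [_ ftr]; rewrite leNgt; apply/negP => /ltW/HY; lra.
have XT : X + 1 <= T by apply: ub_le_sup => //; case: hS.
have HT t : T < t -> r <= f t.
  move=> Tt; rewrite leNgt; apply/negP => ftr.
  have : t <= T by apply: ub_le_sup; [case: hS|split => //; lra].
  lra.
have [t [t1 ftr] tT] := @sup_adherent _ S 1 ltr01 hS.
rewrite -/T in tT.
have tleT : t <= T by apply: ub_le_sup; [case: hS|].
have nT : n%:R <= T by rewrite truncn_le; lra.
have Tn : T < n%:R + 1 by rewrite natr1; exact: truncnS_gt.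
have n1 : X < n%:R by lra.
have [kn _] : f (n%:R + 1) <= K * f n%:R /\ f n%:R <= K * f (n%:R + 1).
  by apply: HK; lra.
have rn := HT _ Tn.
have fn0 := f0 n%:R ltac:(lra).
split; [lra| |lra|exact: HT].
have [nt|tn] := leP n%:R t.
  have [_ h] := HK n%:R t ltac:(lra) nt ltac:(lra).
  have : K * f t <= K * r by rewrite ler_pM2l// ltW.
  lra.
have [h _] := HK t n%:R ltac:(lra) (ltW tn) ltac:(lra).
have : K * f t <= K * r by rewrite ler_pM2l// ltW.
lra.
Qed.

(** Potter bounds of index [- delta], uniform from index 1 on. Unlike regular variation this is
    inherited through [asymp], hence holds for the lengths and the sines themselves. *)
Definition decays {R : realType} (u : nat -> R) (delta : R) : Prop :=
  (forall j, (0 < j)%N -> 0 < u j) /\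
  forall e, 0 < e -> exists2 C : R, 0 < C & forall i j, (0 < i)%N -> (i <= j)%N ->
    u i <= C * (j%:R / i%:R) `^ (delta + e) * u j /\
    u j <= C * (j%:R / i%:R) `^ (- delta + e) * u i.

Lemma finite_bound (R : realType) (g : nat -> R) N :
  exists2 D : R, 0 < D & forall i, (i < N)%N -> g i <= D.
Proof.
exists (1 + \sum_(0 <= i < N) `|g i|).
  by rewrite ltr_pwDl// sumr_ge0.
move=> i iN; rewrite big_mkord (bigD1 (Ordinal iN))//=.
have := ler_norm (g i).
have : 0 <= \sum_(i0 < N | i0 != Ordinal iN) `|g i0| by rewrite sumr_ge0.
lra.
Qed.

Lemma asymp_all (R : realType) (u v : nat -> R) :
  (forall j, (0 < j)%N -> 0 < u j) -> (forall j, (0 < j)%N -> 0 < v j) ->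
  asymp \oo u v -> exists2 C : R, 0 < C & forall j, (0 < j)%N ->
    u j <= C * v j /\ v j <= C * u j.
Proof.
move=> u0 v0 [[C1 C10 [N1 _ H1]] [C2 C20 [N2 _ H2]]].
have [D1 D10 HD1] := finite_bound (fun i => u i / v i) N1.
have [D2 D20 HD2] := finite_bound (fun i => v i / u i) N2.
exists (C1 + C2 + D1 + D2); first by rewrite !addr_gt0.
move=> j j0; have uj := u0 j j0; have vj := v0 j j0.
split.
  have [jN|Nj] := ltnP j N1.
    have := HD1 j jN; rewrite ler_pdivrMr// => /le_trans; apply.
    by rewrite ler_wpM2r ?(ltW vj)//; lra.
  apply: le_trans (H1 j Nj) _; rewrite ler_wpM2r ?(ltW vj)//; lra.
have [jN|Nj] := ltnP j N2.
  have := HD2 j jN; rewrite ler_pdivrMr// => /le_trans; apply.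
  by rewrite ler_wpM2r ?(ltW uj)//; lra.
apply: le_trans (H2 j Nj) _; rewrite ler_wpM2r ?(ltW uj)//; lra.
Qed.

(** Finitely many positive terms are comparable with each other, at the price [D1 * D2]. When [i]
    lies below [N] and [j] does not, the ratio [j / i] is split at [N]; the factor [P] pays for the
    part that is at most [N]. *)
Lemma nat_growth (R : realType) (u : nat -> R) (b C : R) N : (0 < N)%N -> 0 < C ->
  (forall j, (0 < j)%N -> 0 < u j) ->
  (forall i j, (N <= i)%N -> (i <= j)%N -> u j <= C * (j%:R / i%:R) `^ b * u i) ->
  exists2 C' : R, 0 < C' & forall i j, (0 < i)%N -> (i <= j)%N ->
    u j <= C' * (j%:R / i%:R) `^ b * u i.
Proof.
move=> N0 C0 u0 Hu.
have [D1 D10 H1] := finite_bound u N.+1.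
have [D2 D20 H2] := finite_bound (fun i => (u i)^-1) N.+1.
have HD i j : (0 < i)%N -> (i <= N)%N -> (j <= N)%N -> u j <= D1 * D2 * u i.
  move=> i0 iN jN; apply: le_trans (H1 j jN) _.
  have := H2 i iN; have ui := u0 i i0.
  rewrite -[(u i)^-1]div1r ler_pdivrMr// => h.
  by rewrite -mulrA ler_peMr// ltW.
pose P := N%:R `^ `|b| : R.
have P0 : 0 < P by rewrite powR_gt0// ltr0n.
have DP : 0 < D1 * D2 * P by rewrite !mulr_gt0.
have D0 : 0 < D1 * D2 by rewrite mulr_gt0.
exists (C + C * (D1 * D2 * P) + D1 * D2 * P) => [|i j i0 ij].
  by rewrite !addr_gt0// mulr_gt0.
have CDP : 0 < C * (D1 * D2 * P) by rewrite mulr_gt0.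
have j0 : (0 < j)%N by lia.
have ui := u0 i i0.
have iR : 0 < i%:R :> R by rewrite ltr0n.
have jR : 0 < j%:R :> R by rewrite ltr0n.
have NR : 0 < N%:R :> R by rewrite ltr0n.
set q := (j%:R / i%:R) `^ b.
have q0 : 0 < q by rewrite powR_gt0// divr_gt0.
suff [K K0 KH] : exists2 K, 0 <= K <= C + C * (D1 * D2 * P) + D1 * D2 * P &
    u j <= K * q * u i.
  apply: (le_trans KH); rewrite ler_wpM2r ?(ltW ui)// ler_wpM2r ?(ltW q0)//.
  by case/andP: K0.
have [Ni|iN] := leqP N i.
  by exists C; [apply/andP; split; lra|exact: Hu].
have [Nj|jN] := leqP N j.
  exists (C * (D1 * D2 * P)); first by apply/andP; split; lra.
  apply: (le_trans (Hu N j (leqnn _) Nj)).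
  have h : (j%:R / N%:R) `^ b <= q * P.
    have -> : q = (j%:R / N%:R) `^ b * (N%:R / i%:R) `^ b.
      rewrite -powRM ?divr_ge0// /q; congr (_ `^ _).
      by field; rewrite !gt_eqF.
    rewrite -mulrA ler_peMr ?powR_ge0// mulrC.
    apply: powR_ge_min; rewrite ler_pdivlMr// ler_pdivrMr// mul1r ler_nat (ltnW iN)/=.
    by rewrite ler_peMr// ler1n.
  have hN := HD i N i0 (ltnW iN) (leqnn _).
  have p0 : 0 <= (j%:R / N%:R) `^ b :> R by exact: powR_ge0.
  have uN := ltW (u0 N N0).
  have := ler_pM (mulr_ge0 (ltW C0) p0) uN (ler_wpM2l (ltW C0) h) hN.
  by move=> /le_trans; apply; rewrite le_eqVlt; apply/orP; left; apply/eqP; ring.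
exists (D1 * D2 * P); first by apply/andP; split; lra.
apply: (le_trans (HD i j i0 (ltnW iN) (ltnW jN))).
rewrite ler_wpM2r ?(ltW ui)// -[leRHS]mulrA ler_peMr ?(ltW D0)//.
apply: powR_ge_min; rewrite ler_pdivlMr// ler_pdivrMr// mul1r ler_nat ij/=.
apply: (@le_trans _ _ N%:R); first by rewrite ler_nat ltnW.
by rewrite ler_peMr// ?ler1n// ltW.
Qed.

Lemma nat_growth_le (R : realType) (f : R -> R) (b : R) :
  (forall t, 1 <= t -> 0 < f t) -> growth_le f b ->
  exists2 C : R, 0 < C & forall i j, (0 < i)%N -> (i <= j)%N ->
    f j%:R <= C * (j%:R / i%:R) `^ b * f i%:R.
Proof.
move=> f0 [X [C [X1 C0 H]]].
apply: (@nat_growth _ (fun j => f j%:R) b C (Num.truncn X).+1) => //.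
  by move=> j j0; apply: f0; rewrite ler1n.
move=> i j Ni ij; apply: H; last by rewrite ler_nat.
by apply: le_trans (ltW (truncnS_gt X)) _; rewrite ler_nat.
Qed.

Lemma potter_decays (R : realType) (f : R -> R) (delta : R) :
  potter f (- delta) -> decays (fun j => f j%:R) delta.
Proof.
move=> [f0 Hf]; split => [j j0|e e0]; first by apply: f0; rewrite ler1n.
have [h1 h2] := Hf e e0.
have [C C0 HC] := nat_growth_le f0 h1.
have fi0 t : 1 <= t -> 0 < (f t)^-1 by move=> t1; rewrite invr_gt0 f0.
have [D D0 HD] := nat_growth_le fi0 h2.
exists (C + D); first by rewrite addr_gt0.
move=> i j i0 ij.
have fi := f0 i%:R ltac:(by rewrite ler1n).
have fj := f0 j%:R ltac:(by rewrite ler1n; lia).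
split; last first.
  apply: (le_trans (HC i j i0 ij)).
  by rewrite !ler_wpM2r ?powR_ge0 ?(ltW fi)//; lra.
have := HD i j i0 ij; rewrite opprK.
rewrite ler_pdivlMr// mulrC ler_pdivrMr// => /le_trans; apply.
by rewrite !ler_wpM2r ?powR_ge0 ?(ltW fj)//; lra.
Qed.

Lemma decays_asymp (R : realType) (u v : nat -> R) (delta : R) :
  decays u delta -> (forall j, (0 < j)%N -> 0 < v j) -> asymp \oo v u ->
  decays v delta.
Proof.
move=> [u0 Hu] v0 vu; split => // e e0.
have [C C0 HC] := asymp_all v0 u0 vu.
have [D D0 HD] := Hu e e0.
exists (C * D * C); first by rewrite !mulr_gt0.
move=> i j i0 ij; have j0 : (0 < j)%N by lia.
have [h1 h2] := HD i j i0 ij; have [vi ui] := HC i i0; have [vj uj] := HC j j0.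
split.
  apply: (le_trans vi); have := ler_wpM2l (ltW C0) h1 => /le_trans; apply.
  set p := _ `^ _; have p0 : 0 <= p by exact: powR_ge0.
  have -> : C * D * C * p * v j = C * (D * p * (C * v j)) by ring.
  by rewrite !ler_wpM2l// ?mulr_ge0// ltW.
apply: (le_trans vj); have := ler_wpM2l (ltW C0) h2 => /le_trans; apply.
set p := _ `^ _; have p0 : 0 <= p by exact: powR_ge0.
have -> : C * D * C * p * v i = C * (D * p * (C * v i)) by ring.
by rewrite !ler_wpM2l// ?mulr_ge0// ltW.
Qed.

(** * Power sums by telescoping *)

Lemma powRD_gt0 (R : realType) (x a b : R) : 0 < x ->
  x `^ (a + b) = x `^ a * x `^ b.
Proof. by move=> x0; rewrite powRD//; apply/implyP => _; rewrite gt_eqF. Qed.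

Lemma powR_le_affine (R : realType) (x b : R) : 0 <= x -> 0 < b -> b < 1 ->
  x `^ b <= 1 + b * (x - 1).
Proof.
move=> x0 b0 b1; have c0 : 0 < 1 - b by lra.
(* Young's inequality for the product of [x ^ b] and 1 with exponents [1 / b] and [1 / (1 - b)]
   expresses the concavity of the power. *)
have := @conjugate_powR R (x `^ b) 1 b^-1 (1 - b)^-1 (powR_ge0 _ _) ler01.
rewrite !invrK !invr_gt0 => /(_ b0 c0 ltac:(lra)).
rewrite -powRrM divff ?gt_eqF// powRr1// powR1; lra.
Qed.

(** Discrete comparison with the integral of x^(-th): by concavity, at the ratio [n / (n + 1)], each
    term is at most a difference of consecutive values of x^(1 - th) / (1 - th). *)
Lemma sum_powR_le (R : realType) (th : R) n : 0 <= th -> th < 1 ->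
  \sum_(0 <= j < n) (n%:R / j.+1%:R) `^ th <= n%:R / (1 - th).
Proof.
move=> th0 th1; have b0 : 0 < 1 - th by lra.
have [->|th_neq0] := eqVneq th 0.
  rewrite (eq_bigr (fun=> 1)) => [|j _]; last by rewrite powRr0.
  by rewrite sumr_const_nat subn0 subr0 divr1.
have {th_neq0}thp : 0 < th by rewrite lt_neqAle eq_sym th_neq0.
suff H : \sum_(0 <= j < n) (j.+1%:R : R) `^ (- th) <= n%:R `^ (1 - th) / (1 - th).
  case: n H => [|n] H; first by rewrite big_geq// mul0r.
  have n0 : 0 < n.+1%:R :> R by rewrite ltr0n.
  have -> : \sum_(0 <= j < n.+1) (n.+1%:R / j.+1%:R) `^ th =
      n.+1%:R `^ th * \sum_(0 <= j < n.+1) (j.+1%:R : R) `^ (- th).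
    rewrite mulr_sumr; apply: eq_bigr => j _.
    by rewrite powRM ?invr_ge0// powRN -powR_inv1// -powRrM mulN1r powRN.
  have := ler_wpM2l (powR_ge0 n.+1%:R th) H => /le_trans; apply.
  by rewrite mulrA -powRD_gt0// addrC subrK powRr1// ltW.
elim: n => [|n IH]; first by rewrite big_geq// divr_ge0 ?powR_ge0// ltW.
rewrite big_nat_recr//=; apply: le_trans (lerD IH (lexx _)) _.
suff: (n.+1%:R : R) `^ (- th) <=
    (n.+1%:R `^ (1 - th) - n%:R `^ (1 - th)) / (1 - th).
  by rewrite mulrBl; lra.
rewrite ler_pdivlMr//.
have n0 : 0 < n.+1%:R :> R by rewrite ltr0n.
have x0 : 0 <= n%:R / n.+1%:R :> R by rewrite divr_ge0.
have := powR_le_affine x0 b0 ltac:(lra).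
have nE : n%:R = n%:R / n.+1%:R * n.+1%:R :> R by rewrite divfK// gt_eqF.
have xE : n%:R / n.+1%:R - 1 = - n.+1%:R^-1 :> R.
  have -> : n%:R = n.+1%:R - 1 :> R by rewrite -natr1 addrK.
  by field; rewrite gt_eqF.
rewrite xE => h.
have -> : n%:R `^ (1 - th) = (n%:R / n.+1%:R) `^ (1 - th) * n.+1%:R `^ (1 - th) :> R.
  by rewrite -powRM// ?(ltW n0)// -nE.
have p0 : 0 < n.+1%:R `^ (1 - th) :> R by rewrite powR_gt0.
have -> : n.+1%:R `^ (- th) = n.+1%:R `^ (1 - th) * n.+1%:R^-1 :> R.
  by rewrite -powR_inv1 ?(ltW n0)// -powRD_gt0//; congr (_ `^ _); ring.
move: p0 h; set P := _.+1%:R `^ _; set X := (_ / _) `^ _; set v := _.+1%:R^-1.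
by move=> p0 h; have := ler_wpM2l (ltW p0) h; lra.
Qed.

Lemma powRN_ge_affine (R : realType) (x q : R) : 0 < x -> 0 <= q ->
  1 - q * (x - 1) <= x `^ (- q).
Proof.
move=> x0 q0; rewrite /powR gt_eqF//.
apply: le_trans (expR_ge1Dx _); rewrite lerD2l mulNr lerN2 ler_wpM2l//.
have := @le_ln1Dx R (x - 1) ltac:(lra).
by rewrite addrC subrK.
Qed.

(** The induction carries the remainder term subtracted in [H], the discrete analogue of the
    integral from [m] to infinity. *)
Lemma sum_powRN_le (R : realType) (p : R) n m : 1 < p -> (0 < n)%N -> (n <= m)%N ->
  \sum_(n <= j < m) (j.+1%:R / n%:R) `^ (- p) <= n%:R / (p - 1) :> R.
Proof.
move=> p1 n0 nm; have q0 : 0 < p - 1 by lra.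
have nR : 0 < n%:R :> R by rewrite ltr0n.
suff H : \sum_(n <= j < m) (j.+1%:R / n%:R) `^ (- p) <=
    n%:R / (p - 1) - (m%:R / n%:R) `^ (- (p - 1)) * (n%:R / (p - 1)) :> R.
  apply: (le_trans H); rewrite gerBl mulr_ge0 ?powR_ge0// divr_ge0//; lra.
elim: m nm => [|m IH]; first by rewrite leqn0 => /eqP n00; rewrite n00 in n0.
rewrite leq_eqVlt ltnS => /predU1P[<-|nm].
  by rewrite big_geq// divff ?gt_eqF// powR1 mul1r subrr.
rewrite big_nat_recr//=; apply: le_trans (lerD (IH nm) (lexx _)) _.
have m0 : 0 < m%:R :> R by rewrite ltr0n; lia.
have m10 : 0 < m.+1%:R :> R by rewrite ltr0n.
have x0 : 0 < m%:R / m.+1%:R :> R by rewrite divr_gt0.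
have := powRN_ge_affine x0 (ltW q0).
have xE : m%:R / m.+1%:R - 1 = - m.+1%:R^-1 :> R.
  have -> : m%:R = m.+1%:R - 1 :> R by rewrite -natr1 addrK.
  by field; rewrite gt_eqF.
have -> : m%:R / n%:R = m%:R / m.+1%:R * (m.+1%:R / n%:R) :> R.
  by field; rewrite !gt_eqF.
rewrite xE => h.
have -> : (m%:R / m.+1%:R * (m.+1%:R / n%:R)) `^ (- (p - 1)) =
    (m%:R / m.+1%:R) `^ (- (p - 1)) * (m.+1%:R / n%:R) `^ (- (p - 1)) :> R.
  by rewrite -powRM// divr_ge0.
have -> : (m.+1%:R / n%:R) `^ (- p) =
   (m.+1%:R / n%:R) `^ (- (p - 1)) * (m.+1%:R / n%:R)^-1 :> R.
  have x1 : 0 < m.+1%:R / n%:R :> R by rewrite divr_gt0.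
  rewrite -[(_ / _)^-1]powR_inv1 ?(ltW x1)// -powRD_gt0//.
  by congr (_ `^ _); ring.
move: h; set a := _ `^ _; set b := (m.+1%:R / n%:R) `^ _ => h.
have b0 : 0 <= b by exact: powR_ge0.
have k0 : 0 <= b * (n%:R / (p - 1)) by rewrite mulr_ge0// divr_ge0// ltW.
have := ler_wpM2r k0 h.
have -> : (1 - (p - 1) * - m.+1%:R^-1) * (b * (n%:R / (p - 1))) =
   b * (n%:R / (p - 1)) + b * (m.+1%:R / n%:R)^-1.
  by field; rewrite !gt_eqF.
set K := n%:R / (p - 1); set v := (_ / _)^-1; lra.
Qed.

(** * Bounds for the monodromy matrix *)

Lemma ratio_itv (R : realType) i j k : (0 < i)%N -> (i <= j)%N -> (j <= k * i)%N ->
  1 <= (j%:R / i%:R : R) <= k%:R.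
Proof.
move=> i0 ij jk; have iR : 0 < i%:R :> R by rewrite ltr0n.
by rewrite ler_pdivlMr// ler_pdivrMr// mul1r -natrM !ler_nat ij.
Qed.

Lemma ratio_ge1 (R : realType) i j : (0 < i)%N -> (i <= j)%N -> 1 <= (j%:R / i%:R : R).
Proof.
move=> i0 ij; have iR : 0 < i%:R :> R by rewrite ltr0n.
by rewrite ler_pdivlMr// mul1r ler_nat.
Qed.

Lemma powR_le1 (R : realType) (x b : R) : 1 <= x -> b <= 0 -> x `^ b <= 1.
Proof. by move=> x1 b0; rewrite -[leRHS](powRr0 x) ler_powR. Qed.

Lemma decays_local (R : realType) (u : nat -> R) (delta : R) k : decays u delta ->
  exists2 D : R, 0 < D & forall i j, (0 < i)%N -> (i <= j)%N -> (j <= k * i)%N ->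
    u i <= D * u j /\ u j <= D * u i.
Proof.
move=> [u0 Hu]; have [C C0 HC] := Hu 1 ltr01.
pose P : R := k%:R `^ `|delta + 1|; pose Q : R := k%:R `^ `|- delta + 1|.
have P0 : 0 <= P by exact: powR_ge0.
have Q0 : 0 <= Q by exact: powR_ge0.
exists (C * (1 + P + Q)); first by rewrite mulr_gt0//; lra.
move=> i j i0 ij jk; have j0 : (0 < j)%N by lia.
have [h1 h2] := HC i j i0 ij; have x := @ratio_itv R i j k i0 ij jk.
have ui := ltW (u0 i i0); have uj := ltW (u0 j j0).
have h3 : (j%:R / i%:R) `^ (delta + 1) <= P by exact: powR_le_max.
have h4 : (j%:R / i%:R) `^ (- delta + 1) <= Q by exact: powR_le_max.
split; [apply: (le_trans h1)|apply: (le_trans h2)];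
  by rewrite ler_wpM2r// ler_pM2l//; lra.
Qed.

Lemma decays_ge (R : realType) (u : nat -> R) (delta e : R) : decays u delta -> 0 < e ->
  exists2 c : R, 0 < c & forall n, (0 < n)%N -> c <= n%:R `^ (delta + e) * u n.
Proof.
move=> [u0 Hu] e0; have [C C0 HC] := Hu e e0.
exists (u 1%N / C) => [|n n0]; first by rewrite divr_gt0// u0.
have [h _] := HC 1%N n isT n0.
by rewrite divr1 in h; rewrite ler_pdivrMr// mulrC mulrA.
Qed.

Lemma decays_le_pow (R : realType) (u : nat -> R) (delta e : R) : decays u delta -> 0 < e ->
  exists2 C : R, 0 < C & forall n, (0 < n)%N -> u n <= C * n%:R `^ (- delta + e).
Proof.
move=> [u0 Hu] e0; have [C C0 HC] := Hu e e0.
exists (C * u 1%N) => [|n n0]; first by rewrite mulr_gt0// u0.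
have [_ h] := HC 1%N n isT n0.
by rewrite divr1 in h; rewrite mulrAC.
Qed.

Lemma pow_unbounded (R : realType) (e B : R) : 0 < e ->
  exists N, forall n, (N <= n)%N -> B <= n%:R `^ e.
Proof.
move=> e0; exists (Num.truncn ((`|B| + 1) `^ e^-1)).+1 => n Nn.
have b0 : 0 <= `|B| + 1 by rewrite addr_ge0.
have h : (`|B| + 1) `^ e^-1 <= n%:R.
  by apply: le_trans (ltW (truncnS_gt _)) _; rewrite ler_nat.
apply: (@le_trans _ _ (`|B| + 1)); first by have := ler_norm B; lra.
have -> : `|B| + 1 = ((`|B| + 1) `^ e^-1) `^ e.
  by rewrite -powRrM mulVf ?powRr1// gt_eqF.
by apply: ge0_ler_powR; rewrite ?nnegrE ?powR_ge0// ltW.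
Qed.

Lemma ln_le_powR (R : realType) (x t : R) : 1 <= x -> 0 < t -> ln x <= t^-1 * x `^ t.
Proof.
move=> x1 t0; rewrite ler_pdivlMl// -ln_powR.
have p0 : 0 < x `^ t by rewrite powR_gt0; lra.
have := @le_ln1Dx R (x `^ t - 1) ltac:(lra).
by rewrite addrC subrK; lra.
Qed.

Section tails.
Variables (R : realType) (l phi : nat -> R) (dl : R).
Hypothesis hH : limit_circle_hamburger l phi.
Hypothesis Hl : decays l dl.

Let l0 j : (0 < j)%N -> 0 < l j.
Proof. by case: Hl => + _; apply. Qed.

Definition tail n := hlen l - hnode l n.

Lemma sum_hnode n m : (n <= m)%N -> \sum_(n <= j < m) l j.+1 = hnode l m - hnode l n.
Proof.
elim: m => [|m IH]; first by rewrite leqn0 => /eqP->; rewrite big_geq// subrr.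
rewrite leq_eqVlt ltnS => /predU1P[<-|nm]; first by rewrite big_geq// subrr.
by rewrite big_nat_recr//= IH// hnodeS; ring.
Qed.

Lemma sum_le_tail n m : (n <= m)%N -> \sum_(n <= j < m) l j.+1 <= tail n.
Proof.
by move=> nm; rewrite sum_hnode// lerD2r; exact: hnode_le_hlen hH m.
Qed.

Lemma hnode_cvg (e : R) : 0 < e -> exists N, forall n, (N <= n)%N -> hlen l - e < hnode l n.
Proof.
move=> e0; have cv : hnode l @ \oo --> hlen l by case: hH.
have /cvgrPdist_lt/(_ e e0)[N _ HN] := cv.
exists N => n Nn; have := HN n Nn; rewrite /= ltr_norml; lra.
Qed.

Lemma tail_le_sum n B : (forall m, (n <= m)%N -> \sum_(n <= j < m) l j.+1 <= B) ->
  tail n <= B.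
Proof.
move=> H; apply/ler_addgt0Pl => e e0; have [N HN] := hnode_cvg e0.
have := HN (maxn N n) (leq_maxl _ _); have := H (maxn N n) (leq_maxr _ _).
by rewrite sum_hnode ?leq_maxr// /tail; lra.
Qed.

Lemma tail_gt0 n : 0 < tail n.
Proof.
have := sum_le_tail (leqnSn n); rewrite big_nat1; apply: lt_le_trans.
exact: l0.
Qed.

(** The block of indices from [n + 1] to [2 n] suffices: its [n] terms are all comparable with
    [l n]. *)
Lemma tail_ge : exists2 c : R, 0 < c & forall n, (0 < n)%N -> c * (n%:R * l n) <= tail n.
Proof.
have [D D0 HD] := decays_local 2 Hl.
exists D^-1 => [|n n0]; first by rewrite invr_gt0.
have nn : (n <= n + n)%N by lia.
apply: le_trans (sum_le_tail nn).
have -> : D^-1 * (n%:R * l n) = \sum_(n <= j < n + n) D^-1 * l n.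
  by rewrite sumr_const_nat addnK -[RHS]mulr_natl; ring.
apply: ler_sum_nat => j /andP[nj jn]; rewrite ler_pdivrMl//.
by have [] := HD n j.+1 n0 ltac:(lia) ltac:(lia).
Qed.

(** The slack [(dl - 1) / 2] leaves the summable exponent [p > 1]. At [dl = 1] the tail can exceed
    [n l_n] by an unbounded factor, whence the assumption on the lengths in (ii). *)
Lemma tail_le : 1 < dl -> exists2 C : R, 0 < C &
  forall n, (0 < n)%N -> tail n <= C * (n%:R * l n).
Proof.
move=> dl1; have e0 : 0 < (dl - 1) / 2 by lra.
case: Hl => _ Hl'; have [C C0 HC] := Hl' _ e0.
pose p := (dl + 1) / 2; have p1 : 1 < p by rewrite /p; lra.
exists (C / (p - 1)) => [|n n0]; first by rewrite divr_gt0//; lra.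
apply: tail_le_sum => m nm; have ln := ltW (l0 n0).
apply: (@le_trans _ _ (C * l n * \sum_(n <= j < m) (j.+1%:R / n%:R) `^ (- p))).
  rewrite mulr_sumr; apply: ler_sum_nat => j /andP[nj jm].
  have [_ h] := HC n j.+1 n0 ltac:(lia).
  apply: (le_trans h); rewrite (_ : - dl + _ = - p); last by rewrite /p; lra.
  by rewrite mulrAC.
have := ler_wpM2l (mulr_ge0 (ltW C0) ln) (@sum_powRN_le R p n m p1 n0 nm).
by move=> /le_trans; apply; rewrite le_eqVlt; apply/orP; left; apply/eqP; ring.
Qed.

(** For [dl < 1] the product [n l_n] would grow like a power of [n], whereas [tail_ge] bounds it by
    a multiple of the finite total length. *)
Lemma decay_ge1 : 1 <= dl.
Proof.
rewrite leNgt; apply/negP => dl1; have e0 : 0 < (1 - dl) / 2 by lra.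
have [c c0 Hc] := tail_ge; have [d d0 Hd] := decays_ge Hl e0.
have [N HN] := @pow_unbounded R _ ((hlen l + 1) / (c * d)) e0.
have N1 : (0 < N.+1)%N by [].
have := HN N.+1 (leqnSn N); have := Hc N.+1 N1; have := Hd N.+1 N1.
have NR : 0 < N.+1%:R :> R by rewrite ltr0n.
have NE : N.+1%:R = N.+1%:R `^ (dl + (1 - dl) / 2) * N.+1%:R `^ ((1 - dl) / 2) :> R.
  by rewrite -powRD_gt0// -[LHS]powRr1 ?ltW//; congr (_ `^ _); lra.
rewrite {2}NE; set p := N.+1%:R `^ (dl + _); set q := N.+1%:R `^ _.
have q0 : 0 <= q by exact: powR_ge0.
rewrite ler_pdivrMr ?mulr_gt0// => h1 h2 h3.
have h4 : tail N.+1 <= hlen l by rewrite gerBl (hnode_ge0 hH).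
have h5 := ler_wpM2l (mulr_ge0 (ltW c0) q0) h1.
by lra.
Qed.
End tails.

Section core.
Variables (R : realType) (l phi : nat -> R) (dl dp : R) (W : R -> R[i] -> 'M[R[i]]_2).
Hypothesis hH : limit_circle_hamburger l phi.
Hypothesis hW : forall z : R[i],
  is_fundamental_solution (hamburger l phi) (hlen l) z (fun t => W t z).
Let s j : R := `|sin (phi j.+1 - phi j)|.
Hypothesis Hl : decays l dl.
Hypothesis Hs : decays s dp.

Let l0 j : (0 < j)%N -> 0 < l j.
Proof. by case: Hl => + _; apply. Qed.
Let lpos j : 0 < l j.+1.
Proof. exact: l0. Qed.
Let s0 j : (0 < j)%N -> 0 < s j.
Proof. by case: Hs => + _; apply. Qed.
Let u1 z i n := W (hnode l n) z i 0.
Let u2 z i n := W (hnode l n) z i 1.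
Let Hu z i : transfer_rec l phi z (u1 z i) (u2 z i).
Proof. exact: monodromy_rec hH (hW z) i. Qed.

Lemma opnorm_ge z i B N : 0 <= B ->
  (forall n, (N <= n)%N -> (2 * B) ^+ 2 <= sqnorm (u1 z i n) (u2 z i n)) ->
  B <= opnorm (W (hlen l) z).
Proof.
move=> B0 HB.
have h : 2 * B <= normc (W (hlen l) z i 0) + normc (W (hlen l) z i 1).
  apply: (monodromy_ge hH (hW z) (N := N)) => n Nn.
  have := le_trans (HB n Nn) (sqnorm_le _ _).
  by rewrite ler_pXn2r ?nnegrE ?addr_ge0 ?mulr_ge0 ?normc_ge0.
have := entry_le_opnorm (W (hlen l) z) i 0.
have := entry_le_opnorm (W (hlen l) z) i 1; lra.
Qed.

Lemma opnorm_le_rows z B N :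
  (forall i n, (N <= n)%N -> normc (u1 z i n) + normc (u2 z i n) <= B) ->
  opnorm (W (hlen l) z) <= 4 * B.
Proof.
move=> HB; apply: opnorm_le => i j; apply: (monodromy_le hH (hW z) (N := N)) => n Nn.
have := HB i n Nn; have := normc_ge0 (u1 z i n); have := normc_ge0 (u2 z i n).
rewrite /u1 /u2; case: j => [] [|[|//]] jlt.
  by rewrite (_ : Ordinal jlt = 0); [lra|exact/val_inj].
by rewrite (_ : Ordinal jlt = 1); [lra|exact/val_inj].
Qed.

Lemma row_init z (i : 'I_2) :
  [/\ normc (u1 z i 0%N) + normc (u2 z i 0%N) = 1, wedge (u1 z i 0%N) (u2 z i 0%N) = 0 &
      sqnorm (u1 z i 0%N) (u2 z i 0%N) = 1].
Proof.
have n0 : normc (0 : R[i]) = 0 by exact: normc0.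
have n1 : normc (1 : R[i]) = 1 by exact: normc1.
have [[-> ->]|[-> ->]] : (u1 z i 0%N = 1 /\ u2 z i 0%N = 0) \/
    (u1 z i 0%N = 0 /\ u2 z i 0%N = 1).
  rewrite /u1 /u2 !(monodromy_init (hW z)).
  by case: i => [] [|[|//]] ilt; [left|right].
- split; rewrite ?n0 ?n1 ?addr0// /wedge /sqnorm /= ?mulr0 ?mul0r ?subr0//.
  by rewrite expr0n expr1n !addr0.
- split; rewrite ?n0 ?n1 ?add0r// /wedge /sqnorm /= ?mulr0 ?mul0r ?subr0//.
  by rewrite expr0n expr1n !addr0 add0r.
Qed.

Lemma opnorm_ge_k (C1 : R) : 0 < C1 -> 0 < dl + dp -> exists c Y : R,
  [/\ 0 < c, 0 < Y & forall y n, Y <= y -> (0 < n)%N -> 1 <= C1 * (y * (l n * s n)) ->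
    expR (c * n%:R) <= opnorm (W (hlen l) (Complex 0 y))].
Proof.
(* Spending half of [dl + dp] on each sequence makes the exponents for the product [l s] cancel. So
   [l_n s_n] is at most a constant times [l_j s_j] for all [j <= n], and the condition at [n]
   spreads to all earlier indices. *)
move=> C10 d0; have e0 : 0 < (dl + dp) / 2 by lra.
case: Hl => _ Hl'; case: Hs => _ Hs'.
have [Cl Cl0 HCl] := Hl' _ e0.
have [Cs Cs0 HCs] := Hs' _ e0.
have [D D0 HD] := decays_local 2 Hl.
pose K := C1 * (Cl * Cs); have K0 : 0 < K by rewrite !mulr_gt0.
pose kap := (D * K ^+ 2)^-1.
have kap0 : 0 < kap by rewrite invr_gt0 mulr_gt0// exprn_gt0.
have ln0 : 0 < ln (1 + kap) by rewrite ln_gt0//; lra.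
(* The threshold makes the first increment of the wedge at least 2 once [P 0 >= 1 / 2]. The rate is
   halved because [sqnorm] is quadratic in the norm. *)
exists (ln (1 + kap) / 2), (4 / l 1%N); split; [by lra|by rewrite divr_gt0// lpos|].
move=> y n Yy n0 Hn.
have y0 : 0 < y by apply: lt_le_trans Yy; rewrite divr_gt0// lpos.
have y4 : 4 <= y * l 1%N by rewrite -ler_pdivrMr// lpos.
(* The rows start at the two unit vectors, whose squared components along the first angle are the
   squares of its cosine and sine; one of these is at least 1/2. *)
have [i Pi] : exists i, 1 / 2 <=
    sqcoord (phi 1%N) (u1 (Complex 0 y) i 0%N) (u2 (Complex 0 y) i 0%N).
  have h := cos2Dsin2 (phi 1%N).
  have [hc|hc] := leP (1 / 2) (cos (phi 1%N) ^+ 2).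
    exists 0; rewrite /u1 /u2 !(monodromy_init (hW _)) /sqcoord /=.
    by rewrite !(mulr0, mulr1, addr0, expr0n)/= ?addr0.
  exists 1; rewrite /u1 /u2 !(monodromy_init (hW _)) /sqcoord /=.
  by rewrite !(mulr0, mulr1, add0r, addr0, expr0n)/= ?addr0; lra.
have [_ S0 _] := row_init (Complex 0 y) i.
apply: (@opnorm_ge _ i _ n.+1) => [|m nm]; first exact: expR_ge0.
have P0 : 0 < sqcoord (phi 1%N) (u1 (Complex 0 y) i 0%N) (u2 (Complex 0 y) i 0%N) by lra.
have hS := wedge_exp_growth lpos y0 (Hu _ i) S0 (N := n) kap0 P0.
have {}hS : y * l 1%N * sqcoord (phi 1%N) (u1 (Complex 0 y) i 0%N) (u2 (Complex 0 y) i 0%N) *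
    (1 + kap) ^+ n <= wedge (u1 (Complex 0 y) i n.+1) (u2 (Complex 0 y) i n.+1).
  apply: hS => j /andP[j0 jn].
  have [_ hln] := HCl j n j0 jn; have [_ hsn] := HCs j n j0 jn.
  have [hd _] := HD j j.+1 j0 (leqnSn j) ltac:(by rewrite mul2n -addnn -addn1 leq_add2l).
  have lj := l0 j0; have sj := s0 j0.
  have lsn : l n * s n <= Cl * Cs * (l j * s j).
    have ln' := ltW (l0 n0); have sn' := ltW (s0 n0).
    apply: le_trans (ler_pM ln' sn' hln hsn) _.
    set p := _ `^ (- dl + _); set q := _ `^ (- dp + _).
    have pq : p * q <= 1.
      rewrite /p /q -powRD_gt0; last by apply: lt_le_trans (@ratio_ge1 R j n j0 jn).
      by apply: powR_le1; [exact: ratio_ge1|lra].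
    have -> : Cl * p * l j * (Cs * q * s j) = Cl * Cs * (l j * s j) * (p * q) by ring.
    by rewrite ler_piMr// !mulr_ge0// ltW.
  have hK : 1 <= K * (y * (l j * s j)).
    apply: (le_trans Hn); rewrite /K -!mulrA ler_pM2l//.
    have := ler_wpM2l (ltW y0) lsn; lra.
  have sE : sin (phi j.+1 - phi j) ^+ 2 = s j ^+ 2 by rewrite /s real_normK// num_real.
  rewrite sE.
  have hK2 : 1 <= (K * (y * (l j * s j))) ^+ 2.
    by rewrite expr_ge1//; lra.
  rewrite /kap -[leLHS]mul1r ler_pdivrMr ?mulr_gt0 ?exprn_gt0//.
  apply: (le_trans hK2).
  have -> : (K * (y * (l j * s j))) ^+ 2 = K ^+ 2 * y ^+ 2 * s j ^+ 2 * l j * l j by ring.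
  have -> : y ^+ 2 * l j * l j.+1 * s j ^+ 2 * (D * K ^+ 2) =
    K ^+ 2 * y ^+ 2 * s j ^+ 2 * l j * (D * l j.+1) by ring.
  by rewrite ler_wpM2l// !mulr_ge0 ?sqr_ge0// ltW.
have hm := wedge_homo lpos y0 (Hu _ i) nm.
apply: le_trans (wedge_le_sqnorm _ _).
have -> : (2 * expR (ln (1 + kap) / 2 * n%:R)) ^+ 2 = 4 * (1 + kap) ^+ n.
  have -> : (1 + kap) ^+ n = expR (n%:R * ln (1 + kap)).
    by rewrite expRM_natl lnK// posrE; lra.
  rewrite exprMn [_ ^+ 2 in X in _ * X]expr2 -expRD (_ : 2 ^+ 2 = 4 :> R); last by ring.
  by congr (_ * expR _); lra.
have h1 : 0 <= (1 + kap) ^+ n by rewrite exprn_ge0//; lra.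
have h2 : 2 <= y * l 1%N * sqcoord (phi 1%N) (u1 (Complex 0 y) i 0%N) (u2 (Complex 0 y) i 0%N).
  by have := ler_pM _ _ y4 Pi; lra.
have := ler_wpM2r h1 h2; lra.
Qed.

Lemma opnorm_le_m (C1 : R) : 0 < C1 -> 1 < dl + dp -> dl + dp < 2 ->
  exists2 C : R, 0 < C & forall z n, (0 < n)%N ->
    normc z * l n <= C1 * s n -> s n <= C1 * (normc z * l n) ->
    opnorm (W (hlen l) z) <= expR (C * (normc z * tail l n)).
Proof.
move=> C10 d1 d2; have dl1 := decay_ge1 hH Hl.
pose gam := (dl - dp) / 2; have gam0 : 0 < gam by rewrite /gam; lra.
(* The choice of [gam] gives both error terms the size [r l_n] times [n / j] to the power
   [(dl + dp) / 2]. The Potter slack [e] takes half of the room which [dl + dp < 2] leaves below the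
   exponent 1. *)
pose e := (2 - dl - dp) / 4; have e0 : 0 < e by rewrite /e; lra.
pose th := (dl + dp) / 2 + e.
have th0 : 0 <= th by rewrite /th /e; lra.
have th1 : th < 1 by rewrite /th /e; lra.
case: (Hl) => _ Hl'; case: (Hs) => _ Hs'.
have [Cl Cl0 HCl] := Hl' _ e0; have [Cs Cs0 HCs] := Hs' _ e0.
have [c c0 Hc] := tail_ge hH Hl.
(* The initial weight is a power of [n] and must disappear in the exponential. With this [t],
   [n s_n] is at least a multiple of [n ^ t], which dominates [ln n]; and [n s_n] is bounded by a
   multiple of [r * tail l n]. *)
pose t := (1 - dp) / 2; have t0 : 0 < t by rewrite /t; lra.
have [c' c'0 Hc'] := decays_ge Hs t0.
pose K := Cl + 2 * Cs * C1; have K0 : 0 < K by rewrite addr_gt0 ?mulr_gt0.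
pose c2 := c * (c' / C1); have c20 : 0 < c2 by rewrite mulr_gt0// divr_gt0.
pose C' := (ln 16 + gam / t) / c2.
have ln16 : 0 < ln (16 : R) by rewrite ln_gt0; lra.
have C'0 : 0 < C' by rewrite divr_gt0// addr_gt0// divr_gt0.
pose C'' := K / (1 - th) / c.
have C''0 : 0 < C'' by rewrite !divr_gt0//; lra.
exists (C' + C'' + 2); first by lra.
move=> z n n0 h1 h2; set r := normc z in h1 h2 *.
have r0 : 0 <= r by exact: normc_ge0.
have nR : 1 <= n%:R :> R by rewrite ler1n.
have nR0 : 0 < n%:R :> R by rewrite ltr0n.
have htail : r * (n%:R * l n) <= c^-1 * (r * tail l n).
  by rewrite ler_pdivlMl// mulrCA ler_wpM2l// Hc.
(* The maximum with 1 ensures [A j >= 1] and monotonicity for all [j]; for [j < n], the range of the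
   sum, it is the plain power. *)
pose A j : R := Num.max 1 ((n%:R / j.+1%:R) `^ gam).
have A1 j : 1 <= A j by rewrite /A le_max lexx.
have AS j : A j.+1 <= A j.
  rewrite /A ge_max le_max lexx/= le_max; apply/orP; right.
  apply: ge0_ler_powR; rewrite ?nnegrE; [exact: ltW|exact: divr_ge0|exact: divr_ge0|].
  by rewrite ler_wpM2l// lef_pV2 ?posrE ?ltr0n// ler_nat.
have AE j : (j < n)%N -> A j = (n%:R / j.+1%:R) `^ gam.
  move=> jn; rewrite /A max_r// -[leLHS](powRr0 (n%:R / j.+1%:R)).
  by rewrite ler_powR ?(ltW gam0)//; exact: ratio_ge1.
have hsum : \sum_(0 <= j < n) (r * l j.+1 / A j + 2 * (s j.+1 * A j)) <=
    C'' * (r * tail l n).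
  apply: (@le_trans _ _ (K * (r * l n) * \sum_(0 <= j < n) (n%:R / j.+1%:R) `^ th)).
    rewrite mulr_sumr; apply: ler_sum_nat => j /andP[_ jn]; rewrite AE//.
    have [hl _] := HCl j.+1 n isT jn; have [hs _] := HCs j.+1 n isT jn.
    set x := n%:R / j.+1%:R in hl hs *.
    have x1 : 1 <= x by exact: ratio_ge1.
    have x0 : 0 < x by lra.
    have g0 : 0 < x `^ gam by rewrite powR_gt0.
    have k1 : r * l j.+1 / x `^ gam <= Cl * (r * l n) * x `^ th.
      rewrite ler_pdivrMr// -[leRHS]mulrA -powRD_gt0//.
      rewrite (_ : th + gam = dl + e); last by rewrite /th /gam; lra.
      by have := ler_wpM2l r0 hl; lra.
    have k2 : s j.+1 * x `^ gam <= Cs * C1 * (r * l n) * x `^ th.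
      apply: le_trans (ler_wpM2r (ltW g0) hs) _.
      have -> : Cs * x `^ (dp + e) * s n * x `^ gam = Cs * x `^ th * s n.
        have -> : x `^ th = x `^ (dp + e) * x `^ gam.
          by rewrite -powRD_gt0//; congr (_ `^ _); rewrite /th /gam; lra.
        by ring.
      have -> : Cs * C1 * (r * l n) * x `^ th = Cs * x `^ th * (C1 * (r * l n)) by ring.
      by rewrite ler_wpM2l// mulr_ge0 ?powR_ge0// ltW.
    by rewrite /K; lra.
  have rl0 : 0 <= K * (r * l n) by rewrite !mulr_ge0 ?(ltW K0)// ltW// l0.
  apply: le_trans (ler_wpM2l rl0 (sum_powR_le n th0 th1)) _.
  have -> : K * (r * l n) * (n%:R / (1 - th)) = K / (1 - th) * (r * (n%:R * l n)) by ring.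
  rewrite /C'' -[leRHS]mulrA ler_wpM2l// divr_ge0//; lra.
have hpre : 16 * n%:R `^ gam <= expR (C' * (r * tail l n)).
  have n16 : 0 < 16 * n%:R `^ gam :> R by rewrite mulr_gt0// powR_gt0.
  rewrite -[leLHS]lnK ?posrE// ler_expR lnM ?posrE ?powR_gt0// ln_powR.
  have hln := ln_le_powR nR t0.
  have nt1 : 1 <= n%:R `^ t :> R by rewrite -[leLHS](powRr0 (n%:R : R)) ler_powR// ltW.
  have k1 : ln 16 + gam * ln n%:R <= (ln 16 + gam / t) * n%:R `^ t :> R.
    have := ler_wpM2l (ltW gam0) hln; have := ler_wpM2l (ltW ln16) nt1; lra.
  apply: (le_trans k1); rewrite /C' -mulrA ler_wpM2l//.
    by apply: addr_ge0; [exact: ltW|apply: divr_ge0; exact: ltW].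
  rewrite ler_pdivlMl// /c2.
  have hc := Hc' n n0; have hc2 := Hc n n0.
  have k2 : c' * n%:R `^ t <= n%:R * s n.
    have := ler_wpM2r (powR_ge0 (n%:R : R) t) hc => /le_trans; apply.
    rewrite mulrAC -powRD_gt0// (_ : dp + t + t = 1) ?powRr1// ?(ltW nR0)//.
    by rewrite /t; lra.
  have k3 : n%:R * s n <= C1 * (n%:R * (r * l n)).
    by have := ler_wpM2l (ltW nR0) h2; lra.
  have k4 : r * (c * (n%:R * l n)) <= r * tail l n by rewrite ler_wpM2l.
  have k5 : c' / C1 * n%:R `^ t <= n%:R * (r * l n).
    by rewrite mulrAC ler_pdivrMr//; lra.
  by have := ler_wpM2l (ltW c0) k5; lra.
apply: le_trans (_ : 4 * (4 * A 0%N * expR (C'' * (r * tail l n) + 2 * (r * tail l n))) <= _).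
  apply: (@opnorm_le_rows _ _ n) => i m nm.
  have := upper_bound_moving lpos (Hu z i) nm A1 AS.
  have [-> _ _] := row_init z i.
  rewrite mulr1 => /le_trans; apply.
  have A00 : 0 <= 4 * A 0%N by have := A1 0%N; lra.
  rewrite -/r ler_wpM2l// ler_expR.
  apply: lerD; first exact: hsum.
  have := ler_wpM2l r0 (sum_le_tail hH nm); lra.
rewrite AE// divr1.
have -> : expR ((C' + C'' + 2) * (r * tail l n)) = expR (C' * (r * tail l n)) *
    expR (C'' * (r * tail l n) + 2 * (r * tail l n)).
  by rewrite -expRD; congr expR; ring.
set X := expR (_ + _); have X0 : 0 <= X by exact: expR_ge0.
have := ler_wpM2r X0 hpre; lra.
Qed.

(** For [j <= n] the step factor in the frame of [psi] is bounded by 1 plus a constant times a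
    possibly large power of [n / j]. Summing such powers would give too much, but only the logarithm
    of the factor counts, and it is at most a multiple of the square root of [n / j], which sums to
    O(n). For later [j] the almost monotonicity of [s] leaves [r s_n l_j], and [tail_le] sums this
    to O(n). *)
Lemma opnorm_le_k (C1 C2 C3 psi : R) : 0 < C1 -> 0 < C2 -> 0 < C3 -> 1 < dl ->
  (forall j, (0 < j)%N -> `|sin (phi j - psi)| <= C2 * s j) ->
  (forall i j, (0 < i)%N -> (i <= j)%N -> s j <= C3 * s i) ->
  exists2 C : R, 0 < C & forall z n, (0 < n)%N ->
    normc z * (l n * s n) <= C1 -> opnorm (W (hlen l) z) <= expR (C * n%:R).
Proof.
move=> C10 C20 C30 dl1 Hpsi Hmono.
case: (Hl) => _ Hl'; case: (Hs) => _ Hs'.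
have [Cl Cl0 HCl] := Hl' _ ltr01; have [Cs Cs0 HCs] := Hs' _ ltr01.
have [c c0 Hc] := decays_ge Hs ltr01.
have [Ct Ct0 HCt] := tail_le hH Hl dl1.
pose P := `|dl + 1 + (dp + 1 + (dp + 1))|; have P0 : 0 <= P by exact: normr_ge0.
pose K := (C2 + C3) ^+ 2 * (Cl * Cs * Cs) * C1.
have K0 : 0 < K by rewrite !mulr_gt0 ?exprn_gt0 ?addr_gt0//.
pose C4 := ln (1 + K) + P * 2.
have lnK0 : 0 <= ln (1 + K) by rewrite ln_ge0//; lra.
have C40 : 0 <= C4 by rewrite addr_ge0 ?mulr_ge0.
pose C5 := (1 + C2 * C3) ^+ 2.
have C50 : 0 <= C5 by exact: sqr_ge0.
pose C6 := `|ln (16 / c)| + `|dp + 1|.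
have C60 : 0 <= C6 by rewrite addr_ge0.
exists (C6 + (C4 * 2 + C5 * (Ct * C1)) + 1).
  have : 0 <= C5 * (Ct * C1).
    by apply: mulr_ge0 => //; apply: mulr_ge0; exact: ltW.
  by lra.
move=> z n n0 h1; set r := normc z in h1 *.
have r0 : 0 <= r by exact: normc_ge0.
have nR : 1 <= n%:R :> R by rewrite ler1n.
have nR0 : 0 < n%:R :> R by rewrite ltr0n.
have sn := s0 n0; have ln' := l0 n0.
have s1 : s n <= 1 by rewrite ler_norml sin_geN1 sin_le1.
have A1 : 1 <= (s n)^-1 by rewrite invf_ge1.
pose ex j := if (j < n)%N then C4 * (n%:R / j.+1%:R) `^ 2^-1
  else C5 * (r * s n * l j.+1).
have Hex j : 1 + r * l j.+1 * (s n)^-1 * ((s n)^-1^-1 + `|sin (phi j.+1 - psi)|) ^+ 2 <=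
    expR (ex j).
  have hpsi := Hpsi j.+1 isT; have lj := lpos j; have sj := s0 (ltn0Sn j).
  rewrite invrK /ex; set sg := `|sin _| in hpsi *.
  have sg0 : 0 <= sg by exact: normr_ge0.
  have rl0 : 0 <= r * l j.+1 * (s n)^-1 by rewrite !mulr_ge0 ?invr_ge0// ltW.
  case: ltnP => [jn|nj].
    have [hl _] := HCl j.+1 n isT jn; have [hs _] := HCs j.+1 n isT jn.
    set x := n%:R / j.+1%:R in hl hs *.
    have x1 : 1 <= x by exact: ratio_ge1.
    have x0 : 0 < x by lra.
    have hm := Hmono j.+1 n isT jn.
    have k1 : (s n + sg) ^+ 2 <= (C2 + C3) ^+ 2 * s j.+1 ^+ 2.
      by rewrite -exprMn lerXn2r ?nnegrE ?mulr_ge0 ?addr_ge0 ?(ltW sj) ?(ltW sn)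
        ?(ltW C20) ?(ltW C30)//; lra.
    have p0 : 0 <= x `^ (dp + 1) by exact: powR_ge0.
    have k2 : s j.+1 ^+ 2 <= (Cs * x `^ (dp + 1) * s n) ^+ 2.
      by rewrite lerXn2r ?nnegrE ?mulr_ge0 ?(ltW sj) ?(ltW sn) ?(ltW Cs0).
    have k3 : r * l j.+1 * (s n)^-1 <= r * (Cl * x `^ (dl + 1) * l n) * (s n)^-1.
      by rewrite ler_wpM2r ?invr_ge0 ?(ltW sn)// ler_wpM2l.
    have k4 : r * l j.+1 * (s n)^-1 * (s n + sg) ^+ 2 <= K * x `^ P.
      have k5 : (s n + sg) ^+ 2 <= (C2 + C3) ^+ 2 * (Cs * x `^ (dp + 1) * s n) ^+ 2.
        by apply: (le_trans k1); rewrite ler_wpM2l ?sqr_ge0.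
      apply: le_trans (ler_pM rl0 (sqr_ge0 _) k3 k5) _.
      have -> : r * (Cl * x `^ (dl + 1) * l n) / s n *
         ((C2 + C3) ^+ 2 * (Cs * x `^ (dp + 1) * s n) ^+ 2) =
         (C2 + C3) ^+ 2 * (Cl * Cs * Cs) * (r * (l n * s n)) *
           (x `^ (dl + 1) * (x `^ (dp + 1) * x `^ (dp + 1))).
        by field; rewrite gt_eqF.
      have D0 : 0 <= (C2 + C3) ^+ 2 * (Cl * Cs * Cs).
        by apply: mulr_ge0; [exact: sqr_ge0|rewrite !mulr_ge0 ?(ltW Cl0) ?(ltW Cs0)].
      have rls : 0 <= r * (l n * s n) by rewrite !mulr_ge0 ?(ltW ln') ?(ltW sn).
      rewrite -!powRD_gt0//; apply: ler_pM; rewrite ?powR_ge0//.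
      - exact: mulr_ge0.
      - exact: ler_wpM2l.
      - by rewrite ler_powR// ler_norm.
    have xP : 1 <= x `^ P by rewrite -[leLHS](powRr0 x) ler_powR.
    apply: (@le_trans _ _ ((1 + K) * x `^ P)); first by lra.
    have xP0 : 0 < x `^ P by lra.
    have K1 : 0 < 1 + K by lra.
    have xh1 : 1 <= x `^ 2^-1 by rewrite -[leLHS](powRr0 x) ler_powR// invr_ge0.
    have KP0 : 0 < (1 + K) * x `^ P by exact: mulr_gt0.
    rewrite -[leLHS]lnK ?posrE// ler_expR lnM ?posrE// ln_powR.
    have hln := @ln_le_powR R x 2^-1 x1 ltac:(lra).
    rewrite invrK in hln.
    have := ler_wpM2l P0 hln; have := ler_wpM2l lnK0 xh1; rewrite /C4; lra.
  apply: le_trans (expR_ge1Dx _); rewrite lerD2l.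
  have hm := Hmono n j.+1 n0 (leqW nj).
  have k1 : (s n + sg) ^+ 2 <= C5 * s n ^+ 2.
    have : C2 * s j.+1 <= C2 * (C3 * s n) by rewrite ler_pM2l.
    move=> k; rewrite /C5 -exprMn lerXn2r ?nnegrE ?addr_ge0 ?mulr_ge0
      ?addr_ge0 ?mulr_ge0 ?(ltW sn) ?(ltW C20) ?(ltW C30)//.
    by lra.
  apply: le_trans (ler_wpM2l rl0 k1) _.
  rewrite le_eqVlt; apply/orP; left; apply/eqP; field.
  by rewrite gt_eqF.
have hsum m : (n <= m)%N ->
    \sum_(0 <= j < m) ex j <= (C4 * 2 + C5 * (Ct * C1)) * n%:R.
  move=> nm; rewrite (@big_cat_nat _ _ _ n)//= mulrDl lerD//.
    rewrite (eq_big_nat _ _ (F2 := fun j => C4 * (n%:R / j.+1%:R) `^ 2^-1)); last first.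
      by move=> j /andP[_ jn]; rewrite /ex jn.
    rewrite -mulr_sumr -mulrA ler_wpM2l//.
    have := @sum_powR_le R 2^-1 n ltac:(lra) ltac:(lra).
    have h : 1 - 2^-1 = 2^-1 :> R by lra.
    by rewrite h invrK mulrC.
  rewrite (eq_big_nat _ _ (F2 := fun j => C5 * (r * s n) * l j.+1)); last first.
    by move=> j /andP[nj _]; rewrite /ex ltnNge nj/= mulrA.
  rewrite -mulr_sumr -[leLHS]mulrA -[leRHS]mulrA ler_wpM2l//.
  have k := le_trans (sum_le_tail hH nm) (HCt n n0).
  have rs : 0 <= r * s n by rewrite mulr_ge0// ltW.
  apply: le_trans (ler_wpM2l rs k) _.
  have -> : r * s n * (Ct * (n%:R * l n)) = Ct * n%:R * (r * (l n * s n)) by ring.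
  have -> : Ct * C1 * n%:R = Ct * n%:R * C1 by ring.
  by rewrite ler_wpM2l// mulr_ge0// ltW.
apply: le_trans (_ : 4 * (4 * (s n)^-1 * expR ((C4 * 2 + C5 * (Ct * C1)) * n%:R)) <= _).
  apply: (@opnorm_le_rows _ _ n) => i m nm.
  have := upper_bound_fixed lpos (Hu z i) m A1 Hex.
  have [-> _ _] := row_init z i.
  rewrite mulr1 => /le_trans; apply.
  by rewrite ler_wpM2l ?ler_expR ?hsum// mulr_ge0// invr_ge0 ltW.
(* The weight [1 / s n] grows at most like a power of [n], which [ln n <= n] absorbs. *)
have hpre : 16 / s n <= expR (C6 * n%:R).
  have hc := Hc n n0.
  have p0 : 0 < n%:R `^ (dp + 1) :> R by rewrite powR_gt0.
  have k1 : 16 / s n <= 16 / c * n%:R `^ (dp + 1).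
    rewrite ler_pdivrMr//.
    have -> : 16 / c * n%:R `^ (dp + 1) * s n = 16 * (n%:R `^ (dp + 1) * s n) / c by ring.
    by rewrite ler_pdivlMr//; lra.
  apply: (le_trans k1).
  have c16 : 0 < 16 / c by rewrite divr_gt0.
  have c16p : 0 < 16 / c * n%:R `^ (dp + 1) by exact: mulr_gt0.
  rewrite -[leLHS]lnK ?posrE// ler_expR lnM ?posrE// ln_powR.
  have k2 : ln (n%:R : R) <= n%:R.
    by have := @le_ln1Dx R (n%:R - 1) ltac:(lra); rewrite addrC subrK; lra.
  have k3 : 0 <= ln (n%:R : R) by rewrite ln_ge0.
  have k4 : (dp + 1) * ln (n%:R : R) <= `|dp + 1| * n%:R.
    by rewrite (le_trans (ler_norm _))// normrM ler_wpM2l// ger0_norm.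
  have k5 : ln (16 / c) <= `|ln (16 / c)| * n%:R.
    by rewrite (le_trans (ler_norm _))// ler_peMr.
  by rewrite /C6; lra.
have -> : (C6 + (C4 * 2 + C5 * (Ct * C1)) + 1) * n%:R =
   C6 * n%:R + (C4 * 2 + C5 * (Ct * C1)) * n%:R + n%:R by ring.
set E := _ * n%:R; rewrite !expRD.
have e1 : 1 <= expR (n%:R : R) by rewrite -expR0 ler_expR.
have := ler_pM _ _ hpre e1; rewrite divr_ge0 ?(ltW sn)// => /(_ isT ler01).
have e0 := expR_ge0 E => /(ler_wpM2r e0); lra.
Qed.

End core.

(* Averaging l/s over [j, 2j) yields a weight comparable to l/s whose
   increments are O(1/j), hence negligible against s_j since j s_j tends to
   infinity. *)
Lemma slow_weight (R : realType) (l s : nat -> R) (dl dp : R) :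
  decays l dl -> decays s dp -> dp < 1 -> forall C1 : R, 0 < C1 ->
  exists (w : nat -> R) (kap : R) J, [/\ 0 < kap, (0 < J)%N,
    forall j, (J <= j)%N -> [/\ 0 <= w j, `|w j.+1 - w j| <= w j * s j / 2,
      2 * w j * s j <= l j.+1 & kap * l j.+1 <= w j * s j] &
    forall j y, (J <= j)%N -> 0 < y ->
      (forall i, (j <= i)%N -> y * l i <= C1 * s i) -> y * w j <= 1].
Proof.
have j4 j : (j + j <= 4 * j)%N by lia.
have j4' j : (0 < j)%N -> ((j + j).+1 <= 4 * j)%N by lia.
have j4'' j : (0 < j)%N -> (j.+1 <= 4 * j)%N by lia.
move=> Hl Hs dp1 C1 C10.
have l0 j : (0 < j)%N -> 0 < l j by case: Hl => + _; apply.
have s0 j : (0 < j)%N -> 0 < s j by case: Hs => + _; apply.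
have [Dl Dl0 HDl] := decays_local 4 Hl.
have [Ds Ds0 HDs] := decays_local 4 Hs.
pose f j := l j / s j.
pose D := Dl * Ds; have D0 : 0 < D by rewrite mulr_gt0.
have f0 j : (0 < j)%N -> 0 < f j by move=> j0; rewrite divr_gt0 ?l0 ?s0.
have HD i j : (0 < i)%N -> (i <= j)%N -> (j <= 4 * i)%N -> f i <= D * f j /\ f j <= D * f i.
  move=> i0 ij ji; have j0 : (0 < j)%N by exact: leq_trans ij.
  have [a1 a2] := HDl i j i0 ij ji; have [b1 b2] := HDs i j i0 ij ji.
  have li := ltW (l0 i i0); have lj := ltW (l0 j j0).
  have si := s0 i i0; have sj := s0 j j0.
  split; rewrite /f ler_pdivrMr// /D.
    have -> : Dl * Ds * (l j / s j) * s i = Dl * l j * (Ds * s i) / s j by ring.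
    by rewrite ler_pdivlMr// ler_pM// ltW.
  have -> : Dl * Ds * (l i / s i) * s j = Dl * l i * (Ds * s j) / s i by ring.
  by rewrite ler_pdivlMr// ler_pM// ltW.
pose A j := \sum_(j <= i < j + j) f i; pose a j := A j / j%:R.
have Ha j : (0 < j)%N -> f j / D <= a j <= D * f j.
  move=> j0; have jR : 0 < j%:R :> R by rewrite ltr0n.
  have cst (x : R) : x * j%:R = \sum_(j <= i < j + j) x.
    by rewrite sumr_const_nat addnK mulr_natr.
  rewrite /a ler_pdivlMr// ler_pdivrMr// !cst; apply/andP; split;
    apply: ler_sum_nat => i /andP[ji ij];
    have [h1 h2] := HD j i j0 ji (leq_trans (ltnW ij) (j4 j)) => //.
  by rewrite ler_pdivrMr// mulrC.
have da j : (0 < j)%N -> `|a j.+1 - a j| <= (3 * D * f j + a j) / j%:R.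
  move=> j0; have jR : 0 < j%:R :> R by rewrite ltr0n.
  have jR1 : 0 < j.+1%:R :> R by rewrite ltr0n.
  have jj1 : j%:R <= j.+1%:R :> R by rewrite ler_nat.
  (* Shifting the window from [j, 2j) to [j + 1, 2j + 2) changes three terms only, each comparable
     with [f j]. *)
  have AS : A j.+1 = A j - f j + f (j + j)%N + f (j + j).+1.
    have h1 : A j + f (j + j)%N + f (j + j).+1 = \sum_(j <= i < (j + j).+2) f i.
      by rewrite !big_nat_recr ?leqW ?leq_addr.
    have h2 : \sum_(j <= i < (j + j).+2) f i = f j + A j.+1.
      by rewrite big_ltn ?ltnS ?leqW ?leq_addr// /A addSn addnS.
    by lra.
  have [_ f2] := HD j (j + j)%N j0 (leq_addr _ _) (j4 j).
  have [_ f3] := HD j (j + j).+1 j0 (leqW (leq_addr _ _)) (j4' j j0).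
  have [_ f1] := HD j j j0 (leqnn _) ltac:(by rewrite leq_pmull).
  have F2 := f0 (j + j)%N ltac:(by rewrite addn_gt0 j0).
  have F3 := f0 (j + j).+1 isT; have F1 := f0 j j0.
  have [a1 a2] := andP (Ha j j0).
  have aj0 : 0 <= a j by apply: le_trans a1; rewrite divr_ge0 ?ltW.
  have -> : a j.+1 - a j = (f (j + j)%N + f (j + j).+1 - f j) / j.+1%:R - a j / j.+1%:R.
    have AE : A j = a j * j%:R by rewrite /a divfK// gt_eqF.
    rewrite {1}/a AS AE -natr1; field.
    by rewrite natr1 gt_eqF.
  have inv : j.+1%:R^-1 <= j%:R^-1 :> R by rewrite lef_pV2// posrE.
  have i0 : 0 <= j.+1%:R^-1 :> R by rewrite invr_ge0.
  have Df : 0 <= D * f j by rewrite mulr_ge0 ?ltW.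
  have -> : (f (j + j)%N + f (j + j).+1 - f j) / j.+1%:R - a j / j.+1%:R =
    (f (j + j)%N + f (j + j).+1 - f j - a j) / j.+1%:R by ring.
  rewrite normrM [X in _ * X]ger0_norm//.
  apply: ler_pM => //.
  by rewrite ler_norml; apply/andP; split; lra.
have e0 : 0 < (1 - dp) / 2 by lra.
have [c c0 Hc] := decays_ge Hs e0.
(* Beyond [N], [j s_j] is at least [2 (3 D^2 + 1)], thanks to [dp < 1]. Since [f j <= D * a j], the
   increment bound [da] then falls below [a j * s j / 2]. *)
have [N HN] := @pow_unbounded R _ (2 * (3 * D * D + 1) / c) e0.
(* The first bound gives [2 w s <= l_(j+1)], where [Dl] pays for the shift of the index; the second
   gives [y w <= 1]. *)
pose kp := Num.min (1 / (2 * D * Dl)) (1 / (D * C1)).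
have kp0 : 0 < kp by rewrite lt_min !divr_gt0 ?mulr_gt0.
have kp1 : kp * (2 * D * Dl) <= 1 by rewrite -ler_pdivlMr ?mulr_gt0// ge_min lexx.
have kp2 : kp * (D * C1) <= 1 by rewrite -ler_pdivlMr ?mulr_gt0// ge_min lexx orbT.
exists (fun j => kp * a j), (kp / (D * Dl)), N.+1; split => //.
- by rewrite divr_gt0 ?mulr_gt0.
- move=> j Nj; have j0 : (0 < j)%N by exact: leq_trans Nj.
  have jR : 0 < j%:R :> R by rewrite ltr0n.
  have [a1 a2] := andP (Ha j j0); have sj := s0 j j0; have lj := l0 j j0.
  have fs : f j * s j = l j by rewrite /f divfK// gt_eqF.
  have aj0 : 0 <= a j by apply: le_trans a1; rewrite divr_ge0 ?ltW ?f0.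
  have [d1 d2] := HDl j j.+1 j0 (leqnSn j) (j4'' j j0).
  split.
  + by rewrite mulr_ge0// ltW.
  + rewrite -mulrBr normrM (gtr0_norm kp0).
    have -> : kp * a j * s j / 2 = kp * (a j * s j / 2) by ring.
    rewrite ler_wpM2l ?(ltW kp0)//.
    apply: (le_trans (da j j0)); rewrite ler_pdivrMr//.
    have js : 2 * (3 * D * D + 1) <= j%:R * s j.
      have h1 := Hc j j0; have h2 := HN j (ltnW Nj).
      have p0 := powR_ge0 (j%:R : R) ((1 - dp) / 2).
      rewrite ler_pdivrMr// in h2; apply: (le_trans h2).
      have := ler_wpM2l p0 h1 => /le_trans; apply.
      rewrite mulrA -powRD_gt0// (_ : (1 - dp) / 2 + (dp + (1 - dp) / 2) = 1); last by lra.
      by rewrite powRr1// ltW.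
    have fa : f j <= D * a j by rewrite -ler_pdivrMl// mulrC.
    have fa2 : 3 * D * f j <= 3 * D * (D * a j) by rewrite ler_wpM2l// !mulr_ge0// ltW.
    move: (ler_wpM2l aj0 js) fa2; move: (a j) (f j) (s j) => x1 x2 x3; lra.
  + have h : a j * s j <= D * l j by rewrite -fs mulrA ler_wpM2r// ltW.
    have h2 : kp * (a j * s j) <= kp * (D * (Dl * l j.+1)).
      by rewrite ler_wpM2l ?(ltW kp0)// (le_trans h)// ler_wpM2l// ltW.
    have := ler_wpM2r (ltW (l0 j.+1 isT)) kp1; lra.
  + have h : l j / D <= a j * s j by rewrite -fs mulrAC ler_wpM2r// ltW.
    have h2 : l j.+1 / Dl <= l j by rewrite ler_pdivrMr// mulrC.
    have h3 : l j.+1 / Dl / D <= a j * s j.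
      by apply: le_trans h; rewrite ler_wpM2r// invr_ge0 ltW.
    have -> : kp / (D * Dl) * l j.+1 = kp * (l j.+1 / Dl / D) by field; rewrite !gt_eqF.
    by rewrite -[leRHS]mulrA ler_wpM2l// ltW.
- move=> j y Nj y0 H; have j0 : (0 < j)%N by exact: leq_trans Nj.
  have [_ a2] := andP (Ha j j0); have sj := s0 j j0.
  have h : y * f j <= C1 by rewrite /f mulrA ler_pdivrMr// H.
  have h2 : y * (kp * a j) <= kp * (D * (y * f j)).
    have -> : kp * (D * (y * f j)) = y * (kp * (D * f j)) by ring.
    by rewrite !ler_wpM2l// ltW.
  apply: (le_trans h2); apply: le_trans kp2.
  by rewrite !ler_wpM2l// ltW.
Qed.

Section core_lower.
Variables (R : realType) (l phi : nat -> R) (dl dp : R) (W : R -> R[i] -> 'M[R[i]]_2).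
Hypothesis hH : limit_circle_hamburger l phi.
Hypothesis hW : forall z : R[i],
  is_fundamental_solution (hamburger l phi) (hlen l) z (fun t => W t z).
Let s j : R := `|sin (phi j.+1 - phi j)|.
Hypothesis Hl : decays l dl.
Hypothesis Hs : decays s dp.

Lemma opnorm_ge_m (sg C1 : R) (J1 : nat) : 0 < C1 -> dp < 1 -> sg ^+ 2 = 1 ->
  (forall j, (J1 <= j)%N -> [/\ 0 <= sg * sin (phi j.+1 - phi j), s j <= 1 / 4 &
     3 / 4 <= cos (phi j.+1 - phi j)]) ->
  exists2 c : R, 0 < c & exists J0, forall y N, 0 < y -> (J0 <= N)%N ->
    (forall i, (N <= i)%N -> y * l i <= C1 * s i) ->
    1 / 4 * expR (c * (y * tail l N)) <= opnorm (W (hlen l) (Complex 0 y)).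
Proof.
move=> C10 dp1 sg1 Hsg.
have [w [kap [J [kap0 J0 Hw Hw1]]]] := slow_weight Hl Hs dp1 C10.
have lpos j : 0 < l j.+1 by case: (Hl) => + _; apply.
exists (kap / 64); first by rewrite divr_gt0.
exists (maxn J J1) => y N y0; rewrite geq_max => /andP[JN J1N] HN.
set z := Complex 0 y.
have Hu := monodromy_rec hH (hW z) 0.
have [_ S0 E0] := row_init hW z 0.
have t0 : 0 < tail l N by exact: tail_gt0 hH Hl N.
(* Past [M] at least half of the tail after [N] has been traversed. This loss and the square root
   between [sqnorm] and the norm turn [kap / 16] into [kap / 64]. *)
have [M HM] := hnode_cvg hH (ltac:(lra) : 0 < tail l N / 2).
apply: (@opnorm_ge _ _ _ _ hH hW _ 0 _ (maxn M N)) => [|n].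
  by rewrite mulr_ge0 ?expR_ge0//; lra.
rewrite geq_max => /andP[Mn Nn].
have sE j : (N <= j)%N -> sg * sin (phi j.+1 - phi j) = s j.
  move=> Nj; have [h _ _] := Hsg j (leq_trans J1N Nj).
  rewrite -[LHS]ger0_norm// normrM (_ : `|sg| = 1) ?mul1r//.
  by rewrite -sqrtr_sqr sg1 sqrtr1.
have H j : (N <= j)%N -> let sj := sg * sin (phi j.+1 - phi j) in
    [/\ 0 <= sj <= 1 / 4, 3 / 4 <= cos (phi j.+1 - phi j), 0 <= y * w j <= 1,
      `|y * w j.+1 - y * w j| <= y * w j * sj / 2 &
      2 * (y * w j) * sj <= y * l j.+1 /\ kap * (y * l j.+1) <= y * w j * sj].
  move=> Nj /=; rewrite sE//.
  have [h1 h2 h3 h4] := Hw j (leq_trans JN Nj).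
  have [_ h5 h6] := Hsg j (leq_trans J1N Nj).
  have h7 : y * w j <= 1.
    apply: Hw1 => // [|i ji]; first exact: leq_trans Nj.
    by apply: HN; exact: leq_trans ji.
  split => //.
  - by rewrite h5 andbT normr_ge0.
  - by rewrite h7 andbT mulr_ge0// ltW.
  - rewrite -mulrBr normrM (gtr0_norm y0).
    have -> : y * w j * s j / 2 = y * (w j * s j / 2) by ring.
    by rewrite ler_wpM2l// ltW.
  - by split; [have := ler_wpM2l (ltW y0) h3|have := ler_wpM2l (ltW y0) h4]; lra.
apply: le_trans (lyapunov_growth lpos y0 Hu S0 (w := fun j => y * w j) Nn sg1
  (ltW kap0) H).
have E1 : 1 <= sqnorm (W (hnode l N) z 0 0) (W (hnode l N) z 0 1).
  by rewrite -E0; exact: (sqnorm_homo lpos y0 Hu S0).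
have hsum : tail l N / 2 <= \sum_(N <= j < n) l j.+1.
  by rewrite (sum_hnode l Nn); have := HM n Mn; rewrite /tail; lra.
have -> : (2 * (1 / 4 * expR (kap / 64 * (y * tail l N)))) ^+ 2 =
    1 / 4 * expR (kap / 32 * (y * tail l N)).
  have -> : kap / 32 * (y * tail l N) =
      kap / 64 * (y * tail l N) + kap / 64 * (y * tail l N) by lra.
  by rewrite expRD; field.
rewrite /=; apply: ler_pM; rewrite ?expR_ge0//; first by move: E1; lra.
rewrite ler_expR.
have ky : 0 <= kap / 16 * y by rewrite mulr_ge0 ?divr_ge0// ltW.
have := ler_wpM2l ky hsum; lra.
Qed.

End core_lower.

(** * The rates k and m *)

Lemma norm_sin_shift (R : realType) (x : R) (k : int) :
  `|sin (x + k%:~R * pi)| = `|sin x|.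
Proof.
have H n y : `|sin (y + n%:R * pi)| = `|sin y| :> R.
  elim: n => [|n IH]; first by rewrite mul0r addr0.
  by rewrite -natr1 mulrDl mul1r addrA sinDpi normrN.
case: k => n; first by rewrite -pmulrn H.
rewrite NegzE mulrNz mulNr -[in RHS](subrK (n.+1%:R * pi) x).
by rewrite H pmulrn.
Qed.

Lemma sin_eq0_pi (R : realType) (x : R) : sin x = 0 -> exists k : int, x = k%:~R * pi.
Proof.
move=> sx; exists (Num.floor (x / pi)); set k := Num.floor _.
have pi0 : 0 < pi :> R by exact: pi_gt0.
have /andP[k1 k2] := floor_itv (x / pi); rewrite -/k intrD mulr1z in k1 k2.
rewrite ler_pdivlMr// in k1; rewrite ltr_pdivrMr// in k2.
have := norm_sin_shift (x - k%:~R * pi) k; rewrite subrK sx normr0 => /esym/eqP.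
rewrite normr_eq0 => /eqP sy.
have [h|h] := ltP 0 (x - k%:~R * pi); last by lra.
by have := @sin_gt0_pi R (x - k%:~R * pi) ltac:(lra); rewrite sy ltxx.
Qed.

(** * The integral in [rate_m] against the tail of the lengths *)

Section integral_tail.
Variables (R : realType) (f : R -> R).
Hypothesis fpos : forall t, 1 <= t -> 0 < f t.
Hypothesis fmeas : @measurable_fun _ _ (lebesgueType R) R `[1, +oo[ f.
Let mu : {measure set (lebesgueType R) -> \bar R} := @completed_lebesgue_measure R.
Local Notation I D := (\int[mu]_(x in D) (f x)%:E)%E.

Lemma measurable_sub_ray (D : set (lebesgueType R)) : measurable D ->
  D `<=` `[1, +oo[%classic -> measurable_fun D (fun x : lebesgueType R => (f x)%:E).
Proof.
move=> mD D1; apply/measurable_realfun.measurable_EFinP.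
by apply: measurable_funS D1 fmeas => //; exact: lebesgueType_measurable_itv.
Qed.

Lemma integral_unit_bounds (j : nat) (c C : R) : (0 < j)%N -> 0 <= c ->
  (forall x, j%:R <= x -> x < j.+1%:R -> c <= f x <= C) ->
  (c%:E <= I `[j%:R, j.+1%:R[%classic <= C%:E)%E.
Proof.
move=> j0 c0 H; set D : set (lebesgueType R) := `[j%:R, j.+1%:R[%classic.
have mD : measurable D by exact: lebesgueType_measurable_itv.
have D1 : D `<=` `[1, +oo[%classic.
  have j1 : 1 <= j%:R :> R by rewrite ler1n.
  by move=> x /=; rewrite !in_itv/= andbT => /andP[h _]; exact: le_trans j1 h.
have Df x : D x -> c <= f x <= C.
  by rewrite /D /= in_itv/= => /andP[]; exact: H.
have muD : mu D = 1%:E.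
  rewrite /D [LHS]completed_measure_itv lebesgue_measure_itv/= lte_fin ltr_nat ltnSn.
  by rewrite -EFinB -natr1 addrAC subrr add0r.
have icst (x : R) : (\int[mu]_(_ in D) x%:E = x%:E)%E.
  apply: (etrans (integral_cst _ mD x%:E)).
  by rewrite muD mule1.
apply/andP; split.
  rewrite -[leLHS]icst; apply: ge0_le_integral => //.
  - exact: measurable_sub_ray.
  - by move=> x /Df/andP[h _]; rewrite lee_fin.
rewrite -[leRHS]icst; apply: ge0_le_integral => //.
- by move=> x /Df/andP[h _]; rewrite lee_fin (le_trans c0).
- exact: measurable_sub_ray.
- by move=> x /Df/andP[_ h]; rewrite lee_fin.
Qed.

Lemma integral_rayE n : (0 < n)%N -> (I `[n%:R, +oo[%classic =
  \sum_(0 <= k <oo) I `[(n + k)%:R, (n + k).+1%:R[%classic)%E.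
Proof.
move=> n0.
pose F k : set (lebesgueType R) := `[(n + k)%:R, (n + k).+1%:R[%classic.
have FE : `[n%:R, +oo[%classic = \bigcup_k F k.
  apply/seteqP; split => [x /=|x [k _]]; rewrite /F /= !in_itv/= andbT.
    move=> nx; exists (Num.truncn x - n)%N => //=; rewrite in_itv/=.
    have xn : (n <= Num.truncn x)%N by rewrite truncn_ge_nat// (le_trans _ nx).
    by rewrite subnKC// truncn_le truncnS_gt (le_trans _ nx).
  by move=> /andP[h _]; apply: le_trans h; rewrite ler_nat leq_addr.
have mF k : measurable (F k) by exact: lebesgueType_measurable_itv.
have D1 : \bigcup_k F k `<=` `[1, +oo[%classic.
  have n1 : 1 <= n%:R :> R by rewrite ler1n.
  by rewrite -FE => x /=; rewrite !in_itv/= !andbT => h; exact: le_trans n1 h.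
rewrite FE ge0_integral_bigcup//.
- by apply: measurable_sub_ray => //; apply: bigcup_measurable.
- by move=> x /D1 /=; rewrite in_itv/= andbT => /fpos/ltW; rewrite lee_fin.
- apply/trivIsetP => i j _ _ ij; apply/seteqP; split => // x [].
  rewrite /F /= !in_itv/= => /andP[i1 i2] /andP[j1 j2].
  have h1 : (n + i < (n + j).+1)%N by rewrite -(ltr_nat R); apply: le_lt_trans i1 j2.
  have h2 : (n + j < (n + i).+1)%N by rewrite -(ltr_nat R); apply: le_lt_trans j1 i2.
  by move/eqP: ij; apply; apply/eqP; rewrite -(eqn_add2l n) eqn_leq -ltnS h1 -ltnS h2.
Qed.

(** Cutting at the integers makes the integral a series. The real bound [B] makes it finite, which
    later allows the passage to the real-valued integral. *)
Lemma integral_ray_bounds (v : nat -> R) n (c C B : R) : (0 < n)%N -> 0 <= c ->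
  (forall j, (n <= j)%N -> 0 <= v j) ->
  (forall j x, (n <= j)%N -> j%:R <= x -> x < j.+1%:R -> c * v j <= f x <= C * v j) ->
  (forall m, (n <= m)%N -> C * \sum_(n <= j < m) v j <= B) ->
  (I `[n%:R, +oo[%classic <= B%:E)%E /\
  forall m, (n <= m)%N -> ((c * \sum_(n <= j < m) v j)%:E <= I `[n%:R, +oo[%classic)%E.
Proof.
move=> n0 c0 v0 H HB; rewrite integral_rayE//.
have Hk k : ((c * v (n + k)%N)%:E <= I `[(n + k)%:R, (n + k).+1%:R[%classic <=
    (C * v (n + k)%N)%:E)%E.
  apply: integral_unit_bounds => [||x h1 h2]; first by rewrite addn_gt0 n0.
    by rewrite mulr_ge0// v0// leq_addr.
  by apply: H => //; exact: leq_addr.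
have I0 k : (0 <= I `[(n + k)%:R, (n + k).+1%:R[%classic)%E.
  have /andP[h _] := Hk k; apply: le_trans h; rewrite lee_fin mulr_ge0// v0//.
  exact: leq_addr.
have sumE (x : R) m : (\sum_(0 <= k < m) (x * v (n + k)%N)%:E =
    (x * \sum_(n <= j < n + m) v j)%:E)%E.
  rewrite sumEFin -mulr_sumr; congr (_ * _)%:E.
  rewrite -{2}[n]add0n big_addn addKn.
  by apply: eq_bigr => k _; rewrite addnC.
split.
  apply: lime_le; first by apply: is_cvg_nneseries => k _ _; exact: I0.
  apply: nearW => m.
  apply: (@le_trans _ _ (\sum_(0 <= k < m) (C * v (n + k)%N)%:E)%E).
    by apply: lee_sum => k _; have /andP[] := Hk k.
  by rewrite sumE lee_fin HB// leq_addr.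
move=> m nm; rewrite -(subnKC nm) -sumE.
apply: (@le_trans _ _ (\sum_(0 <= k < m - n) I `[(n + k)%:R, (n + k).+1%:R[%classic)%E).
  by apply: lee_sum => k _; have /andP[] := Hk k.
by apply: nneseries_lim_ge => k _ _; exact: I0.
Qed.

End integral_tail.

(** The ray from [T] lies between those from [n] and [n + 1], and on [j, j + 1) the integrand is
    comparable with [l j.+1]. The tails at [n] and [n + 1] are comparable because [l n.+1] is
    bounded by a multiple of [l n.+2], hence of the later tail. *)
Lemma integral_tail_asymp (R : realType) (dlf : R -> R) (l phi : nat -> R) (dl : R) :
  limit_circle_hamburger l phi -> decays l dl ->
  potter dlf (- dl) -> @measurable_fun _ _ (lebesgueType R) R `[1, +oo[ dlf ->
  asymp \oo l (fun j => dlf j%:R) ->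
  exists C X : R, [/\ 0 < C, 1 <= X & forall T, X <= T ->
    let F := \int[@completed_lebesgue_measure R]_(x in [set x | T <= x]) dlf x in
    let n := Num.truncn T in F <= C * tail l n /\ tail l n <= C * F].
Proof.
move=> hH Hl pf mf hl; have [f0 _] := pf.
have l0 j : (0 < j)%N -> 0 < l j by case: (Hl) => + _; apply.
have [X [K [X1 K0 HK]]] := potter_local pf.
have [D D0 HD] := asymp_all l0 (fun j j0 => f0 j%:R ltac:(by rewrite ler1n)) hl.
have [E E0 HE] := decays_local 2 Hl.
have jS j : (0 < j)%N -> (j.+1 <= 2 * j)%N by lia.
pose C := K * K * D; have C0 : 0 < C by rewrite !mulr_gt0.
pose c := C^-1; have c0 : 0 < c by rewrite invr_gt0.
have Hx j x : X <= j%:R -> j%:R <= x -> x < j.+1%:R ->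
    c * l j.+1 <= dlf x <= C * l j.+1.
  move=> Xj jx xj.
  have jR : 1 <= j%:R :> R by lra.
  have j0 : (0 < j)%N by rewrite -(ltr_nat R); lra.
  have j2 : j.+1%:R <= 2 * j%:R :> R by rewrite -natrM ler_nat jS.
  have [h1 h2] := HK j%:R x Xj jx ltac:(lra).
  have [h3 h4] := HK j%:R j.+1%:R Xj ltac:(by rewrite ler_nat) j2.
  have [h5 h6] := HD j.+1 isT.
  have fx : 0 < dlf x by apply: f0; lra.
  have fj := f0 j.+1%:R ltac:(by rewrite ler1n).
  apply/andP; split.
    rewrite /c ler_pdivrMl//; apply: (le_trans h5).
    have k1 : dlf j.+1%:R <= K * (K * dlf x) by apply: (le_trans h3); rewrite ler_pM2l.
    by have := ler_wpM2l (ltW D0) k1; rewrite /C; lra.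
  apply: (le_trans h1); rewrite /C -!mulrA ler_pM2l//.
  by apply: (le_trans h4); rewrite ler_pM2l.
exists (C + C * (1 + E)), (X + 2); split; [by rewrite addr_gt0 ?mulr_gt0//; lra|lra|].
move=> T XT F n.
have nT : n%:R <= T by rewrite truncn_le; lra.
have Tn : T < n.+1%:R by exact: truncnS_gt.
have Xn : X <= n%:R by rewrite -natr1 in Tn; lra.
have n0 : (0 < n)%N by rewrite -(ltr_nat R); lra.
have HC m B : (m >= n)%N -> tail l m <= B -> (forall k, (m <= k)%N ->
    C * \sum_(m <= j < k) l j.+1 <= C * B).
  move=> nm mB k mk; rewrite ler_pM2l// (le_trans _ mB)//.
  exact: sum_le_tail hH m k mk.
have Hb m j x : (n <= m)%N -> (m <= j)%N -> j%:R <= x -> x < j.+1%:R ->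
    c * l j.+1 <= dlf x <= C * l j.+1.
  move=> nm mj; apply: Hx; apply: (le_trans Xn); rewrite ler_nat.
  exact: leq_trans mj.
have lp m j : (m <= j)%N -> 0 <= l j.+1 by move=> _; rewrite ltW// l0.
have [up _] := integral_ray_bounds f0 mf n0 (ltW c0) (lp n)
   (fun j x => Hb n j x (leqnn n)) (HC n _ (leqnn n) (lexx _)).
have [up1 low] := integral_ray_bounds f0 mf (ltn0Sn n) (ltW c0) (lp n.+1)
   (fun j x => Hb n.+1 j x (leqnSn n)) (HC n.+1 _ (leqnSn n) (lexx _)).
set I0 := integral _ _ _ in up; set I1 := integral _ _ _ in up1 low.
have mray (t : R) : measurable (`[t, +oo[%classic : set (lebesgueType R)).
  exact: lebesgueType_measurable_itv.
have sray (t : R) : 1 <= t -> `[t, +oo[%classic `<=` `[1, +oo[%classic.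
  by move=> t1 x /=; rewrite !in_itv/= !andbT; exact: le_trans.
have sub (t u : R) : 1 <= t -> t <= u ->
    (\int[@completed_lebesgue_measure R]_(x in `[u, +oo[%classic) (dlf x)%:E <=
     \int[@completed_lebesgue_measure R]_(x in `[t, +oo[%classic) (dlf x)%:E)%E.
  move=> t1 tu; apply: ge0_subset_integral; [exact: mray|exact: mray|..].
  - apply: (measurable_sub_ray mf) => //; exact: sray.
  - by move=> x /(sray _ t1) /=; rewrite in_itv/= andbT => /f0/ltW; rewrite lee_fin.
  - by move=> x /=; rewrite !in_itv/= !andbT; exact: le_trans.
have FE : [set x | T <= x] = `[T, +oo[%classic.
  by apply/seteqP; split => x /=; rewrite in_itv/= andbT.
have s0 : (\int[@completed_lebesgue_measure R]_(x in `[T, +oo[%classic) (dlf x)%:E <= I0)%E.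
  by apply: sub; lra.
have s1 : (I1 <= \int[@completed_lebesgue_measure R]_(x in `[T, +oo[%classic) (dlf x)%:E)%E.
  by apply: sub; [lra|exact: ltW].
rewrite /F /Rintegral FE; set G := integral _ _ _ in s0 s1 *.
have low0 := low n.+1 (leqnn _); rewrite big_geq// mulr0 in low0.
have G0 : (0 <= G)%E by exact: le_trans s1.
have Gup : (G <= (C * tail l n)%:E)%E by exact: le_trans up.
have Gfin : G \is a fin_num by rewrite ge0_fin_numE// (le_lt_trans Gup)// ltry.
have t0 := tail_gt0 hH Hl n.
have t1 : tail l n.+1 <= C * fine G.
  apply: (tail_le_sum hH) => m nm; rewrite -ler_pdivrMl//.
  by rewrite -lee_fin fineK//; exact: le_trans (low m nm) s1.
have fG0 : 0 <= fine G by exact: fine_ge0.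
split.
  have E1 : 0 <= 1 + E by rewrite addr_ge0// ltW.
  have FC : fine G <= C * tail l n by rewrite -lee_fin fineK.
  apply: (le_trans FC); rewrite mulrDl lerDl.
  exact: mulr_ge0 (mulr_ge0 (ltW C0) E1) (ltW t0).
have tE : tail l n = tail l n.+1 + l n.+1 by rewrite /tail hnodeS; ring.
have [h1 _] := HE n.+1 n.+2 isT (leqnSn _) (jS n.+1 isT).
have h2 := sum_le_tail hH (leqnSn n.+1); rewrite big_nat1 in h2.
have h3 : l n.+1 <= E * tail l n.+1 by apply: (le_trans h1); rewrite ler_pM2l.
have h4 : 0 <= C * fine G by rewrite mulr_ge0// ltW.
have E1 : 0 < 1 + E by lra.
have := ler_wpM2l (ltW E1) t1.
rewrite tE; lra.
Qed.

(** This says that g(r) is r^(rho + o(1)). Positivity is demanded because [ln] has a default value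
    elsewhere. *)
Definition log_order {R : realType} (g : R -> R) (rho : R) : Prop :=
  forall e, 0 < e -> exists X, forall r, X <= r ->
    0 < g r /\ `|ln (g r) - rho * ln r| <= e * ln r.

Lemma ln_unbounded (R : realType) (B : R) :
  exists X : R, 1 <= X /\ forall r, X <= r -> B <= ln r.
Proof.
exists (expR `|B|); split; first by rewrite -expR0 ler_expR.
move=> r hr; have r0 : 0 < r by apply: lt_le_trans hr; exact: expR_gt0.
by rewrite (le_trans (ler_norm B))// -[leLHS]expRK ler_ln ?posrE ?expR_gt0.
Qed.

Lemma decays_ln (R : realType) (u : nat -> R) (delta : R) : decays u delta ->
  forall e, 0 < e -> exists C : R, forall n, (0 < n)%N ->
    `|ln (u n) + delta * ln n%:R| <= e * ln n%:R + C.
Proof.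
move=> Hu e e0; have u0 n : (0 < n)%N -> 0 < u n by case: Hu => + _; apply.
have [c c0 Hc] := decays_ge Hu e0; have [C C0 HC] := decays_le_pow Hu e0.
exists (`|ln c| + `|ln C|) => n n0; have nR : 0 < n%:R :> R by rewrite ltr0n.
have h1 : ln c <= (delta + e) * ln n%:R + ln (u n).
  rewrite -ln_powR -lnM ?posrE ?powR_gt0 ?u0//.
  by rewrite ler_ln ?posrE ?mulr_gt0 ?powR_gt0 ?u0// Hc.
have h2 : ln (u n) <= ln C + (- delta + e) * ln n%:R.
  rewrite -ln_powR -lnM ?posrE ?powR_gt0//.
  by rewrite ler_ln ?posrE ?mulr_gt0 ?powR_gt0 ?u0// HC.
have := ler_norm (- ln c); have := ler_norm (ln C); rewrite normrN => h3 h4.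
have := normr_ge0 (ln c); have := normr_ge0 (ln C) => h5 h6.
by rewrite ler_norml; apply/andP; split; lra.
Qed.

Lemma inverse_order (R : realType) (N : R -> R) (alpha : R) : 0 < alpha ->
  (exists X, forall r, X <= r -> 0 <= N r) ->
  (forall e, 0 < e -> exists C X : R, forall r, X <= r ->
     `|alpha * N r - ln r| <= e * N r + C) ->
  forall e, 0 < e -> exists X, forall r, X <= r -> `|N r - alpha^-1 * ln r| <= e * ln r.
Proof.
move=> a0 [X0 N0] H e e0.
(* The first bound gives the a priori estimate of [N r] by a multiple of [ln r] plus a constant; the
   second turns it into an error of at most half the allowance [e]. *)
pose d := Num.min (alpha / 2) (e * alpha ^+ 2 / 4).
have d0 : 0 < d by rewrite lt_min !divr_gt0// mulr_gt0// exprn_gt0.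
have d1 : d <= alpha / 2 by rewrite ge_min lexx.
have d2 : d <= e * alpha ^+ 2 / 4 by rewrite ge_min lexx orbT.
have [C [X1 HC]] := H d d0.
have ea : 0 < e * alpha / 2 by rewrite divr_gt0 ?mulr_gt0.
have [X2 [X21 HB]] := ln_unbounded (2 * `|C| / (e * alpha / 2)).
exists (Num.max X0 (Num.max X1 X2)) => r; rewrite !ge_max => /andP[r0 /andP[r1 r2]].
have n0 := N0 r r0; have := HC r r1; have := HB r r2.
rewrite ler_pdivrMr// => hB; rewrite ler_norml => /andP[h1 h2].
have C1 := ler_norm C; have C2 := normr_ge0 C.
have lr0 : 0 <= ln r.
  have : 0 <= ln r * (e * alpha / 2) by lra.
  by rewrite pmulr_lge0.
have dN : d * N r <= alpha / 2 * N r by rewrite ler_wpM2r.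
have hN : N r <= 2 / alpha * (ln r + `|C|).
  by rewrite mulrAC ler_pdivlMr//; lra.
have da1 : d * (2 / alpha) <= 1 by rewrite mulrA ler_pdivrMr//; lra.
have da2 : d * (2 / alpha) <= e * alpha / 2.
  by rewrite mulrA ler_pdivrMr//; lra.
have k1 := ler_wpM2l (ltW d0) hN.
have k2 := ler_wpM2r lr0 da2; have k3 := ler_wpM2r C2 da1.
have -> : N r - alpha^-1 * ln r = alpha^-1 * (alpha * N r - ln r).
  by field; rewrite gt_eqF.
rewrite normrM gtr0_norm ?invr_gt0// ler_pdivrMl// ler_norml.
by apply/andP; split; lra.
Qed.

Lemma le_circle (R : realType) (F : R[i] -> R) (r B : R) : 0 <= r ->
  (forall z, normc z = r -> F z <= B) -> max_circle F r <= B.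
Proof.
move=> r0 HB; apply: ge_sup => [|_ [z /= zr <-]]; last exact: HB.
have h : normc (real_complex R r) = r by rewrite normc_real ger0_norm.
by exists (F (real_complex R r)), (real_complex R r).
Qed.

Lemma ge_circle (R : realType) (F : R[i] -> R) (r B : R) z :
  (forall z, normc z = r -> F z <= B) -> normc z = r -> F z <= max_circle F r.
Proof.
move=> HB zr; apply: ub_le_sup; last by exists z.
by exists B => _ [w /= wr <-]; exact: HB.
Qed.

Lemma ln_le_of_expR (R : realType) (x B : R) : 0 <= B -> x <= expR B -> ln x <= B.
Proof.
move=> B0 xB; have [x0|x0] := ltP 0 x; last by rewrite ln0.
by rewrite -[leRHS]expRK ler_ln ?posrE ?expR_gt0.
Qed.

Section growth.
Variables (R : realType) (M : R[i] -> 'M[R[i]]_2).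

Lemma log_growth_le (r B : R) : 0 <= r -> 0 <= B ->
  (forall z, normc z = r -> opnorm (M z) <= expR B) -> log_growth M r <= B.
Proof. by move=> r0 B0 H; apply: le_circle => // z zr; apply/ln_le_of_expR/H. Qed.

Lemma normc_imag (r : R) : 0 <= r -> normc (Complex 0 r) = r.
Proof. by move=> r0; rewrite /= expr0n/= add0r sqrtr_sqr ger0_norm. Qed.

(** The bound by [B] over the whole circle is what makes the supremum genuine: on an unbounded set
    [sup] is a default value, and one large value would prove nothing. *)
Lemma log_growth_ge (r b B : R) : 0 <= r -> 0 <= B ->
  (forall z, normc z = r -> opnorm (M z) <= expR B) ->
  expR b <= opnorm (M (Complex 0 r)) -> b <= log_growth M r.
Proof.
move=> r0 B0 HB Hb; apply: (@le_trans _ _ (ln (opnorm (M (Complex 0 r))))).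
  by rewrite -[leLHS]expRK ler_ln ?posrE ?expR_gt0// (lt_le_trans (expR_gt0 b)).
apply: (@ge_circle _ (fun z => ln (opnorm (M z))) r B); last exact: normc_imag.
by move=> z zr; apply/ln_le_of_expR/HB.
Qed.

Lemma lesssim_log_growth (g : R -> R) (C X : R) : 0 < C -> 0 <= X ->
  (forall r, X <= r -> 0 <= g r) ->
  (forall r z, X <= r -> normc z = r -> opnorm (M z) <= expR (C * g r)) ->
  lesssim (pinfty_nbhs R) (log_growth M) g.
Proof.
move=> C0 X0 g0 H; exists C => //; exists X; split; first exact: num_real.
move=> r /ltW Xr; apply: log_growth_le; [lra|by apply: mulr_ge0; [exact: ltW|exact: g0]|].
by move=> z; exact: H.
Qed.

Lemma lesssim_log_growth_ge (g h : R -> R) (c C X : R) : 0 < c -> 0 < C -> 0 <= X ->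
  (forall r, X <= r -> 0 <= h r) ->
  (forall r z, X <= r -> normc z = r -> opnorm (M z) <= expR (C * h r)) ->
  (forall r, X <= r -> expR (c * g r) <= opnorm (M (Complex 0 r))) ->
  lesssim (pinfty_nbhs R) g (log_growth M).
Proof.
move=> c0 C0 X0 h0 H Hc; exists c^-1; first by rewrite invr_gt0.
exists X; split; first exact: num_real.
move=> r /ltW Xr; rewrite ler_pdivlMl//.
apply: (@log_growth_ge r _ (C * h r)); [lra|by apply: mulr_ge0; [exact: ltW|exact: h0]| |exact: Hc].
by move=> z; exact: H.
Qed.

Lemma growth_order_le (g : R -> R) (rho C X : R) : 0 < C -> 0 < rho -> log_order g rho ->
  (forall r z, X <= r -> normc z = r -> opnorm (M z) <= expR (C * g r)) ->
  (growth_order M <= rho%:E)%E.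
Proof.
move=> C0 rho0 Hg H; apply/lee_addgt0Pr => e e0.
have e20 : 0 < e / 2 by lra.
have [X1 HX1] := Hg _ e20.
have [X2 [X21 HX2]] := ln_unbounded (ln C / (e / 2)).
pose Y := Num.max (expR 1) (Num.max X (Num.max X1 X2)).
apply: (@le_trans _ _ (ereal_sup ((fun r : R =>
    (ln (ln (max_circle (fun z => opnorm (M z)) r)) / ln r)%:E) @` [set r | Y < r]))).
  apply: ereal_inf_lbound; exists [set r | Y < r] => //.
  by exists Y; split; [exact: num_real|].
apply: ge_ereal_sup => _ [r /= /ltW + <-].
rewrite /Y !ge_max => /andP[r1 /andP[rX /andP[rX1 rX2]]].
have [g0 /ler_normlP[_ hg]] := HX1 r rX1; have hC := HX2 r rX2.
have r0 : 0 < r by apply: lt_le_trans r1; exact: expR_gt0.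
have lr1 : 1 <= ln r by rewrite -[leLHS]expRK ler_ln ?posrE ?expR_gt0.
rewrite -EFinD lee_fin ler_pdivrMr; last by lra.
have Cg : 0 < C * g r by rewrite mulr_gt0.
have h1 : max_circle (fun z => opnorm (M z)) r <= expR (C * g r).
  by apply: le_circle => [|z zr]; [exact: ltW|exact: H].
have h2 := ln_le_of_expR (ltW Cg) h1.
have rl : 0 <= (rho + e) * ln r by rewrite mulr_ge0//; lra.
apply: ln_le_of_expR => //; apply: (le_trans h2).
rewrite -[leLHS]lnK ?posrE// ler_expR lnM ?posrE//.
rewrite ler_pdivrMr// in hC; lra.
Qed.

Lemma growth_order_ge (g h : R -> R) (rho c C X : R) : 0 < c -> log_order g rho ->
  (forall r z, X <= r -> normc z = r -> opnorm (M z) <= expR (C * h r)) ->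
  (forall r, X <= r -> expR (c * g r) <= opnorm (M (Complex 0 r))) ->
  (rho%:E <= growth_order M)%E.
Proof.
move=> c0 Hg HC H; apply: le_ereal_inf_tmp => _ [V [Y [_ HY]] <-].
apply/lee_addgt0Pr => e e0; have e20 : 0 < e / 2 by lra.
have [X1 HX1] := Hg _ e20.
have [X2 [X21 HX2]] := ln_unbounded (- ln c / (e / 2)).
(* A lower bound for the upper limit takes one point in each neighbourhood [V]; this one also lies
   beyond all thresholds and has [ln r >= 1]. *)
pose r := Num.max (expR 1) (Num.max X (Num.max X1 (Num.max X2 (Y + 1)))).
have : r <= r by [].
rewrite {1}/r !ge_max => /andP[r1 /andP[rX /andP[rX1 /andP[rX2 rY]]]].
have [g0 /ler_normlP[hg _]] := HX1 r rX1; have hC := HX2 r rX2.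
have r0 : 0 < r by apply: lt_le_trans r1; exact: expR_gt0.
have lr1 : 1 <= ln r by rewrite -[leLHS]expRK ler_ln ?posrE ?expR_gt0.
have Vr : V r by apply: HY; lra.
apply: (@le_trans _ _ ((ln (ln (max_circle (fun z => opnorm (M z)) r)) / ln r)%:E + e%:E)%E).
  rewrite -EFinD lee_fin -lerBlDr ler_pdivlMr; last by lra.
  have cg : 0 < c * g r by rewrite mulr_gt0.
  have h1 : expR (c * g r) <= max_circle (fun z => opnorm (M z)) r.
    apply: (le_trans (H r rX)).
    apply: (@ge_circle _ (fun z => opnorm (M z)) r (expR (C * h r))); last exact/normc_imag/ltW.
    by move=> z zr; exact: HC.
  have h2 : c * g r <= ln (max_circle (fun z => opnorm (M z)) r).
    by rewrite -[leLHS]expRK ler_ln ?posrE ?expR_gt0// (lt_le_trans (expR_gt0 _) h1).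
  have h3 : ln (c * g r) <= ln (ln (max_circle (fun z => opnorm (M z)) r)).
    by rewrite ler_ln ?posrE// (lt_le_trans cg).
  apply: le_trans h3; rewrite lnM ?posrE//.
  rewrite ler_pdivrMr// in hC; lra.
by rewrite leeD2r//; apply: ereal_sup_ubound; exists r.
Qed.

End growth.

(** Composition of two asymptotic proportionalities: [N] is the logarithm of the critical index, and
    [G] that of a quantity read off there. *)
Lemma affine_order (R : realType) (N G : R -> R) (beta kap : R) :
  (exists X, forall r, X <= r -> 0 <= N r) ->
  (forall e, 0 < e -> exists X, forall r, X <= r -> `|N r - beta * ln r| <= e * ln r) ->
  (forall e, 0 < e -> exists C X : R, forall r, X <= r ->
     `|G r - kap * N r| <= e * N r + C) ->
  forall e, 0 < e -> exists X, forall r, X <= r ->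
    `|G r - kap * beta * ln r| <= e * ln r.
Proof.
move=> [X0 N0] HN HG e e0.
have k0 : 0 < `|kap| + 1 by rewrite ltr_wpDl.
have b0 : 0 < `|beta| + 1 by rewrite ltr_wpDl.
pose e1 := Num.min 1 (e / (4 * (`|kap| + 1))).
have e10 : 0 < e1 by rewrite lt_min ltr01 divr_gt0// mulr_gt0.
have e11 : e1 <= 1 by rewrite ge_min lexx.
have e12 : e1 * (4 * (`|kap| + 1)) <= e.
  by rewrite -ler_pdivlMr ?mulr_gt0// ge_min lexx orbT.
pose e2 := e / (4 * (`|beta| + 1)).
have e20 : 0 < e2 by rewrite divr_gt0// mulr_gt0.
have e21 : e2 * (4 * (`|beta| + 1)) = e by rewrite divfK// gt_eqF// mulr_gt0.
have [X1 H1] := HN e1 e10; have [C [X2 H2]] := HG e2 e20.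
have e40 : 0 < e / 4 by lra.
have [X3 [X31 H3]] := ln_unbounded (`|C| / (e / 4)).
exists (Num.max X0 (Num.max X1 (Num.max X2 X3))) => r.
rewrite !ge_max => /andP[r0 /andP[r1 /andP[r2 r3]]].
have n0 := N0 r r0; have h1 := H1 r r1; have h2 := H2 r r2; have h3 := H3 r r3.
rewrite ler_pdivrMr// in h3.
have lr0 : 0 <= ln r.
  have : 0 <= ln r * (e / 4) by apply: le_trans h3.
  by rewrite pmulr_lge0.
have -> : G r - kap * beta * ln r = (G r - kap * N r) + kap * (N r - beta * ln r) by ring.
rewrite (le_trans (ler_normD _ _))// normrM.
have k1 : `|kap| * `|N r - beta * ln r| <= `|kap| * (e1 * ln r) by rewrite ler_wpM2l.
have k2 := ler_wpM2r lr0 e12; have k3 := ler_wpM2r lr0 e11.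
have k4 : N r <= (`|beta| + 1) * ln r.
  have := ler_norm (N r - beta * ln r); have := ler_wpM2r lr0 (ler_norm beta); lra.
have k5 := ler_wpM2l (ltW e20) k4.
have k6 : 0 <= e1 * ln r by rewrite mulr_ge0// ltW.
have k7 : e * ln r = e2 * (4 * (`|beta| + 1)) * ln r by rewrite e21.
have := normr_ge0 C; have := ler_norm C; lra.
Qed.

Lemma log_order_asymp (R : realType) (g h : R -> R) (rho C X : R) : 0 < C ->
  log_order g rho -> (forall r, X <= r -> g r <= C * h r /\ h r <= C * g r) ->
  log_order h rho.
Proof.
move=> C0 Hg H e e0; have e20 : 0 < e / 2 by lra.
have [X1 H1] := Hg _ e20.
have [X2 [X21 H2]] := ln_unbounded (`|ln C| / (e / 2)).
exists (Num.max X (Num.max X1 X2)) => r; rewrite !ge_max => /andP[rX /andP[r1 r2]].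
have [g0 hg] := H1 r r1; have := H2 r r2; have [gh hgg] := H r rX.
rewrite ler_pdivrMr// => hC.
have h0 : 0 < h r.
  have : 0 < C * h r by apply: lt_le_trans gh.
  by rewrite pmulr_rgt0.
split => //.
have k1 : ln (g r) <= ln C + ln (h r).
  by rewrite -lnM ?posrE// ler_ln ?posrE// mulr_gt0.
have k2 : ln (h r) <= ln C + ln (g r).
  by rewrite -lnM ?posrE// ler_ln ?posrE// mulr_gt0.
have := ler_norm (ln C); move: hg; rewrite !ler_norml => /andP[a1 a2] a3.
by apply/andP; split; lra.
Qed.

(** Eventually [a] lies between 1/2 and 3/2 of the nonincreasing function, which gives the constant
    3; [nat_growth] with exponent 0 takes in the remaining indices. *)
Lemma equiv_nonincreasing_decays (R : realType) (a : R -> R) : equiv_nonincreasing a ->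
  (forall t, 1 <= t -> 0 < a t) ->
  exists2 C : R, 0 < C & forall i j, (0 < i)%N -> (i <= j)%N -> a j%:R <= C * a i%:R.
Proof.
move=> [g [gni ag]] apos.
have h0 : 0 < 1 / 2 :> R by lra.
have /cvgrPdist_lt/(_ _ h0)[X [_ HX]] := ag.
pose N := (Num.truncn `|X|).+1.
have HN t : N%:R <= t -> 1 / 2 * g t <= a t <= 3 / 2 * g t.
  move=> Nt; have t1 : 1 <= t by apply: le_trans Nt; rewrite ler1n.
  have Xt : X < t.
    by apply: lt_le_trans Nt; apply: le_lt_trans (ler_norm X) (truncnS_gt _).
  have := HX t Xt; rewrite /= ltr_norml => /andP[h1 h2].
  have a0 := apos t t1.
  have g0 : 0 < g t.
    have q : 0 < a t / g t by lra.
    by have := q; rewrite pmulr_rgt0// invr_gt0.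
  by apply/andP; split; [rewrite -ler_pdivlMr//|rewrite -ler_pdivrMr//]; lra.
have Hu j : (0 < j)%N -> 0 < a j%:R by move=> j0; apply: apos; rewrite ler1n.
have [|C C0 HC] := @nat_growth R (fun j => a j%:R) 0 3 N isT ltac:(lra) Hu.
  move=> i j Ni ij; rewrite powRr0 mulr1.
  have NiR : N%:R <= i%:R :> R by rewrite ler_nat.
  have ijR : i%:R <= j%:R :> R by rewrite ler_nat.
  have /andP[i1 i2] := HN i%:R NiR.
  have /andP[j1 j2] := HN j%:R (le_trans NiR ijR).
  have := gni i%:R j%:R ltac:(by rewrite ler1n; exact: leq_trans Ni) ijR.
  lra.
by exists C => // i j i0 ij; have := HC i j i0 ij; rewrite powRr0 mulr1.
Qed.

(** If the inverse stayed below [X], its integer part would take finitely many values, while [r] is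
    at most a multiple of [f] there. *)
Lemma asymptotic_inverse_unbounded (R : realType) (f : R -> R) (alpha X : R) :
  potter f alpha -> 0 < alpha ->
  exists Y, forall r, Y <= r -> X <= asymptotic_inverse f r.
Proof.
move=> pf a0; have [f0 _] := pf.
have [C [X1 [C0 X11 HC]]] := asymptotic_inverseP pf a0.
have [D D0 HD] := finite_bound (fun j => f j%:R) (Num.truncn `|X|).+1.
exists (Num.max X1 (C * D + 1)) => r; rewrite ge_max => /andP[r1 r2].
have [T1 _ h2 _] := HC r r1.
rewrite leNgt; apply/negP => TX.
have nX : (Num.truncn (asymptotic_inverse f r) < (Num.truncn `|X|).+1)%N.
  by rewrite ltnS le_truncn// (le_trans (ltW TX))// ler_norm.
have := HD _ nX; have := ler_pM2l C0; move=> k kD.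
have : C * f (Num.truncn (asymptotic_inverse f r))%:R <= C * D by rewrite ler_pM2l.
lra.
Qed.

(** * Critical indices of the two rates and their orders *)

Section setup.
Variables (R : realType) (l phi : nat -> R) (dlf dpf : R -> R) (dl dp : R).
Hypothesis hH : limit_circle_hamburger l phi.
Hypothesis pl : potter dlf (- dl).
Hypothesis pp : potter dpf (- dp).
Let s j : R := `|sin (phi j.+1 - phi j)|.
Hypothesis hl : asymp \oo l (fun j => dlf j%:R).
Hypothesis hphi : asymp \oo s (fun j => dpf j%:R).

Lemma sin_angle_gt0 j : (0 < j)%N -> 0 < s j.
Proof.
move=> j0; rewrite normr_gt0; apply/eqP => /sin_eq0_pi[k].
by case: hH => _ _ /(_ j k j0).
Qed.

Lemma length_decays : decays l dl.
Proof. by apply: decays_asymp (potter_decays pl) _ hl; case: hH. Qed.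

Lemma angle_decays : decays s dp.
Proof. exact: decays_asymp (potter_decays pp) sin_angle_gt0 hphi. Qed.

Let l0 j : (0 < j)%N -> 0 < l j.
Proof. by case: length_decays => + _; apply. Qed.

Lemma rate_k_bounds : 0 < dl + dp -> exists C X : R, [/\ 0 < C, 1 <= X &
  forall r, X <= r -> let n := Num.truncn (rate_k dlf dpf r) in
    [/\ (0 < n)%N, n%:R <= rate_k dlf dpf r <= 2 * n%:R,
        1 <= C * (r * (l n * s n)) & r * (l n * s n) <= C]].
Proof.
move=> d0; have [dl0 _] := pl; have [dp0 _] := pp.
pose f t := 1 / (dlf t * dpf t).
have pf : potter f (dl + dp).
  apply: (@potter_ext _ (fun t => (dlf t * dpf t)^-1)) => [t|]; first by rewrite /f div1r.
  by have := potterV (potterM pl pp); rewrite opprD !opprK.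
have [C [X [C0 X1 HC]]] := asymptotic_inverseP pf d0.
have [A A0 HA] := asymp_all l0 (fun j j0 => dl0 j%:R ltac:(by rewrite ler1n)) hl.
have [B B0 HB] := asymp_all sin_angle_gt0 (fun j j0 => dp0 j%:R ltac:(by rewrite ler1n)) hphi.
exists (C * (A * B)), X; split => //; first by rewrite !mulr_gt0.
move=> r rX; have := HC r rX; rewrite -[asymptotic_inverse _ _]/(rate_k dlf dpf r).
set T := rate_k _ _ _; set n := Num.truncn T => -[T1 h1 h2 _].
have n0 : (0 < n)%N by rewrite truncn_gt0.
have nT : n%:R <= T by rewrite truncn_le; lra.
have Tn : T < n.+1%:R by exact: truncnS_gt.
have n1 : 1 <= n%:R :> R by rewrite ler1n.
have dln := dl0 n%:R n1; have dpn := dp0 n%:R n1.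
have [l1 l2] := HA n n0; have [s1 s2] := HB n n0.
have ln0 := l0 n0; have sn0 := sin_angle_gt0 n0.
have r0 : 0 <= r by lra.
split => //.
- by rewrite nT/=; rewrite -natr1 in Tn; lra.
- move: h1; rewrite /f ler_pdivrMr ?mulr_gt0// => /le_trans; apply.
  have := ler_pM (ltW dln) (ltW dpn) l2 s2 => k.
  have := ler_wpM2l (mulr_ge0 (ltW C0) r0) k; lra.
move: h2; rewrite /f div1r ler_pdivlMr ?mulr_gt0// => h2.
have := ler_pM (ltW ln0) (ltW sn0) l1 s1 => k.
have := ler_wpM2l r0 k => k2; apply: (le_trans k2).
have AB : 0 <= A * B by rewrite mulr_ge0// ltW.
have := ler_wpM2l AB h2; lra.
Qed.

(** [n r] is the index where [r l] and [s] are comparable. After it the inequality comes from the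
    supremum in the asymptotic inverse, because [dpf / dlf] need not be monotone. *)
Lemma rate_m_bounds : 0 < dl - dp ->
  @measurable_fun _ _ (lebesgueType R) R `[1, +oo[ dlf ->
  exists C X (n : R -> nat), [/\ 0 < C, 1 <= X & forall r, X <= r ->
    [/\ (0 < n r)%N, r * l (n r) <= C * s (n r), s (n r) <= C * (r * l (n r)),
        forall i, (n r < i)%N -> r * l i <= C * s i &
        r * tail l (n r) <= C * rate_m dlf dpf r /\
        rate_m dlf dpf r <= C * (r * tail l (n r))]].
Proof.
move=> d0 mf; have [dl0 _] := pl; have [dp0 _] := pp.
pose f t := dpf t / dlf t.
have pf : potter f (dl - dp).
  by have := potterM pp (potterV pl); rewrite opprK addrC.
have [C [X [C0 X1 HC]]] := asymptotic_inverseP pf d0.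
have [A A0 HA] := asymp_all l0 (fun j j0 => dl0 j%:R ltac:(by rewrite ler1n)) hl.
have [B B0 HB] := asymp_all sin_angle_gt0 (fun j j0 => dp0 j%:R ltac:(by rewrite ler1n)) hphi.
have [E [Y [E0 Y1 HE]]] := integral_tail_asymp hH length_decays pl mf hl.
have [Z HZ] := asymptotic_inverse_unbounded Y pf d0.
pose K := C * (A * B) + A * B + E.
have AB0 : 0 < A * B by rewrite mulr_gt0.
have CAB0 : 0 < C * (A * B) by rewrite mulr_gt0.
exists K, (Num.max X Z), (fun r => Num.truncn (asymptotic_inverse f r)).
split; [by rewrite /K; lra|by rewrite le_max X1|].
move=> r; rewrite ge_max => /andP[rX rZ].
have := HC r rX; set T := asymptotic_inverse f r; set n := Num.truncn T => -[T1 h1 h2 h3].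
have n0 : (0 < n)%N by rewrite truncn_gt0.
have n1 : 1 <= n%:R :> R by rewrite ler1n.
have r0 : 0 <= r by lra.
have mono (a b c : R) : 0 <= b -> c <= K -> a <= c * b -> a <= K * b.
  by move=> b0 cK ab; apply: (le_trans ab); rewrite ler_wpM2r.
have key i : (0 < i)%N -> forall D, 0 < D -> r * dlf i%:R <= D * dpf i%:R ->
    r * l i <= D * (A * B) * s i.
  move=> i0 D D0 h; have [l1 l2] := HA i i0; have [s1 s2] := HB i i0.
  have := ler_wpM2l r0 l1; have := ler_wpM2l (ltW A0) h.
  have AD : 0 <= A * D by rewrite mulr_ge0// ltW.
  have := ler_wpM2l AD s2; lra.
have dln := dl0 n%:R n1; have dpn := dp0 n%:R n1.
have sn := ltW (sin_angle_gt0 n0); have ln0 := ltW (l0 n0).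
have [E1 E2] := HE T (HZ r rZ).
rewrite -/n in E1 E2; split => //.
- apply: (mono _ _ (C * (A * B))) => //; first by rewrite /K; lra.
  by apply: key => //; move: h2; rewrite /f mulrA ler_pdivlMr.
- apply: (mono _ _ (C * (A * B))); [exact: mulr_ge0|by rewrite /K; lra|].
  have [l1 l2] := HA n n0; have [s1 s2] := HB n n0.
  move: h1; rewrite /f ler_pdivrMr// => h1.
  have := ler_wpM2l (ltW B0) h1.
  have BCr : 0 <= B * (C * r) by rewrite !mulr_ge0// ltW.
  have := ler_wpM2l BCr l2; lra.
- move=> i ni; have i0 : (0 < i)%N by exact: leq_trans ni.
  have si := ltW (sin_angle_gt0 i0).
  apply: (mono _ _ (A * B)) => //; first by rewrite /K; lra.
  rewrite -[A * B]mul1r; apply: key => //; rewrite mul1r.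
  have Ti : T < i%:R by apply: lt_le_trans (truncnS_gt _) _; rewrite ler_nat.
  have := h3 _ Ti; rewrite /f ler_pdivlMr//; apply: dl0; lra.
rewrite /rate_m -/f -/T; set F := Rintegral _ _ _ in E1 E2 *.
have t0 := tail_gt0 hH length_decays n.
have F0 : 0 <= F.
  have : 0 <= E * F by lra.
  by rewrite pmulr_rge0.
have EK : E <= K by rewrite /K; lra.
split; apply: (mono _ _ E) => //; rewrite ?mulr_ge0 ?(ltW t0)//.
  by rewrite mulrCA ler_wpM2l.
by rewrite mulrCA ler_wpM2l.
Qed.

End setup.

Lemma ln_abs_le (R : realType) (a b C : R) : 0 < a -> 0 < b -> 0 < C ->
  a <= C * b -> b <= C * a -> `|ln a - ln b| <= `|ln C|.
Proof.
move=> a0 b0 C0 h1 h2; have := ler_norm (ln C).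
have : ln a <= ln C + ln b by rewrite -lnM ?posrE// ler_ln ?posrE// mulr_gt0.
have : ln b <= ln C + ln a by rewrite -lnM ?posrE// ler_ln ?posrE// mulr_gt0.
by move=> k1 k2 k3; rewrite ler_norml; apply/andP; split; lra.
Qed.

(** For [dl = 1] the exponent is 0, and the total length serves as the upper bound in place of
    [tail_le]; [tail_ge] gives the lower bound in all cases. *)
Lemma tail_ln (R : realType) (l phi : nat -> R) (dl : R) :
  limit_circle_hamburger l phi -> decays l dl ->
  forall e, 0 < e -> exists C : R, forall n, (0 < n)%N ->
    `|ln (tail l n) - (1 - dl) * ln n%:R| <= e * ln n%:R + C.
Proof.
move=> hH Hl e e0; have l0 n : (0 < n)%N -> 0 < l n by case: (Hl) => + _; apply.
have [C HC] := decays_ln Hl e0; have [c c0 Hc] := tail_ge hH Hl.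
have dl1 := decay_ge1 hH Hl.
have tpos n := tail_gt0 hH Hl n.
have [D D0 HD] : exists2 D : R, 0 < D & forall n, (0 < n)%N ->
    ln (tail l n) <= ln D + (1 - dl) * ln n%:R + (e * ln n%:R + C).
  have [dl_eq1|dl_neq1] := eqVneq dl 1.
    exists (Num.max 1 (hlen l)); first by rewrite lt_max ltr01.
    move=> n n0; rewrite dl_eq1 subrr mul0r addr0.
    have := HC n n0; have := normr_ge0 (ln (l n) + dl * ln n%:R).
    have : ln (tail l n) <= ln (Num.max 1 (hlen l)).
      rewrite ler_ln ?posrE ?lt_max ?ltr01// le_max; apply/orP; right.
      by rewrite gerBl (hnode_ge0 hH).
    by lra.
  have [D D0 HD] := tail_le hH Hl ltac:(by rewrite lt_neqAle eq_sym dl_neq1).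
  exists D => // n n0; have nR : 0 < n%:R :> R by rewrite ltr0n.
  have : ln (tail l n) <= ln D + (ln n%:R + ln (l n)).
    rewrite -!lnM ?posrE ?mulr_gt0 ?l0//.
    by rewrite ler_ln ?posrE ?mulr_gt0 ?l0// HD.
  by have := HC n n0; rewrite ler_norml => /andP[_]; lra.
exists (`|ln c| + `|ln D| + C) => n n0.
have nR : 0 < n%:R :> R by rewrite ltr0n.
have h1 : ln c + (ln n%:R + ln (l n)) <= ln (tail l n).
  rewrite -!lnM ?posrE ?mulr_gt0 ?l0//.
  by rewrite ler_ln ?posrE ?mulr_gt0 ?l0// Hc.
have h2 := HD n n0; have := HC n n0; rewrite ler_norml => /andP[h3 h4].
have := ler_norm (- ln c); have := ler_norm (ln D); rewrite normrN => k1 k2.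
have := normr_ge0 (ln c); have := normr_ge0 (ln D) => k3 k4.
by rewrite ler_norml; apply/andP; split; lra.
Qed.

Section orders.
Variables (R : realType) (l phi : nat -> R) (dlf dpf : R -> R) (dl dp : R).
Hypothesis hH : limit_circle_hamburger l phi.
Hypothesis pl : potter dlf (- dl).
Hypothesis pp : potter dpf (- dp).
Let s j : R := `|sin (phi j.+1 - phi j)|.
Hypothesis hl : asymp \oo l (fun j => dlf j%:R).
Hypothesis hphi : asymp \oo s (fun j => dpf j%:R).

Let Hl : decays l dl := length_decays hH pl hl.
Let Hs : decays s dp := angle_decays hH pp hphi.
Let l0 j : (0 < j)%N -> 0 < l j.
Proof. by case: Hl => + _; apply. Qed.
Let s0 j : (0 < j)%N -> 0 < s j.
Proof. by case: Hs => + _; apply. Qed.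

(** At [n], the integer part of k(r), [r l_n s_n] is comparable with 1, so ln r is (dl + dp + o(1))
    ln n up to a constant, and this relation is inverted. *)
Lemma rate_k_order : 0 < dl + dp -> log_order (rate_k dlf dpf) (1 / (dl + dp)).
Proof.
move=> d0; have [C [X [C0 X1 HC]]] := rate_k_bounds hH pl pp hl hphi d0.
pose n r := Num.truncn (rate_k dlf dpf r); pose N r : R := ln (n r)%:R.
have N0 r : X <= r -> 0 <= N r.
  by move=> /HC[n0 _ _ _]; rewrite /N ln_ge0// ler1n.
have HN := @inverse_order R N (dl + dp) d0 (ex_intro _ X N0).
have {}HN e : 0 < e -> exists X, forall r, X <= r -> `|N r - (dl + dp)^-1 * ln r| <= e * ln r.
  apply: HN => {}e e0; have e20 : 0 < e / 2 by lra.
  have [C1 H1] := decays_ln Hl e20; have [C2 H2] := decays_ln Hs e20.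
  exists (C1 + C2 + `|ln C|), X => r rX; have [n0 _ h1 h2] := HC r rX.
  rewrite -/(n r) in n0 h1 h2.
  have := H1 _ n0; have := H2 _ n0; rewrite !ler_norml -/(N r) => /andP[a1 a2] /andP[b1 b2].
  have r0 : 0 < r by lra.
  have ls0 : 0 < l (n r) * s (n r) by rewrite mulr_gt0 ?l0 ?s0.
  have : `|ln (r * (l (n r) * s (n r))) - ln 1| <= `|ln C|.
    by apply: ln_abs_le => //; [exact: mulr_gt0|rewrite mulr1].
  rewrite ln1 subr0 !lnM ?posrE ?l0 ?s0// ler_norml => /andP[c1 c2].
  by apply/andP; split; lra.
move=> e e0.
have HG d : 0 < d -> exists C X : R, forall r, X <= r ->
    `|ln (rate_k dlf dpf r) - 1 * N r| <= d * N r + C.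
  move=> d0'; exists `|ln 2|, X => r rX; have [n0 /andP[h1 h2] _ _] := HC r rX.
  rewrite mul1r; have n1 : 0 < (n r)%:R :> R by rewrite ltr0n.
  have k0 : 0 < rate_k dlf dpf r by apply: lt_le_trans h1.
  apply: (@le_trans _ _ `|ln 2|); first by apply: ln_abs_le => //; rewrite -/(n r) in h1; lra.
  by rewrite lerDr mulr_ge0 ?N0// ltW.
have [X2 HX2] := affine_order (ex_intro _ X N0) HN HG e0.
exists (Num.max X X2) => r; rewrite ge_max => /andP[rX rX2].
have [n0 /andP[h1 _] _ _] := HC r rX.
split; first by apply: lt_le_trans h1; rewrite ltr0n.
by rewrite div1r -[_^-1]mul1r; exact: HX2.
Qed.

(** Here ln r is (dl - dp + o(1)) ln n up to a constant, and m(r) is comparable with r times the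
    tail, of order n^(1 - dl); finally 1 + (1 - dl) / (dl - dp) = (1 - dp) / (dl - dp). *)
Lemma rate_m_order : 0 < dl - dp ->
  @measurable_fun _ _ (lebesgueType R) R `[1, +oo[ dlf ->
  log_order (rate_m dlf dpf) ((1 - dp) / (dl - dp)).
Proof.
move=> d0 mf; have [C [X [n [C0 X1 HC]]]] := rate_m_bounds hH pl pp hl hphi d0 mf.
pose N r : R := ln (n r)%:R.
have N0 r : X <= r -> 0 <= N r.
  by move=> /HC[n0 _ _ _ _]; rewrite /N ln_ge0// ler1n.
have HN := @inverse_order R N (dl - dp) d0 (ex_intro _ X N0).
have {}HN e : 0 < e -> exists X, forall r, X <= r -> `|N r - (dl - dp)^-1 * ln r| <= e * ln r.
  apply: HN => {}e e0; have e20 : 0 < e / 2 by lra.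
  have [C1 H1] := decays_ln Hl e20; have [C2 H2] := decays_ln Hs e20.
  exists (C1 + C2 + `|ln C|), X => r rX; have [n0 h1 h2 _ _] := HC r rX.
  have := H1 _ n0; have := H2 _ n0; rewrite !ler_norml -/(N r) => /andP[a1 a2] /andP[b1 b2].
  have r0 : 0 < r by lra.
  have : `|ln (r * l (n r)) - ln (s (n r))| <= `|ln C|.
    by apply: ln_abs_le => //; [rewrite mulr_gt0 ?l0|exact: s0].
  rewrite lnM ?posrE ?l0// ler_norml => /andP[c1 c2].
  by apply/andP; split; lra.
apply: (@log_order_asymp _ (fun r => r * tail l (n r)) _ _ C X) => //; last first.
  by move=> r rX; have [_ _ _ _ [h1 h2]] := HC r rX.
move=> e e0.
have HG d : 0 < d -> exists C X : R, forall r, X <= r ->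
    `|ln (tail l (n r)) - (1 - dl) * N r| <= d * N r + C.
  move=> d0'; have [C' HC'] := tail_ln hH Hl d0'.
  by exists C', X => r rX; have [n0 _ _ _ _] := HC r rX; exact: HC'.
have [X2 HX2] := affine_order (ex_intro _ X N0) HN HG e0.
exists (Num.max X X2) => r; rewrite ge_max => /andP[rX rX2].
have r0 : 0 < r by lra.
have t0 := tail_gt0 hH Hl (n r).
split; first by rewrite mulr_gt0.
rewrite lnM ?posrE//.
have -> : ln r + ln (tail l (n r)) - (1 - dp) / (dl - dp) * ln r =
  ln (tail l (n r)) - (1 - dl) * (dl - dp)^-1 * ln r.
  by field; rewrite gt_eqF.
exact: HX2.
Qed.

End orders.

Lemma decays_to0 (R : realType) (u : nat -> R) (delta e : R) : decays u delta ->
  0 < delta -> 0 < e -> exists N, forall n, (N <= n)%N -> u n <= e.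
Proof.
move=> Hu d0 e0; have d20 : 0 < delta / 2 by lra.
have [C C0 HC] := decays_le_pow Hu d20.
have [N HN] := @pow_unbounded R _ (C / e) d20.
exists N.+1 => n Nn; have n0 : (0 < n)%N by exact: leq_trans Nn.
apply: (le_trans (HC n n0)).
rewrite (_ : - delta + delta / 2 = - (delta / 2)); last by lra.
rewrite powRN ler_pdivrMr ?powR_gt0 ?ltr0n// mulrC -ler_pdivrMr//.
by apply: HN; exact: ltnW.
Qed.

(** A small sine only places an increment near some multiple of pi. Being bounded by a multiple of
    the sine, the increment itself tends to 0; then monotonicity decides the sign of the sine, and
    the cosine is close to 1. *)
Lemma angles_eventually_signed (R : realType) (phi : nat -> R) (dp : R) :
  decays (fun j => `|sin (phi j.+1 - phi j)|) dp -> 0 < dp ->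
  (\forall j \near \oo, phi j <= phi j.+1) \/ (\forall j \near \oo, phi j.+1 <= phi j) ->
  lesssim \oo (fun j => `|phi j.+1 - phi j|) (fun j => `|sin (phi j.+1 - phi j)|) ->
  exists (sg : R) J, sg ^+ 2 = 1 /\ forall j, (J <= j)%N ->
    [/\ 0 <= sg * sin (phi j.+1 - phi j), `|sin (phi j.+1 - phi j)| <= 1 / 4 &
        3 / 4 <= cos (phi j.+1 - phi j)].
Proof.
move=> Hs dp0 mono [C C0 [J1 _ HJ1]].
have q0 : 0 < 1 / 4 :> R by lra.
have /cvgrPdist_lt/(_ _ q0)/nbhs_ballP[d /= d0 Hd] := @continuous_cos R 0.
have pi0 : 0 < pi :> R by exact: pi_gt0.
pose e := Num.min (1 / 4) (Num.min d pi / (2 * C)).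
have dpi : 0 < Num.min d pi by rewrite lt_min d0.
have e0 : 0 < e by rewrite lt_min q0 divr_gt0// mulr_gt0.
have [J2 HJ2] := decays_to0 Hs dp0 e0.
have small j : (maxn J1 J2 <= j)%N -> [/\ `|sin (phi j.+1 - phi j)| <= 1 / 4,
    `|phi j.+1 - phi j| < d & `|phi j.+1 - phi j| < pi].
  rewrite geq_max => /andP[j1 j2]; have h1 := HJ1 j j1; have h2 := HJ2 j j2.
  have e1 : e <= 1 / 4 by rewrite ge_min lexx.
  have e2 : e <= Num.min d pi / (2 * C) by rewrite ge_min lexx orbT.
  rewrite ler_pdivlMr ?mulr_gt0// in e2.
  have h3 : `|phi j.+1 - phi j| < Num.min d pi.
    apply: (le_lt_trans h1).
    have := ler_wpM2l (ltW C0) h2; lra.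
  by move: h3; rewrite lt_min => /andP[? ?]; split => //; lra.
have cosge j : (maxn J1 J2 <= j)%N -> 3 / 4 <= cos (phi j.+1 - phi j).
  move=> /small[_ h _]; have : `|cos 0 - cos (phi j.+1 - phi j)| < 1 / 4.
    by apply: Hd; rewrite /ball/= sub0r normrN.
  by rewrite cos0 ltr_norml => /andP[_]; lra.
case: mono => -[J3 _ HJ3].
  exists 1, (maxn (maxn J1 J2) J3); split; first by rewrite expr1n.
  move=> j; rewrite geq_max => /andP[j12 j3]; have [h1 _ h3] := small j j12.
  split => //; last exact: cosge.
  rewrite mul1r sin_ge0_pi// subr_ge0 (HJ3 j j3)/=.
  by rewrite (le_trans (ler_norm _))// ltW.
exists (-1), (maxn (maxn J1 J2) J3); split; first by rewrite sqrrN expr1n.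
move=> j; rewrite geq_max => /andP[j12 j3]; have [h1 _ h3] := small j j12.
split => //; last exact: cosge.
rewrite mulN1r -sinN sin_ge0_pi// opprB subr_ge0 (HJ3 j j3)/=.
by rewrite (le_trans (ler_norm _))// distrC ltW.
Qed.

(** * Norm bounds in terms of k and m *)

Section bounds.
Variables (R : realType) (l phi : nat -> R) (dlf dpf : R -> R) (dl dp : R).
Variable W : R -> R[i] -> 'M[R[i]]_2.
Hypothesis hH : limit_circle_hamburger l phi.
Hypothesis hW : forall z : R[i],
  is_fundamental_solution (hamburger l phi) (hlen l) z (fun t => W t z).
Hypothesis pl : potter dlf (- dl).
Hypothesis mf : @measurable_fun _ _ (lebesgueType R) R `[1, +oo[ dlf.
Hypothesis pp : potter dpf (- dp).
Let s j : R := `|sin (phi j.+1 - phi j)|.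
Hypothesis hl : asymp \oo l (fun j => dlf j%:R).
Hypothesis hphi : asymp \oo s (fun j => dpf j%:R).
Hypothesis hd : 1 < dl + dp < 2.

Let Hl : decays l dl := length_decays hH pl hl.
Let Hs : decays s dp := angle_decays hH pp hphi.
Let M := W (hlen l).
Let k := rate_k dlf dpf.
Let m := rate_m dlf dpf.

Lemma index_gaps : [/\ 0 < dl + dp, 0 < dl - dp, dp < 1 & 1 <= dl].
Proof. by have := decay_ge1 hH Hl; case/andP: hd => h1 h2; split; lra. Qed.

Lemma opnorm_le_rate_m : exists C X : R, [/\ 0 < C, 1 <= X,
  forall r, X <= r -> 0 <= m r &
  forall r z, X <= r -> normc z = r -> opnorm (M z) <= expR (C * m r)].
Proof.
have [d0 d1 d2 d3] := index_gaps; case/andP: hd => h1 h2.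
have [C [X [n [C0 X1 HC]]]] := rate_m_bounds hH pl pp hl hphi d1 mf.
have [K K0 HK] := opnorm_le_m hH hW Hl Hs C0 h1 h2.
exists (K * C), X; split => //; first exact: mulr_gt0.
  move=> r rX; have [n0 _ _ _ [b1 _]] := HC r rX.
  have : 0 <= C * m r.
    apply: le_trans b1; rewrite mulr_ge0//; first lra.
    exact/ltW/(tail_gt0 hH Hl).
  by rewrite pmulr_rge0.
move=> r z rX zr; have [n0 a1 a2 _ [b1 _]] := HC r rX.
have := HK z (n r) n0; rewrite zr => /(_ a1 a2) /le_trans; apply.
by rewrite ler_expR -mulrA ler_wpM2l// ltW.
Qed.

Lemma opnorm_ge_rate_k : exists c X : R, [/\ 0 < c, 1 <= X &
  forall r, X <= r -> expR (c * k r) <= opnorm (M (Complex 0 r))].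
Proof.
have [d0 d1 d2 d3] := index_gaps.
have [C [X [C0 X1 HC]]] := rate_k_bounds hH pl pp hl hphi d0.
have [c [Y [c0 Y0 HY]]] := opnorm_ge_k hH hW Hl Hs C0 d0.
exists (c / 2), (Num.max X Y); split; [by rewrite divr_gt0|by rewrite le_max X1|].
move=> r; rewrite ge_max => /andP[rX rY]; have [n0 /andP[a1 a2] a3 _] := HC r rX.
apply: le_trans (HY r _ rY n0 a3); rewrite ler_expR.
by have := ler_wpM2l (ltW c0) a2; rewrite -/k; lra.
Qed.

Lemma opnorm_le_rate_k (psi C2 : R) : 0 < C2 -> 1 < dl -> equiv_nonincreasing dpf ->
  (forall j, (1 <= j)%N -> `|sin (phi j - psi)| <= C2 * s j) ->
  exists C X : R, [/\ 0 < C, 1 <= X, forall r, X <= r -> 0 <= k r &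
  forall r z, X <= r -> normc z = r -> opnorm (M z) <= expR (C * k r)].
Proof.
move=> C20 dl1 mono Hpsi; have [d0 d1 d2 d3] := index_gaps.
have [C [X [C0 X1 HC]]] := rate_k_bounds hH pl pp hl hphi d0.
have [dp0 _] := pp.
have [B B0 HB] := asymp_all (sin_angle_gt0 hH)
  (fun j j0 => dp0 j%:R ltac:(by rewrite ler1n)) hphi.
have [D D0 HD] := equiv_nonincreasing_decays mono dp0.
have BDB : 0 < B * D * B by rewrite !mulr_gt0.
have smono i j : (0 < i)%N -> (i <= j)%N -> s j <= B * D * B * s i.
  move=> i0 ij; have [b1 _] := HB j (leq_trans i0 ij); have [_ b2] := HB i i0.
  have := ler_wpM2l (ltW B0) (HD i j i0 ij).
  have BD : 0 <= B * D by rewrite mulr_ge0// ltW.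
  by have := ler_wpM2l BD b2; rewrite -/(s j) -/(s i) in b1 *; lra.
have [K K0 HK] := opnorm_le_k hH hW Hl Hs C0 C20 BDB dl1 Hpsi smono.
exists K, X; split => //.
  by move=> r rX; have [n0 /andP[a1 _] _ _] := HC r rX; apply: le_trans a1.
move=> r z rX zr; have [n0 /andP[a1 _] _ a4] := HC r rX.
have := HK z _ n0; rewrite zr => /(_ a4) /le_trans; apply.
by rewrite ler_expR ler_wpM2l// ltW.
Qed.

Lemma opnorm_ge_rate_m : 0 < dp ->
  (\forall j \near \oo, phi j <= phi j.+1) \/ (\forall j \near \oo, phi j.+1 <= phi j) ->
  lesssim \oo (fun j => `|phi j.+1 - phi j|) s ->
  exists c X : R, [/\ 0 < c, 1 <= X &
  forall r, X <= r -> expR (c * m r) <= opnorm (M (Complex 0 r))].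
Proof.
move=> dpos mono hang; have [d0 d1 d2 d3] := index_gaps.
have [sg [J1 [sg1 Hsg]]] := angles_eventually_signed Hs dpos mono hang.
have [C [X [n [C0 X1 HC]]]] := rate_m_bounds hH pl pp hl hphi d1 mf.
have [c c0 [J0 HJ]] := opnorm_ge_m hH hW Hl Hs C0 d2 sg1 Hsg.
have Hm := rate_m_order hH pl pp hl hphi d1 mf.
have [E E0 HE] := decays_local 2 Hl.
have l0 j : (0 < j)%N -> 0 < l j by case: (Hl) => + _; apply.
(* The lower bound is run from [(n r).+1], where [a3] applies; this leads back to the tail at [n r],
   which is comparable with [m r]. *)
have tS N : (0 < N)%N -> tail l N <= (1 + E) * tail l N.+1.
  move=> N0; have tE : tail l N = tail l N.+1 + l N.+1 by rewrite /tail hnodeS; ring.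
  have [b1 _] := HE N.+1 N.+2 isT (leqnSn _) ltac:(by rewrite mul2n -addnn addSn ltnS leq_addl).
  have b2 := sum_le_tail hH (leqnSn N.+1); rewrite big_nat1 in b2.
  have b3 : l N.+1 <= E * tail l N.+1 by apply: (le_trans b1); rewrite ler_pM2l.
  by rewrite tE; lra.
(* The final halving keeps one factor [expR (c' * m r)] in reserve. It absorbs the constant 1/4 once
   it exceeds 4, and [m r] is unbounded because its order [rho] is positive. *)
pose c' := c / (C * (1 + E)) / 2.
have E1 : 0 < 1 + E by lra.
have c'0 : 0 < c' by rewrite !divr_gt0// mulr_gt0.
pose rho := (1 - dp) / (dl - dp).
have rho0 : 0 < rho by rewrite divr_gt0//; lra.
have rho20 : 0 < rho / 2 by lra.
have [X2 HX2] := Hm _ rho20.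
have [X3 [X31 HX3]] := ln_unbounded (ln (ln 4 / c') / (rho / 2)).
have sJ : 0 < s J0.+1 by exact: (sin_angle_gt0 hH).
exists c', (Num.max X (Num.max X2 (Num.max X3 (C * s J0.+1 / l J0.+1 + 1)))).
split => //; first by rewrite le_max X1.
move=> r; rewrite !ge_max => /andP[rX /andP[r2 /andP[r3 r4]]].
have [n0 _ _ a3 [_ a4]] := HC r rX.
have r0 : 0 < r by lra.
have ln4 : 0 < ln (4 : R) by rewrite ln_gt0; lra.
have Jn : (J0 <= (n r).+1)%N.
  rewrite leqNgt; apply/negP => nJ; have := a3 J0.+1 (leqW (ltnW nJ)).
  by rewrite -ler_pdivlMr ?l0//; rewrite -/(s _); lra.
have hN i : ((n r).+1 <= i)%N -> r * l i <= C * s i by move=> ni; exact: a3.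
apply: le_trans (HJ r (n r).+1 r0 Jn hN).
have [m0 hm] := HX2 r r2.
have mbig : ln 4 <= c' * m r.
  rewrite mulrC -ler_pdivrMr//.
  have h3 := HX3 r r3; rewrite ler_pdivrMr// in h3.
  have l4 : 0 < ln 4 / c' by exact: divr_gt0.
  rewrite -ler_ln ?posrE//; apply: (le_trans h3).
  move: hm; rewrite ler_norml -/rho => /andP[b1 _].
  by move: b1; rewrite -/(m r); lra.
have k1 : 2 * (c' * m r) <= c * (r * tail l (n r).+1).
  have t1 := tS (n r) n0.
  have t2 : m r <= C * (r * ((1 + E) * tail l (n r).+1)).
    by apply: (le_trans a4); rewrite ler_pM2l// ler_pM2l.
  have -> : 2 * (c' * m r) = c * (m r / (C * (1 + E))).
    by rewrite /c'; field; rewrite !gt_eqF.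
  rewrite ler_pM2l// ler_pdivrMr ?mulr_gt0//; lra.
apply: (@le_trans _ _ (1 / 4 * expR (2 * (c' * m r)))); last first.
  by rewrite ler_wpM2l ?ler_expR//; lra.
have -> : 2 * (c' * m r) = c' * m r + c' * m r by ring.
have e4 : 4 <= expR (c' * m r) by rewrite -[leLHS]lnK ?posrE// ler_expR.
rewrite expRD; set e := expR _ in e4 *.
have e0 : 0 <= e by exact: expR_ge0.
have := ler_wpM2l e0 e4; lra.
Qed.

End bounds.

Unset Implicit Arguments.

Theorem theorem1p2 (R : realType) (l phi : nat -> R) (dl dphi : R -> R)
    (deltal deltaphi : R) (W : R -> R[i] -> 'M[R[i]]_2)
    (hH : limit_circle_hamburger l phi)
    (hW : forall z : R[i],
        is_fundamental_solution (hamburger l phi) (hlen l) z (fun t => W t z))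
    (hdl : regularly_varying dl (- deltal))
    (hdphi : regularly_varying dphi (- deltaphi))
    (hl : asymp \oo l (fun j => dl j%:R))
    (hphi : asymp \oo (fun j => `|sin (phi j.+1 - phi j)|)
                      (fun j => dphi j%:R))
    (hmono : equiv_nonincreasing dphi)
    (hdelta : 1 < deltal + deltaphi < 2) :
  let monodromy := W (hlen l) in
  let k := rate_k dl dphi in
  let m := rate_m dl dphi in
  [/\ [/\ lesssim (pinfty_nbhs R) k (log_growth monodromy),
          lesssim (pinfty_nbhs R) (log_growth monodromy) m,
          ((1 / (deltal + deltaphi))%:E <= growth_order monodromy)%E &
          (growth_order monodromy
             <= ((1 - deltaphi) / (deltal - deltaphi))%:E)%E],
      (exists psi C : R, 0 < C /\
          forall j, (1 <= j)%N ->
            `|sin (phi j - psi)| <= C * `|sin (phi j.+1 - phi j)|) ->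
        1 < deltal ->
        asymp (pinfty_nbhs R) (log_growth monodromy) k /\
        growth_order monodromy = (1 / (deltal + deltaphi))%:E
    & ((\forall j \near \oo, phi j <= phi j.+1) \/
       (\forall j \near \oo, phi j.+1 <= phi j)) ->
        asymp \oo (fun j => `|phi j.+1 - phi j|)
                  (fun j => `|sin (phi j.+1 - phi j)|) ->
        asymp \oo (fun j => `|sin (phi j.+1 - phi j)|)
                  (fun j => dphi j%:R) ->
        0 < deltaphi ->
        asymp (pinfty_nbhs R) (log_growth monodromy) m /\
        growth_order monodromy
          = ((1 - deltaphi) / (deltal - deltaphi))%:E].

Proof.
move=> monodromy k m.
have pl := rv_potter hdl; have pp := rv_potter hdphi.
have [_ mf _] := hdl.
have [d0 d1 d2 d3] := index_gaps hH pl hl hdelta.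
have ordk := rate_k_order hH pl pp hl hphi d0.
have ordm := rate_m_order hH pl pp hl hphi d1 mf.
have rhok0 : 0 < 1 / (deltal + deltaphi) by rewrite divr_gt0.
have rhom0 : 0 < (1 - deltaphi) / (deltal - deltaphi) by rewrite divr_gt0// subr_gt0.
have [Cm [Xm [Cm0 Xm1 m0 Hm]]] := opnorm_le_rate_m hH hW pl mf pp hl hphi hdelta.
have [c [X [c0 X1 Hk]]] := opnorm_ge_rate_k hH hW pl pp hl hphi hdelta.
have widen (Y Z : R) : Y <= Num.max Y Z by rewrite le_max lexx.
have widen' (Y Z : R) : Z <= Num.max Y Z by rewrite le_max lexx orbT.
have low_k : lesssim (pinfty_nbhs R) k (log_growth monodromy).
  apply: (@lesssim_log_growth_ge _ monodromy k m c Cm (Num.max Xm X)) => //.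
  - by rewrite (le_trans _ (widen _ _))//; lra.
  - by move=> r rX; apply: m0; exact: le_trans rX.
  - by move=> r z rX; apply: Hm; exact: le_trans rX.
  - by move=> r rX; apply: Hk; exact: le_trans rX.
have ord_low_k : ((1 / (deltal + deltaphi))%:E <= growth_order monodromy)%E.
  apply: (@growth_order_ge _ monodromy k m _ c Cm (Num.max Xm X)) => //.
  - by move=> r z rX; apply: Hm; exact: le_trans rX.
  - by move=> r rX; apply: Hk; exact: le_trans rX.
have Xm0 : 0 <= Xm by lra.
have up_m : lesssim (pinfty_nbhs R) (log_growth monodromy) m.
  exact: (@lesssim_log_growth _ monodromy m Cm Xm).
have ord_up_m : (growth_order monodromy <=
    ((1 - deltaphi) / (deltal - deltaphi))%:E)%E.
  exact: (@growth_order_le _ monodromy m _ Cm Xm).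
split => //.
- move=> [psi [C2 [C20 Hpsi]]] dl1.
  have [Ck [Xk [Ck0 Xk1 k0 HCk]]] :=
    opnorm_le_rate_k hH hW pl pp hl hphi hdelta C20 dl1 hmono Hpsi.
  have Xk0 : 0 <= Xk by lra.
  split; first by split => //; exact: (@lesssim_log_growth _ monodromy k Ck Xk).
  apply/eqP; rewrite eq_le ord_low_k andbT.
  exact: (@growth_order_le _ monodromy k _ Ck Xk).
- move=> mono [hang _] _ dp0.
  have [c' [X' [c'0 X'1 Hm']]] :=
    opnorm_ge_rate_m hH hW pl mf pp hl hphi hdelta dp0 mono hang.
  split.
    split => //; apply: (@lesssim_log_growth_ge _ monodromy m m c' Cm (Num.max Xm X')) => //.
    + by rewrite (le_trans _ (widen _ _)).
    + by move=> r rX; apply: m0; exact: le_trans rX.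
    + by move=> r z rX; apply: Hm; exact: le_trans rX.
    + by move=> r rX; apply: Hm'; exact: le_trans rX.
  apply/eqP; rewrite eq_le ord_up_m/=.
  apply: (@growth_order_ge _ monodromy m m _ c' Cm (Num.max Xm X')) => //.
  + by move=> r z rX; apply: Hm; exact: le_trans rX.
  + by move=> r rX; apply: Hm'; exact: le_trans rX.
Qed.
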